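(* Let $f_\infty\in F$ and let $(f_n)_{n\ge 1}\subset F$ and downward closed polynomial spaces $(V_m)_{m\ge 1}$ on $\Gamma$ satisfy the following assumptions with constants $C_0,C_1,C_2>0$ and exponents $\beta_s>0$, $\beta_w\ge\beta_s$, $\sigma>0$, $\alpha>0$, $\gamma>0$. (A1) For all $n\ge 1$: $\|f_\infty-f_n\|_F\le C_0 n^{-\beta_s}$ and $\|f_\infty-f_n\|_{L^2_\mu(\Gamma)}\le C_0 n^{-\beta_w}$. (A2(2)) For all $m\ge 1$: $\dim V_m\le C_1 m^\sigma$ and $\sup_{f\in F}\dfrac{e_{V_m,2}(f)}{\|f\|_F}\le C_1 m^{-\alpha}$, where $e_{V,2}(f):=\min_{v\in V}\|f-v\|_{L^2_\mu(\Gamma)}$. (A3) The work required for a single evaluation of $f_n$ satisfies $\mathrm{Work}(f_n)\le C_2 n^\gamma$ for all $n\ge 1$. For $L\in\mathbb{N}$ let $\mathcal{S}^{c}_L(f_\infty)$ be the (random) stabilized multilevel weighted least squares approximation and let $\mathrm{Work}(\mathcal{S}^{c}_L(f_\infty))$ be the work it requires for function evaluations, both defined in the context. Define $$\lambda:=\begin{cases}\sigma/\alpha & \text{if }\gamma/\beta_s\le\sigma/\alpha,\\ \theta\gamma/\beta_s+(1-\theta)\sigma/\alpha\ \text{ with }\theta:=\beta_s/\beta_w & \text{if }\gamma/\beta_s>\sigma/\alpha,\end{cases}$$ $$t:=\begin{cases}2&\text{if }\gamma/\beta_s<\sigma/\alpha,\\ 3+\sigma/\alpha&\text{if }\gamma/\beta_s=\sigma/\alpha,\\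 1&\text{if }\gamma/\beta_s>\sigma/\alpha\text{ and }\beta_w=\beta_s,\\ 2&\text{if }\gamma/\beta_s>\sigma/\alpha\text{ and }\beta_w>\beta_s.\end{cases}$$ Let $0<\epsilon\lesssim 1$. Then one may choose $L\in\mathbb{N}$ such that $$\mathbb{E}\,\|f_\infty-\mathcal{S}^{c}_L(f_\infty)\|^2_{L^2_\mu(\Gamma)}\le\epsilon^2$$ and $$\mathrm{Work}(\mathcal{S}^{c}_L(f_\infty))\lesssim\epsilon^{-\lambda}|\log\epsilon|^{t}\log|\log\epsilon|.$$ Here $\lesssim$ denotes an inequality that holds up to a factor depending only on $C_0,C_1,C_2,\alpha,\beta_s,\beta_w,\gamma$.
   Context: Setting. $\Gamma\subset\mathbb{R}^d$, $d\in\mathbb{N}\cup\{\infty\}$, is a (product) domain with a probability measure $\mu$. $(F,\|\cdot\|_F)$ is a normed vector space of continuous functions on $\Gamma$, continuously embedded in $L^2_\mu(\Gamma)$. A space of polynomials is downward closed if it is $\operatorname{span}\{y^\eta=\prod_j y_j^{\eta_j}:\eta\in\mathcal I\}$ for a set $\mathcal I$ of (finitely supported) multi-indices in $\mathbb{N}^d$, $\mathbb{N}=\{0,1,\dots\}$, such that $\eta\in\mathcal I$ and $\eta'\le\eta$ componentwise imply $\eta'\in\mathcal I$. The spaces $V_m$ are finite-dimensional subspaces of $L^2_\mu(\Gamma)$. The indices $n,m\ge 1$ are allowed to take non-integer (real) values. Optimal sampling. For a finite-dimensional polynomial space $V\subset L^2_\mu(\Gamma)$ with $L^2_\mu$-orthonormal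 basis $(B_j)_{j=1}^{m}$, $m=\dim V$, the optimal density is $\rho^*_V(y):=\frac1m\sum_{j=1}^m|B_j(y)|^2$, the optimal weight is $w^*_V:=1/\rho^*_V$, and the optimal sampling distribution $\nu^*_V$ is the probability measure with $\frac{d\nu^*_V}{d\mu}=\rho^*_V$. Stabilized weighted least squares. Given $V$ (with $L^2_\mu$-orthonormal basis $(B_j)$), a weight $w$ and sample points $y_1,\dots,y_N\in\Gamma$, let $\langle g,h\rangle_N:=\frac1N\sum_{j=1}^N w(y_j)g(y_j)h(y_j)$, $\|g\|_N^2:=\langle g,g\rangle_N$, and $\mathbf G:=(\langle B_i,B_j\rangle_N)_{i,j}$. The weighted least squares approximation $\Pi_V f$ is the minimizer of $\|f-v\|_N$ over $v\in V$ (the one of smallest $L^2_\mu(\Gamma)$ norm if not unique). The stabilized version is $\Pi_V^{c}f:=\Pi_V f$ if $\|\mathbf G-\mathbf I\|\le\frac12$ (spectral norm, $\mathbf I$ the identity matrix), and $\Pi_V^{c}f:=0$ otherwise. Multilevel method. Fix $L\in\mathbb{N}$. Let $\delta:=\frac{\beta_w-\beta_s}{\alpha(\gamma+\beta_s)}\ge0$, let $M:=\exp(L\delta)$ if $\gamma/\beta_s>\sigma/\alpha$ and $M:=1$ otherwise. For $k,l\in\{0,\dots,L\}$ put $$m_k:=M\exp\big(k/(\sigma+\alpha)\big),\qquad n_l:=\exp\big(l/(\gamma+\beta_s)\big).$$ For each $k\in\{0,\dots,L\}$ draw independent, identically distributed samples $\Gamma_k=\{y_{k,1},\dots,y_{k,|\Gamma_k|}\}$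 with $y_{k,j}\sim\nu^*_{V_{m_k}}$, where the sample sizes satisfy $$m_k^\sigma\le\kappa\frac{|\Gamma_k|}{\log|\Gamma_k|}\le 2m_k^\sigma,\qquad \kappa:=\frac{1-\log 2}{2+2L}.$$ Let $\Pi^{c}_k$ denote the stabilized weighted least squares approximation onto $V_{m_k}$ with weight $w^*_{V_{m_k}}$ and sample points $\Gamma_k$. With the convention $f_{n_{-1}}:=0$, $$\mathcal{S}^{c}_L(f_\infty):=\sum_{l=0}^L\Pi^{c}_{L-l}\big(f_{n_l}-f_{n_{l-1}}\big).$$ Its evaluation work is $$\mathrm{Work}(\mathcal{S}^{c}_L(f_\infty)):=|\Gamma_L|\,\mathrm{Work}(f_{n_0})+\sum_{l=1}^L|\Gamma_{L-l}|\big(\mathrm{Work}(f_{n_l})+\mathrm{Work}(f_{n_{l-1}})\big).$$ $\mathbb{E}$ is the expectation over the random samples.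
   Formalization: The factors hidden in ≲ (in the work bound and in 0<ε≲1) may depend also on σ and on an upper bound K for ‖f_∞‖_F and ‖f_∞‖_{L²_μ}; with only the listed constants the claim fails, e.g. for f_n=f_∞=R·g with R→∞. *)

(* Defs.v *)
From HB Require Import structures.
From mathcomp Require Import all_boot all_order all_algebra.
From mathcomp Require Import all_classical all_reals all_analysis.

Set Implicit Arguments.
Unset Strict Implicit.
Unset Printing Implicit Defensive.
Import Order.TTheory GRing.Theory Num.Def Num.Theory.
Import numFieldNormedType.Exports.

Local Open Scope classical_set_scope.
Local Open Scope ring_scope.

(* [Some n] is the finite dimension n, [None] is the countably infinite one. *)
Definition coord_index (dim : option nat) : choiceType :=
  if dim is Some n then 'I_n : choiceType else nat : choiceType.

Definition Rdim (R : realType) (dim : option nat) : topologicalType :=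
  {ptws coord_index dim -> R}.

(* A nonempty subset Gamma of R^d as a space in its own right, with the subset
   topology and the Borel sigma-algebra of that topology.  The point y0 is there
   only because measurable types of the library are pointed. *)
Definition domain (R : realType) (dim : option nat) (Gamma : set (Rdim R dim))
  (y0 : Gamma) : Type := Gamma.

Section domain_instances.
Context (R : realType) (dim : option nat) (Gamma : set (Rdim R dim)).
Variable y0 : Gamma.

HB.instance Definition _ := Topological.copy (domain y0) (set_type Gamma).
HB.instance Definition _ := isPointed.Build (domain y0) y0.
HB.instance Definition _ := @isMeasurable.Build
  (sigma_display (@open (domain y0))) (domain y0) <<s (@open (domain y0)) >>
  (@sigma_algebra0 _ setT _) (@sigma_algebraC _ _)
  (@sigma_algebra_bigcup _ setT _).

End domain_instances.

Section polynomials.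
Context (R : realType) (dim : option nat) (Gamma : set (Rdim R dim)).
Context (y0 : Gamma).

Definition multiindex := coord_index dim -> nat.

(* The product is over the (finitely many) factors different from 1. *)
Definition monomial (eta : multiindex) (y : domain y0) : R :=
  \big[*%R/1]_(j \in [set: coord_index dim]) ((val y : coord_index dim -> R) j ^+ eta j).

Definition downward_closed (I : set multiindex) :=
  forall eta eta' : multiindex, I eta -> (forall j, (eta' j <= eta j)%N) ->
  I eta'.

Definition monomial_span (I : set multiindex) : set (domain y0 -> R) :=
  [set v | exists (n : nat) (eta : 'I_n -> multiindex) (c : 'I_n -> R),
     (forall i, I (eta i)) /\ v = fun y => \sum_(i < n) c i * monomial (eta i) y].

Definition downward_closed_polynomial_space (V : set (domain y0 -> R)) :=
  exists I : set multiindex,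
    [/\ forall eta, I eta -> finite_set [set j | eta j != 0%N],
        downward_closed I & V = monomial_span I].

End polynomials.

Section L2.
Context (d : measure_display) (T : measurableType d) (R : realType).
Variable mu : probability T R.

Definition L2norm (f : T -> R) : \bar R := 'N[mu]_2%:E[EFin \o f].

(* The infimum is attained when V is finite dimensional in L^2. *)
Definition best_error (V : set (T -> R)) (f : T -> R) : \bar R :=
  ereal_inf [set L2norm (f \- v) | v in V].

(* B_1, ..., B_n is an orthonormal basis of V, regarded as a subspace of L^2, so
   that n is the dimension of V in L^2.  Equality in L^2 is equality almost
   everywhere; linear independence follows from orthonormality. *)
Definition orthonormal_basis (V : set (T -> R)) (n : nat)
    (B : 'I_n -> T -> R) :=
  [/\ forall i, V (B i),
      forall i j, (\int[mu]_y (B i y * B j y)%:E)%E = ((i == j)%:R)%:E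
    & forall v, V v -> exists c : 'I_n -> R,
        {ae mu, forall y, v y = \sum_(i < n) c i * B i y}].

(* F, identified with functions on T through ev, is continuously embedded in
   L^2: every element is square integrable, distinct elements differ in L^2, and
   the inclusion is bounded. *)
Definition continuously_embedded (F : normedModType R)
    (ev : {linear F -> (T -> R^o)}) :=
  [/\ forall f : F, (ev f : T -> R) \in Lfun mu 2%:E,
      forall f : F, {ae mu, forall y, ev f y = 0} -> f = 0
    & exists K : R, forall f : F, (L2norm (ev f) <= (K * `|f|)%:E)%E].

Definition opt_density (n : nat) (B : 'I_n -> T -> R) (y : T) : R :=
  n%:R^-1 * \sum_(i < n) `|B i y| ^+ 2.

(* The value 0 where the density vanishes (a null set of the sampling
   distribution) is a convention. *)
Definition opt_weight (n : nat) (B : 'I_n -> T -> R) (y : T) : R :=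
  (opt_density B y)^-1.

Definition opt_distribution (n : nat) (B : 'I_n -> T -> R) (A : set T) :
  \bar R := \int[mu]_(y in A) (opt_density B y)%:E.

Definition independent_RVs (d' : measure_display) (Omega : measurableType d')
    (P : probability Omega R) (N : nat) (Y : 'I_N -> {RV P >-> T}) :=
  forall (J : {set 'I_N}) (A : 'I_N -> set T),
    (forall j, measurable (A j)) ->
    P (\bigcap_(j in [set` J]) (Y j @^-1` A j)) =
    (\prod_(j in J) P (Y j @^-1` A j))%E.

Definition iid_optimal_samples (d' : measure_display)
    (Omega : measurableType d') (P : probability Omega R) (n : nat)
    (B : 'I_n -> T -> R) (N : nat) (Y : 'I_N -> {RV P >-> T}) :=
  independent_RVs Y /\
  forall (j : 'I_N) (A : set T), measurable A ->
    distribution P (Y j) A = opt_distribution B A.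

Definition sample_dot (w : T -> R) (N : nat) (ys : 'I_N -> T)
    (g h : T -> R) : R :=
  N%:R^-1 * \sum_(j < N) w (ys j) * g (ys j) * h (ys j).

Definition sample_norm (w : T -> R) (N : nat) (ys : 'I_N -> T) (g : T -> R) : R :=
  Num.sqrt (sample_dot w ys g g).

Definition gram (n : nat) (B : 'I_n -> T -> R) (w : T -> R) (N : nat)
    (ys : 'I_N -> T) : 'M[R]_n :=
  \matrix_(i, j) sample_dot w ys (B i) (B j).

Definition euclidean_norm (n : nat) (x : 'cV[R]_n) : R :=
  Num.sqrt (\sum_(i < n) x i 0 ^+ 2).

Definition spectral_norm (n : nat) (A : 'M[R]_n) : R :=
  sup [set euclidean_norm (A *m x) | x in [set x | euclidean_norm x <= 1]].

Definition least_squares_minimizer (V : set (T -> R)) (w : T -> R) (N : nat)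
    (ys : 'I_N -> T) (f v : T -> R) :=
  V v /\ forall u, V u ->
    sample_norm w ys (f \- v) <= sample_norm w ys (f \- u).

(* Unique only up to almost everywhere equality. *)
Definition least_squares (V : set (T -> R)) (w : T -> R) (N : nat)
    (ys : 'I_N -> T) (f : T -> R) : T -> R :=
  xget (cst 0) [set v | least_squares_minimizer V w ys f v /\
    forall u, least_squares_minimizer V w ys f u -> (L2norm v <= L2norm u)%E].

Definition stabilized_least_squares (V : set (T -> R)) (n : nat)
    (B : 'I_n -> T -> R) (w : T -> R) (N : nat) (ys : 'I_N -> T)
    (f : T -> R) : T -> R :=
  if spectral_norm (gram B w ys - 1%:M) <= 2^-1
  then least_squares V w ys f else cst 0.

End L2.

Section multilevel_parameters.
Context (R : realType).
Variables (alpha beta_s beta_w gamma sigma : R).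

Definition delta : R := (beta_w - beta_s) / (alpha * (gamma + beta_s)).

Definition scaleM (L : nat) : R :=
  if sigma / alpha < gamma / beta_s then expR (L%:R * delta) else 1.

Definition level_m (L k : nat) : R :=
  scaleM L * expR (k%:R / (sigma + alpha)).

Definition level_n (l : nat) : R := expR (l%:R / (gamma + beta_s)).

Definition kappa (L : nat) : R := (1 - ln 2) / (2 + 2 * L%:R).

(* N k is the sample size |Gamma_k|. *)
Definition admissible_sample_sizes (L : nat) (N : nat -> nat) :=
  forall k, (k <= L)%N ->
    level_m L k `^ sigma <= kappa L * ((N k)%:R / ln (N k)%:R)
      <= 2 * level_m L k `^ sigma.

Definition theta : R := beta_s / beta_w.

Definition lambda : R :=
  if gamma / beta_s <= sigma / alpha then sigma / alpha
  else theta * (gamma / beta_s) + (1 - theta) * (sigma / alpha).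

Definition log_exponent : R :=
  if gamma / beta_s < sigma / alpha then 2
  else if gamma / beta_s == sigma / alpha then 3 + sigma / alpha
  else if beta_w == beta_s then 1 else 2.

(* work n is the work of one evaluation of f_n. *)
Definition multilevel_work (work : R -> R) (L : nat) (N : nat -> nat) : R :=
  (N L)%:R * work (level_n 0) +
  \sum_(1 <= l < L.+1)
    (N (L - l)%N)%:R * (work (level_n l) + work (level_n l.-1)).

End multilevel_parameters.

Section multilevel.
Context (d : measure_display) (T : measurableType d) (R : realType).
Variable mu : probability T R.
Variables (alpha beta_s beta_w gamma sigma : R).
Variables (V : R -> set (T -> R)) (dimV : R -> nat).
Variable B : forall m : R, 'I_(dimV m) -> T -> R.
Variables (f : R -> T -> R) (L : nat) (N : nat -> nat).

Local Notation m_ := (level_m alpha beta_s beta_w gamma sigma L).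
Local Notation n_ := (level_n beta_s gamma).

Definition level_difference (l : nat) : T -> R :=
  if l is l'.+1 then f (n_ l) \- f (n_ l') else f (n_ 0).

Definition multilevel_approx (ys : forall k, 'I_(N k) -> T) : T -> R :=
  fun y => \sum_(l < L.+1)
    stabilized_least_squares mu (V (m_ (L - l)%N)) (@B (m_ (L - l)%N))
      (opt_weight (@B (m_ (L - l)%N))) (ys (L - l)%N) (level_difference l) y.

(* The expectation is taken of an extended-real variable, which spares an
   integrability side condition. *)
Definition mean_square_error (d' : measure_display)
    (Omega : measurableType d') (P : probability Omega R)
    (f_inf : T -> R) (Y : forall k, 'I_(N k) -> {RV P >-> T}) : \bar R :=
  (\int[P]_w
     (L2norm mu (f_inf \- multilevel_approx (fun k j => Y k j w))%R ^+ 2))%E.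

End multilevel.

Section assumptions.
Context (d : measure_display) (T : measurableType d) (R : realType).
Variable mu : probability T R.
Context (F : normedModType R).
Variable ev : {linear F -> (T -> R^o)}.

Definition assumption_A1 (C0 beta_s beta_w : R) (f_inf : F) (f : R -> F) :=
  forall n : R, 1 <= n ->
    `|f_inf - f n| <= C0 * n `^ (- beta_s) /\
    (L2norm mu (ev (f_inf - f n)%R) <= (C0 * n `^ (- beta_w))%:E)%E.

Definition assumption_A2 (C1 sigma alpha : R) (V : R -> set (T -> R))
    (dimV : R -> nat) :=
  forall m : R, 1 <= m ->
    (dimV m)%:R <= C1 * m `^ sigma /\
    (ereal_sup [set best_error mu (V m) (ev g) * (`|g|^-1)%:E
               | g in [set g : F | g != 0%R]] <= (C1 * m `^ (- alpha))%:E)%E.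

Definition assumption_A3 (C2 gamma : R) (work : R -> R) :=
  forall n : R, 1 <= n -> work n <= C2 * n `^ gamma.

End assumptions.

(* Main.v *)
(* A Lie-Trotter form of the Golden-Thompson inequality, applied along powers of two,
   bounds the expected trace of (I + t S / q)^q for a sum S of independent rank-one
   matrices.  Letting q grow gives a matrix Chernoff bound, so the Gram matrix G of
   an optimal sample of size N satisfies |G - I| <= 1/2 up to an event of probability
   at most 3 n exp(- N / (16 n)), where n = dim V.  On the good event the empirical
   norm controls the L^2 norm on V, and optimality of the least squares fit bounds
   its error by the empirical and L^2 errors of any fixed v in V, whose expectations
   agree.  The sample sizes make the failure probability decay like exp(- c L ln L),
   which is negligible against the level errors of order exp(- c L).

   The errors of the levels are summed with a weighted Cauchy-Schwarz inequality whose
   weights are the a priori level errors; choosing L of order |log eps| balances the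
   resulting geometric sums. *)
Require Import Defs.
From HB Require Import structures.
From mathcomp Require Import all_boot all_order all_algebra.
From mathcomp Require Import all_classical all_reals all_analysis.
From mathcomp Require Import measurable_realfun simple_functions.
From mathcomp Require Import measurable_fun_approximation.
From mathcomp Require Import ring lra.
Import Order.TTheory GRing.Theory Num.Def Num.Theory.
Import numFieldNormedType.Exports.

Set Implicit Arguments.
Unset Strict Implicit.
Unset Printing Implicit Defensive.

Local Open Scope classical_set_scope.
Local Open Scope ring_scope.

(** * Trace inequalities for symmetric matrices *)

Section trace.
Context (R : realFieldType) (n : nat).
Implicit Types (A B M P Q X Y Z : 'M[R]_n).

(** Spectral theory and the matrix exponential are avoided. Eigenvalues enter only through traces,
    and the exponential of [t S] is replaced by the polynomial [(1 + t S / q) ^ q], whose entries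
    are bounded and polynomial in the sample matrices; independence is then needed only for products
    of bounded functions. Since [q] only has to be large, powers of two suffice, and for them the
    trace inequality follows from AM-GM alone. Two obstacles shape the rest. The basis spans the
    polynomial space only almost everywhere, whereas least squares evaluates functions at points:
    one null set common to the whole space is fixed, and samples hit it with probability zero.
    Moreover the fit is chosen without measurability in the sample, so each random error is bounded
    pointwise by a measurable majorant, whose expectation is estimated. On the failure event the fit
    is 0 and a whole level difference is lost. Its norm is bounded uniformly in the level, and the
    failure probability has to be small against the square of every level error. *)

Lemma mxtraceB m (A B : 'M[R]_m) : \tr (A - B) = \tr A - \tr B.
Proof. by rewrite linearB. Qed.

Lemma mxtrace_mul_tr_ge0 M : 0 <= \tr (M *m M^T).
Proof.
rewrite /mxtrace sumr_ge0// => i _; rewrite mxE sumr_ge0// => j _.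
by rewrite mxE -expr2 sqr_ge0.
Qed.

(** Expand the squared Frobenius norm of [A - B^T]. *)
Lemma mxtrace_mul_AMGM A B :
  \tr (A *m B) *+ 2 <= \tr (A *m A^T) + \tr (B *m B^T).
Proof.
have := mxtrace_mul_tr_ge0 (A - B^T).
rewrite linearB /= trmxK mulmxBl !mulmxBr !mxtraceB.
have -> : \tr (B^T *m A^T) = \tr (A *m B) by rewrite -trmx_mul mxtrace_tr.
by rewrite (mxtrace_mulC B^T B) mulr2n; lra.
Qed.

Lemma trmx_exp M k : (M ^+ k)^T = M^T ^+ k.
Proof.
by elim: k => [|k IH]; rewrite ?expr0 ?trmx1// exprS trmx_mul IH exprSr.
Qed.

Lemma mxtrace_expC A B k : \tr ((A *m B) ^+ k) = \tr ((B *m A) ^+ k).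
Proof.
case: k => [|k]; first by rewrite !expr0.
have -> : (A *m B) ^+ k.+1 = A *m ((B *m A) ^+ k *m B).
  elim: k => [|k IH]; first by rewrite expr1 expr0 mul1mx.
  by rewrite exprS IH exprS -!mulmxE !mulmxA.
by rewrite mxtrace_mulC exprSr -!mulmxE !mulmxA.
Qed.

(* The exponents [2^i] can all be reached from [1] by AM-GM alone: the step
   from [r] to [2r] first passes from [(XY)^(2r)] to [(X^2Y^2)^r]. *)
Lemma mxtrace_expM_le i X Y : X^T = X -> Y^T = Y ->
  \tr ((X *m Y) ^+ (2 ^ i)) <= \tr (X ^+ (2 ^ i) *m Y ^+ (2 ^ i)).
Proof.
elim/ltn_ind: i X Y => -[_ X Y _ _|i IH X Y hX hY]; first by rewrite !expr1.
(* Each pass of the inner induction halves the powers of [M]: cyclicity brings [Q] next to [P], the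
   outer hypothesis at exponent [2 ^ k] separates their powers, and AM-GM merges them, since equal
   powers of [P] and [Q] have the same trace by cyclicity. *)
have step j M : (j <= i)%N ->
    \tr (M ^+ (2 ^ j) *m (M^T) ^+ (2 ^ j)) <= \tr ((M *m M^T) ^+ (2 ^ j)).
  move=> ji.
  suff : forall k, (k <= j)%N -> \tr (M ^+ (2 ^ j) *m (M^T) ^+ (2 ^ j)) <=
      \tr ((M ^+ (2 ^ (j - k)) *m (M^T) ^+ (2 ^ (j - k))) ^+ (2 ^ k)).
    by move=> /(_ j (leqnn j)); rewrite subnn !expr1.
  elim=> [_|k IHk kj]; first by rewrite subn0 expr1.
  apply: le_trans (IHk (ltnW kj)) _.
  have -> : (2 ^ (j - k) = 2 ^ (j - k.+1) + 2 ^ (j - k.+1))%N.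
    by rewrite addnn -mul2n -expnS subnSK.
  set s := (2 ^ (j - k.+1))%N; set t := (2 ^ k)%N.
  rewrite !exprD -!mulmxE.
  have -> : M ^+ s *m M ^+ s *m (M^T ^+ s *m M^T ^+ s) =
            M ^+ s *m (M ^+ s *m M^T ^+ s *m M^T ^+ s) by rewrite !mulmxA.
  rewrite mxtrace_expC -mulmxA.
  set Q := M ^+ s *m M^T ^+ s; set P := M^T ^+ s *m M ^+ s.
  have QT : Q^T = Q by rewrite /Q trmx_mul !trmx_exp trmxK.
  have PT : P^T = P by rewrite /P trmx_mul !trmx_exp trmxK.
  have ki : (k < i.+1)%N by rewrite ltnS (leq_trans (ltnW kj)).
  apply: (le_trans (IH _ ki Q P QT PT)).
  have := mxtrace_mul_AMGM (Q ^+ t) (P ^+ t).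
  rewrite !trmx_exp QT PT !mulmxE -!exprD addnn -mul2n -expnS.
  by rewrite [\tr (P ^+ _)]mxtrace_expC -/Q !mulr2n; lra.
rewrite expnS mulnC exprM -/(expn 2 i) muln2 -addnn.
set r := (2 ^ i)%N; rewrite -exprM muln2 -addnn exprD -mulmxE.
set M := X *m Y.
have MT : M^T = Y *m X by rewrite /M trmx_mul hX hY.
(* AM-GM with both factors [M ^+ r], then [step], leave the r-th power of [X *m X] times [Y *m Y],
   to which the hypothesis at [i] applies. *)
have h1 : \tr (M ^+ r *m M ^+ r) <= \tr (M ^+ r *m (M^T) ^+ r).
  have := mxtrace_mul_AMGM (M ^+ r) (M ^+ r).
  by rewrite !mulr2n trmx_exp; lra.
apply: (le_trans h1); apply: (le_trans (step i M (leqnn i))).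
have -> : M *m M^T = X *m (Y *m Y *m X) by rewrite MT /M !mulmxA.
rewrite mxtrace_expC -mulmxA.
have -> : X ^+ (r + r) = (X *m X) ^+ r by rewrite exprD -exprMn_comm.
have -> : Y ^+ (r + r) = (Y *m Y) ^+ r by rewrite exprD -exprMn_comm.
rewrite mxtrace_expC -/r [leRHS]mxtrace_mulC mxtrace_expC.
by apply: IH; rewrite // trmx_mul ?hX ?hY.
Qed.

(** The maximal absolute row sum is the operator norm for the sup norm on vectors: it is
    submultiplicative and is bounded through the entries, without eigenvalues. *)
Definition row_sum_le M (c : R) := forall i, \sum_j `|M i j| <= c.

Lemma row_sum_leM A B a b : row_sum_le A a -> row_sum_le B b -> 0 <= b ->
  row_sum_le (A *m B) (a * b).
Proof.
move=> hA hB b0 i.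
apply: (@le_trans _ _ (\sum_j \sum_k `|A i k| * `|B k j|)).
  apply: ler_sum => j _; rewrite mxE (le_trans (ler_norm_sum _ _ _))//.
  by under eq_bigr do rewrite normrM.
rewrite exchange_big /=.
under eq_bigr do rewrite -mulr_sumr.
apply: (@le_trans _ _ (\sum_k `|A i k| * b)).
  by apply: ler_sum => k _; apply: ler_wpM2l.
by rewrite -mulr_suml ler_wpM2r.
Qed.

Lemma row_sum_leD A B a b : row_sum_le A a -> row_sum_le B b ->
  row_sum_le (A + B) (a + b).
Proof.
move=> hA hB i; apply: le_trans (lerD (hA i) (hB i)).
by rewrite -big_split /= ler_sum// => j _; rewrite mxE ler_normD.
Qed.

Lemma row_sum_leZ A a k : row_sum_le A a -> row_sum_le (k *: A) (`|k| * a).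
Proof.
move=> hA i; under eq_bigr do rewrite mxE normrM.
by rewrite -mulr_sumr ler_wpM2l.
Qed.

Lemma row_sum_le1 : row_sum_le 1%:M 1.
Proof.
move=> i; rewrite (bigD1 i)//= big1 ?addr0 ?mxE ?eqxx ?normr1// => j /negPf ji.
by rewrite mxE eq_sym ji normr0.
Qed.

Lemma row_sum_leW A a b : a <= b -> row_sum_le A a -> row_sum_le A b.
Proof. by move=> ab hA i; apply: le_trans ab. Qed.

Lemma row_sum_le_entries A a : (forall i j, `|A i j| <= a) ->
  row_sum_le A (n%:R * a).
Proof.
move=> h i; apply: (@le_trans _ _ (\sum_(j < n) a)); first exact: ler_sum.
by rewrite sumr_const card_ord mulr_natl.
Qed.

Lemma row_sum_leX A a k : 0 <= a -> row_sum_le A a ->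
  row_sum_le (A ^+ k) (a ^+ k).
Proof.
move=> a0 hA; elim: k => [|k IH]; first by rewrite !expr0; exact: row_sum_le1.
by rewrite !exprS; apply: row_sum_leM => //; rewrite exprn_ge0.
Qed.

(** Telescoping: [A ^+ k.+1 - B ^+ k.+1] is [A *m (A ^+ k - B ^+ k) + (A - B) *m B ^+ k]. Since
    [1 <= c], the power [c ^+ k] may replace [c ^+ k.-1]. *)
Lemma row_sum_leXB A B c e k : 1 <= c -> row_sum_le A c -> row_sum_le B c ->
  0 <= e -> row_sum_le (A - B) e ->
  row_sum_le (A ^+ k - B ^+ k) (k%:R * c ^+ k * e).
Proof.
move=> c1 hA hB e0 hAB; have c0 : 0 <= c by exact: le_trans c1.
elim: k => [|k IH].
  by rewrite !expr0 subrr mul0r mul0r => i; rewrite big1// => j _; rewrite mxE normr0.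
have -> : A ^+ k.+1 - B ^+ k.+1 = A *m (A ^+ k - B ^+ k) + (A - B) *m B ^+ k.
  by rewrite !exprS -!mulmxE mulmxBr mulmxBl addrA subrK.
apply: (@row_sum_leW _ (c * (k%:R * c ^+ k * e) + e * c ^+ k)).
  rewrite -natr1 exprS.
  have -> : c * (k%:R * c ^+ k * e) + e * c ^+ k =
            c ^+ k * e * (c * k%:R + 1) by ring.
  have -> : (k%:R + 1) * (c * c ^+ k) * e = c ^+ k * e * (c * k%:R + c) by ring.
  by rewrite ler_wpM2l ?mulr_ge0 ?exprn_ge0// lerD2l.
apply: row_sum_leD; apply: row_sum_leM => //.
- by rewrite !mulr_ge0 ?exprn_ge0.
- exact: row_sum_leX.
- by rewrite exprn_ge0.
Qed.

Lemma mxtrace_le_row_sum A a : row_sum_le A a -> `|\tr A| <= n%:R * a.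
Proof.
move=> h; rewrite (le_trans (ler_norm_sum _ _ _))//.
apply: (@le_trans _ _ (\sum_(i < n) a)).
  apply: ler_sum => i _; apply: le_trans (h i).
  by rewrite (bigD1 i)//= lerDl sumr_ge0.
by rewrite sumr_const card_ord mulr_natl.
Qed.

(* A quantitative Golden-Thompson inequality: the two sides differ by the
   Lie-Trotter error, which is of order [1 / q]. *)
Lemma mxtrace_golden_thompson i q A B (a : R) : q = (2 ^ i)%N ->
  A^T = A -> B^T = B -> 0 <= a -> row_sum_le A a -> row_sum_le B a ->
  \tr ((1%:M + q%:R^-1 *: (A + B)) ^+ q) <=
  \tr ((1%:M + q%:R^-1 *: A) ^+ q *m (1%:M + q%:R^-1 *: B) ^+ q) +
  n%:R * ((1 + a / q%:R) ^+ (2 * q) * a ^+ 2 / q%:R).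
Proof.
move=> qE sA sB a0 hA hB.
have q0 : 0 < q%:R :> R by rewrite ltr0n qE expn_gt0.
set X := 1%:M + q%:R^-1 *: A; set Y := 1%:M + q%:R^-1 *: B.
have sX : X^T = X by rewrite /X linearD linearZ /= trmx1 sA.
have sY : Y^T = Y by rewrite /Y linearD linearZ /= trmx1 sB.
have aq0 : 0 <= a / q%:R by rewrite divr_ge0// ltW.
have hX' : row_sum_le (q%:R^-1 *: A) (a / q%:R).
  by rewrite mulrC -{2}(@ger0_norm _ q%:R^-1) ?invr_ge0 ?ltW//; apply: row_sum_leZ.
have hY' : row_sum_le (q%:R^-1 *: B) (a / q%:R).
  by rewrite mulrC -{2}(@ger0_norm _ q%:R^-1) ?invr_ge0 ?ltW//; apply: row_sum_leZ.
have hX : row_sum_le X (1 + a / q%:R) by apply: row_sum_leD => //; exact: row_sum_le1.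
have hY : row_sum_le Y (1 + a / q%:R) by apply: row_sum_leD => //; exact: row_sum_le1.
have e2 : (1 + a / q%:R) ^+ 2 = 1 + (a/q%:R + a/q%:R) + (a / q%:R) ^+ 2 by ring.
have hXY : row_sum_le (X *m Y) ((1 + a / q%:R) ^+ 2).
  by rewrite expr2; apply: row_sum_leM => //; rewrite addr_ge0.
set Z := 1%:M + q%:R^-1 *: (A + B).
have hZ : row_sum_le Z ((1 + a / q%:R) ^+ 2).
  apply: (@row_sum_leW _ (1 + (a/q%:R + a/q%:R))); first by rewrite e2 lerDl sqr_ge0.
  rewrite /Z scalerDr; apply: row_sum_leD; first exact: row_sum_le1.
  exact: row_sum_leD.
(* The defect is of second order, of size [(a / q) ^+ 2]; the q-th power multiplies it by [q], which
   leaves an error of order [1 / q]. *)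
have ZXY : Z - X *m Y = -1 *: ((q%:R^-1 *: A) *m (q%:R^-1 *: B)).
  rewrite /Z /X /Y mulmxDl mul1mx mulmxDr mulmx1 scalerDr scaleN1r.
  move: (_ *m (_ *: B)) => P; move: (_ *: A) (_ *: B) (1%:M : 'M[R]_n) => A' B' I.
  apply/matrixP => u v; rewrite !mxE; move: (A' u v : R) (B' u v : R) (P u v : R) (I u v : R) => x1 x2 x3 x4; ring.
have hd : row_sum_le (Z - X *m Y) ((a / q%:R) ^+ 2).
  have := row_sum_leZ (-1) (row_sum_leM hX' hY' aq0).
  by rewrite -ZXY normrN1 mul1r -expr2.
have := @row_sum_leXB Z (X *m Y) _ _ q _ hZ hXY (sqr_ge0 _) hd.
rewrite e2 -addrA lerDl addr_ge0 ?addr_ge0 ?sqr_ge0// addrA -e2 => /(_ isT) hq.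
have := mxtrace_le_row_sum hq; rewrite linearB /= => /(le_trans (ler_norm _)) h1.
have h2 := mxtrace_expM_le i sX sY; rewrite -qE in h2.
rewrite -lerBlDl.
apply: (@le_trans _ _ (\tr (Z ^+ q) - \tr ((X *m Y) ^+ q))).
  by rewrite lerB.
apply: (le_trans h1).
rewrite ler_wpM2l ?ler0n//.
have -> : (a / q%:R) ^+ 2 = a ^+ 2 / q%:R / q%:R by field; rewrite gt_eqF.
by rewrite -exprM le_eqVlt; apply/orP; left; apply/eqP; field; rewrite gt_eqF.
Qed.

(** Expand the squared Frobenius norm of [M - c *: (x *m x^T)], where [c] is the quadratic form at
    the unit vector [x]. *)
Lemma mxtrace_sandwich_le M (x : 'cV[R]_n) : M^T = M -> \tr (x^T *m x) = 1 ->
  \tr (x^T *m M *m x) ^+ 2 <= \tr (M *m M).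
Proof.
move=> sM x1; set c := \tr _.
have := mxtrace_mul_tr_ge0 (M - c *: (x *m x^T)).
have -> : (M - c *: (x *m x^T))^T = M - c *: (x *m x^T).
  by rewrite linearB linearZ /= trmx_mul trmxK sM.
rewrite mulmxBl !mulmxBr !mxtraceB.
rewrite -!scalemxAl -!scalemxAr !mxtraceZ.
have -> : \tr (M *m (x *m x^T)) = c by rewrite mulmxA mxtrace_mulC mulmxA.
have -> : \tr (x *m x^T *m M) = c by rewrite -mulmxA mxtrace_mulC.
have -> : \tr (x *m x^T *m (x *m x^T)) = 1.
  have -> : x *m x^T *m (x *m x^T) = x *m (x^T *m x) *m x^T by rewrite !mulmxA.
  rewrite mxtrace_mulC [x^T *m x]mx11_scalar.
  move: x1; rewrite {1}/mxtrace big_ord1 => x1.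
  by rewrite x1 mulmx1 /mxtrace big_ord1.
by rewrite !mulr1; lra.
Qed.

(** Expand the squared norm of [M *m x - c *: x]. *)
Lemma sandwich_sqr_le M (x : 'cV[R]_n) : M^T = M -> \tr (x^T *m x) = 1 ->
  \tr (x^T *m M *m x) ^+ 2 <= \tr (x^T *m (M *m M) *m x).
Proof.
move=> sM x1; set c := \tr _.
have : 0 <= \tr ((M *m x - c *: x)^T *m (M *m x - c *: x)).
  by rewrite mxtrace_mulC; have := sqr_ge0 c; rewrite /mxtrace => _;
     apply: sumr_ge0 => i _; rewrite mxE; apply: sumr_ge0 => j _;
     rewrite !mxE -expr2 sqr_ge0.
have -> : (M *m x - c *: x)^T = x^T *m M - c *: x^T.
  by rewrite linearB linearZ /= trmx_mul sM.
rewrite mulmxBl !mulmxBr !mxtraceB.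
rewrite -!scalemxAl -!scalemxAr !mxtraceZ -/c x1.
have -> : \tr (x^T *m (M *m x)) = c by rewrite mulmxA.
have -> : x^T *m M *m (M *m x) = x^T *m (M *m M) *m x by rewrite !mulmxA.
by rewrite mulr1; lra.
Qed.

(** Bounds a power of the top eigenvalue by a trace without diagonalizing: the exponent is doubled
    by [sandwich_sqr_le], and the last doubling passes to the trace by [mxtrace_sandwich_le]. *)
Lemma sandwich_exp_le i M (x : 'cV[R]_n) : M^T = M -> \tr (x^T *m x) = 1 ->
  0 <= \tr (x^T *m M *m x) ->
  \tr (x^T *m M *m x) ^+ (2 ^ i.+1) <= \tr (M ^+ (2 ^ i.+1)).
Proof.
move=> sM x1 c0.
have h k : \tr (x^T *m M *m x) ^+ (2 ^ k) <= \tr (x^T *m M ^+ (2 ^ k) *m x).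
  elim: k => [|k IH]; first by rewrite !expr1.
  rewrite expnS mulnC !exprM.
  apply: le_trans (sandwich_sqr_le _ x1); last by rewrite trmx_exp sM.
  by rewrite lerXn2r// nnegrE ?exprn_ge0//; apply: le_trans IH; rewrite exprn_ge0.
rewrite expnS mulnC !exprM.
apply: le_trans (mxtrace_sandwich_le _ x1); last by rewrite trmx_exp sM.
by rewrite lerXn2r// nnegrE ?exprn_ge0//; apply: le_trans (h i); rewrite exprn_ge0.
Qed.

End trace.

(** * Integration against densities and bounded functions *)

Section density.
Local Open Scope ereal_scope.
Context d d' (T : measurableType d) (T' : measurableType d') (R : realType).
Variables (P : {measure set T -> \bar R}) (nu : {measure set T' -> \bar R}).
Variables (Y : T -> T') (W : T -> R).
Hypotheses (mY : measurable_fun setT Y) (mW : measurable_fun setT W) (W0 : forall x, (0 <= W x)%R).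
Hypothesis nuE : forall A, measurable A -> nu A = \int[P]_(x in Y @^-1` A) (W x)%:E.

Import HBNNSimple.

(** Serves both the change from [mu] to the sampling distribution ([Y] the identity, [W] the
    density) and the decoupling of a sample from a factor ([W] that factor, shifted to be
    nonnegative). The two sides agree on simple functions and pass to the limit by monotone
    convergence. *)
Lemma ge0_integral_density (h : T' -> \bar R) :
  measurable_fun setT h -> (forall y, 0 <= h y) ->
  \int[nu]_y h y = \int[P]_x ((W x)%:E * h (Y x)).
Proof.
move=> mh h0; pose h_ := nnsfun_approx measurableT mh.
have mYf (f : T' -> R) : measurable_fun setT f -> measurable_fun setT (EFin \o f \o Y).
  by move=> mf; apply/measurable_EFinP; exact: measurableT_comp mY.
transitivity (limn (fun n => \int[nu]_y (h_ n y)%:E)).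
  rewrite -monotone_convergence//.
  - apply: eq_integral => y _; apply/esym/cvg_lim => //.
    exact: cvg_nnsfun_approx.
  - by move=> n; exact/measurable_EFinP.
  - by move=> n y _; rewrite lee_fin.
  - by move=> y _ a b ab; rewrite lee_fin; exact/lefP/nd_nnsfun_approx.
rewrite [X in limn X](_ : _ = (fun n => \int[P]_x ((W x)%:E * (h_ n (Y x))%:E))).
  rewrite -monotone_convergence//; last 3 first.
  - by move=> n; apply: emeasurable_funM; [exact/measurable_EFinP|exact: mYf].
  - by move=> n x _; rewrite mule_ge0// lee_fin.
  - by move=> x _ a b ab; rewrite lee_pmul// ?lee_fin//; exact/lefP/nd_nnsfun_approx.
  apply: eq_integral => x _; apply/cvg_lim => //.
  have hx : (h_ n (Y x))%:E @[n --> \oo] --> h (Y x) by exact: cvg_nnsfun_approx.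
  exact: cvgeZl.
apply/funext => n.
have mA r : measurable (h_ n @^-1` [set r]) by [].
under [LHS]eq_integral do rewrite fimfunE -fsumEFin//.
rewrite [LHS]ge0_integral_fsum//; last 2 first.
  - by move=> r; exact/measurable_EFinP/measurableT_comp.
  - by move=> r y _; rewrite EFinM nnfun_muleindic_ge0.
under [RHS]eq_integral.
  move=> x xD; rewrite fimfunE -fsumEFin// ge0_mule_fsumr; last first.
    by move=> r; rewrite EFinM nnfun_muleindic_ge0.
  over.
rewrite [RHS]ge0_integral_fsum//; last 2 first.
  - move=> r; apply: emeasurable_funM; first exact/measurable_EFinP.
    by apply: (mYf (fun y => r * \1_(h_ n @^-1` [set r]) y)%R); exact: measurable_funM.
  - move=> r y _; apply: mule_ge0; first by rewrite lee_fin.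
    by rewrite EFinM nnfun_muleindic_ge0.
apply: eq_fsbigr => r _.
rewrite integralZl_indic_nnsfun// integral_indic// setIT nuE//.
have mYA : measurable (Y @^-1` (h_ n @^-1` [set r])).
  by rewrite -[X in measurable X]setTI; exact: mY.
have [r0|r0] := leP 0%R r; last first.
  have -> : h_ n @^-1` [set r] = set0.
    apply/seteqP; split => // y /= hr; move: r0; rewrite -hr ltNge.
    by rewrite fun_ge0.
  rewrite preimage_set0 integral_set0 mule0.
  under eq_integral do rewrite indic0 mulr0 mule0.
  by rewrite integral0.
under [RHS]eq_integral do rewrite EFinM muleCA.
rewrite ge0_integralZl//; last 2 first.
  - by apply: emeasurable_funM; [exact/measurable_EFinP|exact: mYf].
  - by move=> x _; rewrite mule_ge0// lee_fin.
rewrite integral_mkcond; congr (_ * _); apply: eq_integral => x _.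
rewrite /patch indicE.
have -> : (Y x \in h_ n @^-1` [set r]) = (x \in Y @^-1` (h_ n @^-1` [set r])).
  by apply/idP/idP; rewrite !inE.
by case: ifP => _; rewrite ?mule1 ?mule0.
Qed.

End density.

Section bounded_measurable.
Context d (T : measurableType d) (R : realType).
Implicit Types (f g : T -> R).

(** Closed under sums and products and integrable for every probability, so that polynomials in
    matrix entries carry no integrability conditions. *)
Definition bmeas f := measurable_fun setT f /\ exists c, forall x, `|f x| <= c.

Lemma bmeas_cst c : bmeas (cst c).
Proof. by split => //; exists `|c|. Qed.

Lemma bmeasD f g : bmeas f -> bmeas g -> bmeas (fun x => f x + g x).
Proof.
move=> [mf [a fa]] [mg [b gb]]; split; first exact: measurable_funD.
by exists (a + b) => x; rewrite (le_trans (ler_normD _ _))// lerD.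
Qed.

Lemma bmeasM f g : bmeas f -> bmeas g -> bmeas (fun x => f x * g x).
Proof.
move=> [mf [a fa]] [mg [b gb]]; split; first exact: measurable_funM.
by exists (a * b) => x; rewrite normrM ler_pM.
Qed.

Lemma bmeasZ k f : bmeas f -> bmeas (fun x => k * f x).
Proof. by move=> hf; apply: bmeasM => //; exact: bmeas_cst. Qed.

Lemma bmeas_sum (I : Type) (s : seq I) (p : pred I) (F : I -> T -> R) :
  (forall i, bmeas (F i)) -> bmeas (fun x => \sum_(i <- s | p i) F i x).
Proof.
move=> hF; elim: s => [|i s IH].
  under [X in bmeas X]eq_fun do rewrite big_nil.
  exact: bmeas_cst.
under [X in bmeas X]eq_fun do rewrite big_cons.
by case: (p i) => //; apply: bmeasD.
Qed.

Lemma bmeas_prod (I : Type) (s : seq I) (p : pred I) (F : I -> T -> R) :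
  (forall i, bmeas (F i)) -> bmeas (fun x => \prod_(i <- s | p i) F i x).
Proof.
move=> hF; elim: s => [|i s IH].
  under [X in bmeas X]eq_fun do rewrite big_nil.
  exact: bmeas_cst.
under [X in bmeas X]eq_fun do rewrite big_cons.
by case: (p i) => //; apply: bmeasM.
Qed.

Lemma bmeas_indic (A : set T) : measurable A -> bmeas \1_A.
Proof.
move=> mA; split => //; exists 1 => x.
by rewrite indicE; case: (_ \in _); rewrite ?normr0 ?normr1.
Qed.

Variable P : probability T R.
Local Notation "'EE' f" := (\int[P]_x f x) (at level 10, f at level 9).

Lemma bmeas_integrable f : bmeas f -> P.-integrable setT (EFin \o f).
Proof.
move=> [mf [c fc]]; apply: measurable_bounded_integrable => //.
  by apply: le_lt_trans (probability_le1 P measurableT) _; rewrite ltry.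
exists c; split; first exact: num_real.
by move=> M cM x _; apply: le_trans (ltW cM).
Qed.

Lemma EFin_bmeas f : bmeas f -> (EE f)%:E = (\int[P]_x (f x)%:E)%E.
Proof.
by move=> hf; rewrite /Rintegral fineK//; apply: integrable_fin_num => //; exact: bmeas_integrable.
Qed.

Lemma expectD f g : bmeas f -> bmeas g -> EE (fun x => f x + g x) = EE f + EE g.
Proof. by move=> hf hg; rewrite RintegralD//; exact: bmeas_integrable. Qed.

Lemma expectZ k f : bmeas f -> EE (fun x => k * f x) = k * EE f.
Proof. by move=> hf; rewrite RintegralZl//; exact: bmeas_integrable. Qed.

Lemma expect_cst k : EE (cst k) = k.
Proof. rewrite Rintegral_cst// [X in fine X](_ : _ = 1%E) ?mulr1//.
exact: probability_setT. Qed.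

Lemma expect_sum (I : Type) (s : seq I) (p : pred I) (F : I -> T -> R) :
  (forall i, bmeas (F i)) ->
  EE (fun x => \sum_(i <- s | p i) F i x) = \sum_(i <- s | p i) EE (F i).
Proof.
move=> hF; elim: s => [|i s IH].
  by rewrite big_nil; under eq_Rintegral do rewrite big_nil; rewrite (expect_cst 0).
rewrite big_cons; under eq_Rintegral do rewrite big_cons.
case: (p i) => //; rewrite -IH expectD//; exact: bmeas_sum.
Qed.

Lemma le_expect f g : bmeas f -> bmeas g -> (forall x, f x <= g x) -> EE f <= EE g.
Proof. by move=> hf hg fg; apply: le_Rintegral => //; exact: bmeas_integrable. Qed.

Lemma expect_indic (A : set T) : measurable A -> EE \1_A = fine (P A).
Proof. by move=> mA; rewrite /Rintegral integral_indic// setIT. Qed.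

End bounded_measurable.

Lemma bmeas_comp d d' (T : measurableType d) (T' : measurableType d') (R : realType)
  (f : T' -> R) (Y : {mfun T >-> T'}) : bmeas f -> bmeas (f \o Y).
Proof.
move=> [mf [c fc]]; split; first exact: measurableT_comp.
by exists c => x /=.
Qed.

Section independence.
Context d d' (T : measurableType d) (T' : measurableType d') (R : realType).
Variable P : probability T R.
Local Notation "'EE' f" := (\int[P]_x f x) (at level 10, f at level 9).

(** Adding bounds of [W] and [h] makes both nonnegative. Then [c + w] times the law of [Y] has
    density [W + w] in the sense of [ge0_integral_density], and the added constants cancel after
    expansion. *)
Lemma expect_decouple (W : T -> R) (Y : {mfun T >-> T'}) (c : R) :
  bmeas W ->
  (forall A, measurable A ->
     EE (fun x => W x * \1_A (Y x)) = c * EE (fun x => \1_A (Y x))) ->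
  forall h : T' -> R, bmeas h ->
  EE (fun x => W x * h (Y x)) = c * EE (fun x => h (Y x)).
Proof.
move=> bW hA h bh; have hY : bmeas (fun x => h (Y x)) by exact: (bmeas_comp Y bh).
have cE : c = EE W.
  have := hA setT measurableT; under eq_Rintegral do rewrite indicT mulr1.
  by under [X in _ = _ * X -> _]eq_Rintegral do rewrite indicT;
     rewrite (expect_cst P 1) mulr1 => ->.
have [w hw] := bW.2; have [b hb] := bh.2.
have W0 x : 0 <= W x + w by have := hw x; rewrite ler_norml => /andP[+ _]; lra.
have h0 y : 0 <= h y + b by have := hb y; rewrite ler_norml => /andP[+ _]; lra.
have bW' : bmeas (fun x => W x + w) by apply: bmeasD => //; exact: bmeas_cst.
have bh' : bmeas (fun y => h y + b) by apply: bmeasD => //; exact: bmeas_cst.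
have hY' := @bmeas_comp _ _ _ _ _ _ Y bh'.
have cw0 : 0 <= c + w.
  rewrite cE -[w in leRHS](expect_cst P) -expectD//; last exact: bmeas_cst.
  by rewrite -(expect_cst P 0); apply: le_expect => //; exact: bmeas_cst.
have key : EE (fun x => (W x + w) * (h (Y x) + b)) =
    (c + w) * EE (fun x => h (Y x) + b).
  apply: EFin_inj; rewrite EFinM !EFin_bmeas//; last exact: bmeasM.
  pose nu := mscale (NngNum cw0) (distribution P Y).
  transitivity (\int[nu]_y (h y + b)%:E)%E; last first.
    have mh' : measurable_fun setT (fun y => (h y + b)%:E).
      exact/measurable_EFinP/bh'.1.
    rewrite ge0_integral_mscale//; last by move=> y _; rewrite lee_fin.
    by rewrite ge0_integral_distribution//; move=> y; rewrite lee_fin.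
  under eq_integral do rewrite EFinM.
  apply/esym; apply: (@ge0_integral_density _ _ _ _ _ P nu Y) => //.
  - exact: bW'.1.
  - move=> A mA.
    have mYA : measurable (Y @^-1` A).
      by rewrite -[X in measurable X]setTI; exact: measurable_funP.
    have bA := bmeas_comp Y (bmeas_indic R mA).
    transitivity (\int[P]_x ((W x + w) * \1_A (Y x))%:E)%E; last first.
      rewrite [RHS]integral_mkcond; apply: eq_integral => x _.
      rewrite /patch indicE.
      have -> : (Y x \in A) = (x \in Y @^-1` A) by apply/idP/idP; rewrite !inE.
      by case: ifP => _; rewrite ?mulr1 ?mulr0.
    rewrite -EFin_bmeas; last exact: bmeasM.
    under eq_Rintegral do rewrite mulrDl.
    rewrite expectD; [|exact: bmeasM|exact: bmeasZ].
    rewrite hA// expectZ// -mulrDl.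
    rewrite /nu /mscale/= EFinM; congr (_ * _)%E.
    transitivity (fine (P (Y @^-1` A)))%:E.
      by rewrite fineK// fin_num_measure.
    by rewrite -expect_indic.
  - exact/measurable_EFinP/bh'.1.
have bWh : bmeas (fun x => W x * h (Y x)) by exact: bmeasM.
move: key.
have -> : (fun x => (W x + w) * (h (Y x) + b)) =
   (fun x => W x * h (Y x) + (w * h (Y x) + (b * W x + w * b))).
  by apply/funext => x; ring.
have bwb : @bmeas _ T _ (fun=> w * b) by exact: bmeas_cst.
have b1 : bmeas (fun x => w * h (Y x)) by exact: bmeasZ.
have b2 : bmeas (fun x => b * W x) by exact: bmeasZ.
have b3 : bmeas (fun x => b * W x + w * b) by exact: (bmeasD b2 bwb).
rewrite (expectD P bWh (bmeasD b1 b3)) (expectD P b1 b3) (expectD P b2 bwb).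
have bb : @bmeas _ T _ (fun=> b) by exact: bmeas_cst.
have eb : \int[P]_x b = b by exact: (expect_cst P b).
rewrite !expectZ// (expectD P hY bb) eb -cE => key.
by apply: (addIr (w * EE (fun x => h (Y x)) + (b * c + w * b))); rewrite key; ring.
Qed.

End independence.

(** * Independence *)

Section independent_products.
Context d d' (T : measurableType d) (T' : measurableType d') (R : realType).
Variables (P : probability T R) (N : nat) (Y : 'I_N -> {RV P >-> T'}).
Hypothesis indepY : independent_RVs Y.
Local Notation "'EE' f" := (\int[P]_x f x) (at level 10, f at level 9).

(** Independence is given for events, so indicators come first: the claim for [k] allows any bounded
    functions in the first [k] coordinates and indicators in the others. Each step frees one
    coordinate by [expect_decouple]. *)
Lemma expect_prod_independent (h : 'I_N -> T' -> R) : (forall i, bmeas (h i)) ->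
  EE (fun x => \prod_i h i (Y i x)) = \prod_i EE (fun x => h i (Y i x)).
Proof.
suff H k : (k <= N)%N -> forall h : 'I_N -> T' -> R, (forall i, bmeas (h i)) ->
    (forall i : 'I_N, (k <= i)%N -> exists2 A, measurable A & h i = \1_A) ->
    EE (fun x => \prod_i h i (Y i x)) = \prod_i EE (fun x => h i (Y i x)).
  move=> bh; apply: (H N (leqnn N) h bh) => i.
  by rewrite leqNgt ltn_ord.
elim: k => [_|k IH kN] {}h bh hA.
  have /choice[A hA'] : forall i, exists A, measurable A /\ h i = \1_A.
    by move=> i; have [A mA ->] := hA i (leq0n i); exists A.
  have YA i : (fun x => h i (Y i x)) = \1_(Y i @^-1` A i).
    apply/funext => x; rewrite (hA' i).2 !indicE.
    by congr (_%:R); apply/idP/idP; rewrite !inE.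
  have mYA i : measurable (Y i @^-1` A i).
    by rewrite -[X in measurable X]setTI; apply: measurable_funP => //; case: (hA' i).
  under [RHS]eq_bigr do rewrite YA expect_indic//.
  have -> : (fun x => \prod_i h i (Y i x)) =
      \1_(\bigcap_(j in [set` [set: 'I_N]%SET]) (Y j @^-1` A j)).
    apply/funext => x; rewrite indicE.
    have [xA|xA] := boolP (x \in _).
      rewrite big1// => i _; rewrite -[LHS]/((fun x => h i (Y i x)) x) YA indicE.
      by move: xA; rewrite inE => /(_ i); rewrite /= finset.inE => /(_ isT) ?; rewrite mem_set.
    apply/eqP/prodf_eq0.
    move: xA; rewrite notin_setE => /existsNP[i /not_implyP[_ xi]].
    exists i => //; rewrite -[X in X == _]/((fun x => h i (Y i x)) x) YA indicE.
    by rewrite memNset.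
  have mcap : measurable (\bigcap_(j in [set` [set: 'I_N]%SET]) (Y j @^-1` A j)).
    apply: fin_bigcap_measurable => // *; exact: finite_finset.
  rewrite expect_indic// indepY; last by move=> j; case: (hA' j).
  rewrite (eq_bigr (fun j => (fine (P (Y j @^-1` A j)))%:E)); last first.
    by move=> j _; rewrite fineK// fin_num_measure.
  by rewrite prodEFin /=; apply: eq_bigl => i; rewrite finset.inE.
pose i0 := Ordinal kN.
pose W x := \prod_(i | i != i0) h i (Y i x).
have bW : bmeas W by apply: bmeas_prod => i; exact: bmeas_comp.
have -> : (fun x => \prod_i h i (Y i x)) = (fun x => W x * h i0 (Y i0 x)).
  by apply/funext => x; rewrite (bigD1 i0)//= mulrC.
rewrite (bigD1 i0)//= mulrC; apply: expect_decouple => // A mA.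
pose h' i := if i == i0 then \1_A else h i.
have := IH (ltnW kN) h'; move=> /(_ _ _)/esym e.
transitivity (\prod_i EE (fun x => h' i (Y i x))); last first.
  rewrite (bigD1 i0)//= mulrC /h' eqxx; congr (_ * _).
  by apply: eq_bigr => i /negPf ->.
rewrite e.
- apply: eq_Rintegral => x _; rewrite [RHS](bigD1 i0)//= mulrC /h' eqxx.
  by congr (_ * _); apply: eq_bigr => i /negPf ->.
- by move=> i; rewrite /h'; case: ifP => // _; exact: bmeas_indic.
- move=> i ki; rewrite /h'; have [//|ii0] := eqVneq i i0; first by exists A.
  apply: hA; rewrite ltn_neqAle ki andbT eq_sym; apply: contra ii0 => /eqP ik.
  by apply/eqP/val_inj.
Qed.

(** The algebra spanned by products of bounded functions of the samples in [J]; it stands in for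
    measurability with respect to these samples. *)
Inductive generated_by (J : {pred 'I_N}) : (T -> R) -> Prop :=
| generated_prod (h : 'I_N -> T' -> R) : (forall i, bmeas (h i)) ->
    (forall i, i \notin J -> h i = cst 1) ->
    generated_by J (fun x => \prod_i h i (Y i x))
| generatedD f g : generated_by J f -> generated_by J g ->
    generated_by J (fun x => f x + g x)
| generatedZ k f : generated_by J f -> generated_by J (fun x => k * f x).

Lemma generated_bmeas J f : generated_by J f -> bmeas f.
Proof.
elim=> [h bh _|{}f g _ bf _ bg|k {}f _ bf].
- by apply: bmeas_prod => i; exact: bmeas_comp.
- exact: bmeasD.
- exact: bmeasZ.
Qed.

Lemma generated_cst J k : generated_by J (cst k).
Proof.
have -> : cst k = (fun x : T => k * \prod_(i < N) (cst 1 : T' -> R) (Y i x)).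
  by apply/funext => x; rewrite big1 ?mulr1.
by apply: generatedZ; apply: (@generated_prod J (fun=> cst 1)) => // i; exact: bmeas_cst.
Qed.

Lemma generatedM J f g : generated_by J f -> generated_by J g ->
  generated_by J (fun x => f x * g x).
Proof.
move=> hf; elim: hf g => [h bh hJ|f1 f2 _ IH1 _ IH2|k f1 _ IH] g hg.
- elim: hg => [h' bh' hJ'|g1 g2 _ IH1 _ IH2|k g1 _ IH].
  + have -> : (fun x => \prod_i h i (Y i x) * \prod_i h' i (Y i x)) =
       (fun x => \prod_i (fun y => h i y * h' i y) (Y i x)).
      by apply/funext => x; rewrite -big_split.
    apply: (@generated_prod J (fun i y => h i y * h' i y)) => [i|i iJ].
      exact: bmeasM.
    by rewrite hJ// hJ'//; apply/funext => y; rewrite /= mulr1.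
  + under [X in generated_by _ X]eq_fun do rewrite mulrDr.
    exact: generatedD.
  + under [X in generated_by _ X]eq_fun do rewrite mulrCA.
    exact: generatedZ.
- under [X in generated_by _ X]eq_fun do rewrite mulrDl.
  by apply: generatedD; [exact: IH1|exact: IH2].
- under [X in generated_by _ X]eq_fun do rewrite -mulrA.
  by apply: generatedZ; exact: IH.
Qed.

Lemma generated_sum J (I : Type) (s : seq I) (p : pred I) (F : I -> T -> R) :
  (forall i, p i -> generated_by J (F i)) -> generated_by J (fun x => \sum_(i <- s | p i) F i x).
Proof.
move=> hF; elim: s => [|i s IH].
  have -> : (fun x => \sum_(i <- [::] | p i) F i x) = cst 0.
    by apply/funext => x; rewrite big_nil.
  exact: generated_cst.
have -> : (fun x => \sum_(j <- i :: s | p j) F j x) = (fun x =>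
    if p i then F i x + \sum_(j <- s | p j) F j x else \sum_(j <- s | p j) F j x).
  by apply/funext => x; rewrite big_cons.
by have [pi|//] := boolP (p i); apply: generatedD => //; exact: hF.
Qed.

Lemma generated_fun (J : {pred 'I_N}) i (u : T' -> R) : i \in J -> bmeas u ->
  generated_by J (fun x => u (Y i x)).
Proof.
move=> iJ bu.
have -> : (fun x => u (Y i x)) =
    (fun x => \prod_j (if j == i then u else cst 1) (Y j x)).
  apply/funext => x; rewrite (bigD1 i)//= eqxx big1 ?mulr1// => j /negPf ->.
  by [].
apply: (@generated_prod J (fun j => if j == i then u else cst 1)) => j.
  by case: ifP => // _; exact: bmeas_cst.
by case: eqP => [->|//]; rewrite iJ.
Qed.

Lemma expect_generatedM (J : {pred 'I_N}) j f (u : T' -> R) :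
  j \notin J -> generated_by J f -> bmeas u ->
  EE (fun x => f x * u (Y j x)) = EE f * EE (fun x => u (Y j x)).
Proof.
move=> jJ hf bu; have buY : bmeas (fun x => u (Y j x)) by exact: (bmeas_comp (Y j) bu).
elim: hf => [h bh hJ|f1 f2 g1 IH1 g2 IH2|k f1 g1 IH].
- pose h' i := if i == j then u else h i.
  have e : (fun x => \prod_i h i (Y i x) * u (Y j x)) =
      (fun x => \prod_i h' i (Y i x)).
    apply/funext => x; rewrite (bigD1 j)//= hJ//= mul1r mulrC.
    rewrite [RHS](bigD1 j)//= /h' eqxx; congr (_ * _).
    by apply: eq_bigr => i /negPf ->.
  rewrite e !expect_prod_independent//; last first.
    by move=> i; rewrite /h'; case: ifP.
  rewrite [in LHS](bigD1 j)//= [in RHS](bigD1 j)//= /h' eqxx mulrC; congr (_ * _).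
  rewrite hJ// (expect_cst P 1) mul1r.
  by apply: eq_bigr => i /negPf ->.
- have b1 := generated_bmeas g1; have b2 := generated_bmeas g2.
  under eq_Rintegral do rewrite mulrDl.
  by rewrite (expectD P (bmeasM b1 buY) (bmeasM b2 buY)) IH1 IH2 (expectD P b1 b2) mulrDl.
- have b1 := generated_bmeas g1.
  under eq_Rintegral do rewrite -mulrA.
  by rewrite (expectZ P k (bmeasM b1 buY)) IH (expectZ P k b1) mulrA.
Qed.

End independent_products.

(** * Matrix Chernoff bound *)

(** Put [v = 2 * u ^+ 2 - u]: the product of [1 + u] and [1 + v] is at least 1, and
    [1 + v <= expR v]. This bounds [(1 + z / q) ^+ q] below by nearly [expR z]. *)
Lemma expR_sub_le (R : realType) (u : R) : -2^-1 <= u -> expR (u - 2 * u ^+ 2) <= 1 + u.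
Proof.
move=> u2; have h : 1 <= (1 + u) * (1 + (2 * u ^+ 2 - u)).
  have -> : (1 + u) * (1 + (2 * u ^+ 2 - u)) = 1 + u ^+ 2 * (1 + 2 * u) by ring.
  by rewrite lerDl mulr_ge0 ?sqr_ge0//; lra.
have -> : u - 2 * u ^+ 2 = - (2 * u ^+ 2 - u) by ring.
have u0 : 0 < 1 + u by lra.
rewrite expRN -[leRHS]invrK lef_pV2 ?posrE ?invr_gt0 ?expR_gt0//.
apply: le_trans (expR_ge1Dx _).
by rewrite -(ler_pM2l u0) divff ?gt_eqF.
Qed.

Lemma expR_10V (R : realType) : expR (10^-1 : R) <= 10 / 9.
Proof.
rewrite -[X in expR X]opprK expRN -[leRHS]invrK lef_pV2 ?posrE ?invr_gt0 ?expR_gt0//.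
by apply: le_trans (expR_ge1Dx _); lra.
Qed.

Lemma exists_pow2_ge (R : realType) (b : R) : exists i, b <= (2 ^ i.+1)%N%:R.
Proof.
exists (Num.trunc b); apply: le_trans (ltW (truncnS_gt b)) _.
by rewrite ler_nat ltnW// ltn_expl.
Qed.

Section matrix_chernoff.
Context d d' (T : measurableType d) (T' : measurableType d') (R : realType).
Variables (P : probability T R) (N : nat) (Y : 'I_N -> {RV P >-> T'}).
Hypothesis indepY : independent_RVs Y.
Local Notation "'EE' f" := (\int[P]_x f x) (at level 10, f at level 9).
Variables (n : nat) (X : T' -> 'M[R]_n).
Hypotheses (n_gt0 : (0 < n)%N) (bX : forall a b, bmeas (fun y => X y a b)).
Hypotheses (leX : forall y a b, `|X y a b| <= n%:R) (symX : forall y, (X y)^T = X y).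
Hypothesis sqrX : forall y, X y *m X y = n%:R *: X y.
Hypothesis EX : forall i a b, EE (fun x => X (Y i x) a b) = (a == b)%:R.
Variable t : R.

Let S k x := \sum_(i < N | (i < k)%N) X (Y i x).
Let Z q k x : 'M[R]_n := 1%:M + q%:R^-1 *: (t *: S k x).
Let a := `|t| * (n%:R * (N%:R * n%:R)).
(** Bounds the growth of the expected trace per sample: splitting produces the factor
    [1 + ((1 + t * n / q) ^+ q - 1) / n], to which [1 + x <= expR x] is applied twice. *)
Let r := expR ((expR (t * n%:R) - 1) / n%:R).

Let n0 : 0 < n%:R :> R. Proof. by rewrite ltr0n. Qed.

Let a0 : 0 <= a. Proof. by rewrite !mulr_ge0. Qed.

Lemma chernoff_generated q k m u v :
  generated_by Y [pred i : 'I_N | (i < k)%N] (fun x => (Z q k x ^+ m) u v).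
Proof.
elim: m u v => [|m IH] u v.
  have -> : (fun x => (Z q k x ^+ 0) u v) = cst ((1 : 'M[R]_n) u v).
    by apply/funext => x; rewrite expr0.
  exact: generated_cst.
have -> : (fun x => (Z q k x ^+ m.+1) u v) =
   (fun x => \sum_w Z q k x u w * (Z q k x ^+ m) w v).
  by apply/funext => x; rewrite exprS mxE.
apply: generated_sum => w _; apply: generatedM => //.
have -> : (fun x => Z q k x u w) = (fun x => (1%:M : 'M[R]_n) u w +
    (q%:R^-1 * t) * \sum_(i < N | (i < k)%N) X (Y i x) u w).
  by apply/funext => x; rewrite !mxE summxE mulrA.
apply: generatedD; first exact: (generated_cst _ _ _).
apply: generatedZ; apply: generated_sum => i ik.
exact: (@generated_fun _ _ _ _ _ _ _ _ _ i (fun y => X y u w)).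
Qed.

Let bZ q k m u v : bmeas (fun x => (Z q k x ^+ m) u v).
Proof. exact: generated_bmeas (chernoff_generated q k m u v). Qed.

Let btr q k m : bmeas (fun x => \tr (Z q k x ^+ m)).
Proof. by apply: bmeas_sum. Qed.

Let symS k x : (S k x)^T = S k x.
Proof. by rewrite /S linear_sum /=; apply: eq_bigr => i _; rewrite symX. Qed.

Let symZ q k x : (Z q k x)^T = Z q k x.
Proof. by rewrite /Z linearD linearZ linearZ /= trmx1 symS. Qed.

Let trZ_ge0 q k x i : 0 <= \tr (Z q k x ^+ (2 ^ i.+1)).
Proof.
rewrite expnS mulnC exprM expr2 -{2}(symZ q k x) -trmx_exp.
exact: mxtrace_mul_tr_ge0.
Qed.

Let row_sum_tS k x : row_sum_le (t *: S k x) a.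
Proof.
apply: row_sum_leZ; apply: row_sum_le_entries => u v; rewrite summxE.
apply: le_trans (ler_norm_sum _ _ _) _.
apply: (@le_trans _ _ (\sum_(i < N) n%:R)); last by rewrite sumr_const card_ord mulr_natl.
rewrite [leRHS](bigID (fun i : 'I_N => (i < k)%N))/= -[leLHS]addr0 lerD//; last exact: sumr_ge0.
exact: ler_sum.
Qed.

Let row_sum_tX y : (0 < N)%N -> row_sum_le (t *: X y) a.
Proof.
move=> N0; apply: row_sum_leZ; apply: row_sum_le_entries => u v.
by apply: le_trans (leX y u v) _; rewrite ler_peMl// ler1n.
Qed.

(** As [X y] is [n] times an idempotent, powers of [1%:M + c *: X y] stay affine in [X y], which
    makes their expectation explicit. *)
Let expX c m y : (1%:M + c *: X y) ^+ m = 1%:M + (((1 + c * n%:R) ^+ m - 1) / n%:R) *: X y.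
Proof.
elim: m => [|m IH]; first by rewrite !expr0 subrr mul0r scale0r addr0.
rewrite exprS IH -mulmxE mulmxDl mul1mx mulmxDr mulmx1 -scalemxAl -scalemxAr sqrX.
rewrite !scalerA -addrA -!scalerDl exprS; congr (_ + _ *: _).
by field; rewrite gt_eqF.
Qed.

(** The new sample is split off by the Golden-Thompson inequality. Its factor is affine in [X] and
    decouples from the earlier samples; as [X] has the identity as mean, only diagonal entries of
    the old power survive. *)
Let step i q k : q = (2 ^ i.+1)%N -> (k < N)%N -> 0 <= 1 + t * n%:R / q%:R ->
  EE (fun x => \tr (Z q k.+1 x ^+ q)) <= r * EE (fun x => \tr (Z q k x ^+ q)) +
    n%:R * (expR (2 * a) * a ^+ 2) / q%:R.
Proof.
move=> qE kN qt; pose j := Ordinal kN.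
have q0 : 0 < q%:R :> R by rewrite ltr0n qE expn_gt0.
pose c := ((1 + t * n%:R / q%:R) ^+ q - 1) / n%:R.
pose e := n%:R * (expR (2 * a) * a ^+ 2) / q%:R.
have SS x : S k.+1 x = S k x + X (Y j x).
  rewrite /S (bigD1 j)//= addrC; congr (_ + _); apply: eq_bigl => l.
  by rewrite ltnS leq_eqVlt andb_orl -(inj_eq val_inj) /= andbN /= ; case: ltngtP.
have le1 x : \tr (Z q k.+1 x ^+ q) <=
    (\tr (Z q k x ^+ q) + c * \sum_u \sum_v (Z q k x ^+ q) u v * X (Y j x) v u) + e.
  rewrite /Z SS scalerDr.
  have tS : (t *: S k x)^T = t *: S k x by rewrite linearZ /= symS.
  have tX : (t *: X (Y j x))^T = t *: X (Y j x) by rewrite linearZ /= symX.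
  have N0 : (0 < N)%N by exact: (leq_ltn_trans (leq0n k) kN).
  apply: le_trans (mxtrace_golden_thompson qE tS tX a0 (row_sum_tS k x) (row_sum_tX _ N0)) _.
  apply: lerD.
    rewrite [X in _ *m X](_ : _ = 1%:M + c *: X (Y j x)); last first.
      by rewrite scalerA expX /c; congr (_ + ((1 + _) ^+ _ - 1) / _ *: _); ring.
    rewrite mulmxDr mulmx1 -scalemxAr mxtraceD mxtraceZ lerD2l.
    rewrite (_ : \tr (_ *m _) = \sum_u \sum_v (Z q k x ^+ q) u v * X (Y j x) v u)//.
    by apply: eq_bigr => u _; rewrite mxE.
  have -> : e = n%:R * a ^+ 2 / q%:R * expR (2 * a) by rewrite /e; ring.
  have -> w : n%:R * (w * a ^+ 2 / q%:R) = n%:R * a ^+ 2 / q%:R * w by ring.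
  rewrite ler_wpM2l//; first by rewrite !mulr_ge0 ?sqr_ge0// invr_ge0 ltW.
  have -> : expR (2 * a) = expR (a / q%:R) ^+ (2 * q).
    by rewrite -expRM_natl; congr expR; rewrite natrM; field; rewrite gt_eqF.
  by rewrite lerXn2r ?nnegrE ?expR_ge0 ?expR_ge1Dx// addr_ge0// divr_ge0.
have bZX u v : bmeas (fun x => (Z q k x ^+ q) u v * X (Y j x) v u).
  by apply: bmeasM => //; exact: (bmeas_comp (Y j) (bX v u)).
have bsum u : bmeas (fun x => \sum_v (Z q k x ^+ q) u v * X (Y j x) v u).
  by apply: bmeas_sum => v.
have bs : bmeas (fun x => \sum_u \sum_v (Z q k x ^+ q) u v * X (Y j x) v u).
  by apply: bmeas_sum => u; apply: bsum.
have be : @bmeas _ T _ (fun=> e) by exact: bmeas_cst.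
apply: le_trans (le_expect P (btr _ _ _) (bmeasD (bmeasD (btr _ _ _) (bmeasZ c bs)) be) le1) _.
rewrite (expectD P (bmeasD (btr _ _ _) (bmeasZ c bs)) be) (expectD P (btr _ _ _) (bmeasZ c bs)).
rewrite (expectZ P c bs) [\int[P]_x e](expect_cst P e) lerD2r.
have -> : EE (fun x => \sum_u \sum_v (Z q k x ^+ q) u v * X (Y j x) v u) =
    \sum_u EE (fun x => \sum_v (Z q k x ^+ q) u v * X (Y j x) v u).
  exact: expect_sum.
have -> : \sum_u EE (fun x => \sum_v (Z q k x ^+ q) u v * X (Y j x) v u) =
    EE (fun x => \tr (Z q k x ^+ q)).
  rewrite [RHS](expect_sum P)//; apply: eq_bigr => u _.
  rewrite (expect_sum P)// (bigD1 u)//= big1 ?addr0.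
    rewrite (expect_generatedM indepY _ (chernoff_generated q k q u u) (bX u u)).
      by rewrite EX eqxx mulr1.
    by rewrite inE /= ltnn.
  move=> v vu; rewrite (expect_generatedM indepY _ (chernoff_generated q k q u v) (bX v u)).
    by rewrite EX (negPf vu) mulr0.
  by rewrite inE /= ltnn.
rewrite -[X in X + _]mul1r -mulrDl ler_wpM2r//.
  apply: Rintegral_ge0 => x _; rewrite qE; exact: trZ_ge0.
rewrite /r; apply: le_trans (expR_ge1Dx _); rewrite lerD2l /c ler_wpM2r ?invr_ge0//.
rewrite lerB//.
have -> : expR (t * n%:R) = expR (t * n%:R / q%:R) ^+ q.
  by rewrite -expRM_natl; congr expR; field; rewrite gt_eqF.
by rewrite lerXn2r ?nnegrE ?expR_ge0 ?expR_ge1Dx.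
Qed.

(** Collects the Lie-Trotter errors of [N] steps, crudely but independently of [q]. *)
Let C := n%:R * (expR (2 * a) * a ^+ 2) * N%:R * (1 + r) ^+ N.

Let bound i q : q = (2 ^ i.+1)%N -> 0 <= 1 + t * n%:R / q%:R ->
  EE (fun x => \tr (Z q N x ^+ q)) <= r ^+ N * n%:R + C / q%:R.
Proof.
move=> qE qt; pose e := n%:R * (expR (2 * a) * a ^+ 2) / q%:R.
have q0 : 0 < q%:R :> R by rewrite ltr0n qE expn_gt0.
have e0 : 0 <= e by rewrite !mulr_ge0 ?expR_ge0 ?sqr_ge0// invr_ge0 ltW.
have r0 : 0 < r by exact: expR_gt0.
have H k : (k <= N)%N -> EE (fun x => \tr (Z q k x ^+ q)) <=
    r ^+ k * n%:R + e * k%:R * (1 + r) ^+ k.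
  elim: k => [_|k IH kN].
    rewrite expr0 mul1r mulr0 mul0r addr0.
    have -> : (fun x => \tr (Z q 0 x ^+ q)) = cst n%:R.
      apply/funext => x; rewrite /Z /S big_pred0// scaler0 scaler0 addr0.
      by rewrite expr1n mxtrace1.
    by rewrite expect_cst.
  apply: le_trans (step qE kN qt) _.
  apply: le_trans (lerD (ler_wpM2l (ltW r0) (IH (ltnW kN))) (lexx _)) _.
  rewrite -/e mulrDr -addrA mulrA -exprS lerD2l.
  have rk : 1 <= (1 + r) ^+ k by rewrite exprn_ege1// lerDl ltW.
  rewrite exprS -natr1.
  have -> : e * (k%:R + 1) * ((1 + r) * (1 + r) ^+ k) =
     r * (e * k%:R * (1 + r) ^+ k) + e * (1 + r) ^+ k * (1 + k%:R + r) by ring.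
  rewrite lerD2l -mulrA ler_peMr// mulr_ege1// -addrA lerDl addr_ge0// ltW//.
by apply: le_trans (H N (leqnn N)) _; rewrite lerD2l /e /C le_eqVlt; apply/orP; left; apply/eqP; ring.
Qed.

(** The Laplace transform method with a polynomial in place of the exponential. A majorant [F] of
    the event is produced instead of a probability, so that the event itself need not be measurable;
    the sign of [t] selects upper or lower deviations. *)
Lemma matrix_chernoff (s : R) : exists F : T -> R,
  [/\ bmeas F, forall x, 0 <= F x,
      EE F <= 3 / 2 * (n%:R * expR (N%:R * ((expR (t * n%:R) - 1) / n%:R) - t * s))
    & forall x (u : 'cV[R]_n), \tr (u^T *m u) = 1 ->
      t * s <= t * \tr (u^T *m (\sum_i X (Y i x)) *m u) -> 1 <= F x].
Proof.
pose z := t * s.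
have rN0 : 0 < r ^+ N * n%:R by rewrite mulr_gt0// exprn_gt0// expR_gt0.
have C0 : 0 <= C.
  by rewrite !mulr_ge0 ?expR_ge0 ?sqr_ge0// exprn_ge0// addr_ge0// expR_ge0.
(* The four summands make, in order, [1 + t * n / q] nonnegative, [z / q] at least [- 1/2], the loss
   [2 * z ^+ 2 / q] at most [1/10], and the error [C / q] at most a quarter of the main term. The
   resulting factors [10/9] and [5/4] multiply to less than [3/2]. *)
have [i hi] := exists_pow2_ge (`|t| * n%:R + 2 * `|z| + 20 * z ^+ 2 + 4 * (C / (r ^+ N * n%:R))).
move qE : (2 ^ i.+1)%N hi => q hi; symmetry in qE.
have q0 : 0 < q%:R :> R by rewrite ltr0n qE expn_gt0.
have p1 : 0 <= `|t| * n%:R by rewrite mulr_ge0.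
have p2 : 0 <= `|z| by [].
have p3 : 0 <= z ^+ 2 by exact: sqr_ge0.
have p4 : 0 <= C / (r ^+ N * n%:R) by rewrite divr_ge0// ltW.
have qt : 0 <= 1 + t * n%:R / q%:R.
  rewrite -(pmulr_rge0 _ q0) mulrDr mulr1 mulrC divfK ?gt_eqF//.
  have : `|t * n%:R| <= q%:R by rewrite normrM (ger0_norm (ltW n0)); lra.
  by rewrite ler_norml => /andP[]; lra.
have zq : - 2^-1 <= z / q%:R.
  rewrite ler_pdivlMr//; have : `|z| <= q%:R / 2 by lra.
  by rewrite ler_norml => /andP[]; lra.
have w0 : 0 < 1 + z / q%:R by lra.
exists (fun x => (1 + z / q%:R) ^- q * \tr (Z q N x ^+ q)); split.
- exact: bmeasZ.
- by move=> x; rewrite mulr_ge0// ?invr_ge0 ?exprn_ge0 ?(ltW w0)// qE.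
- rewrite (expectZ P _ (btr _ _ _)).
  apply: le_trans (ler_wpM2l _ (bound qE qt)) _.
    by rewrite invr_ge0 exprn_ge0 ?(ltW w0).
  have h1 : (1 + z / q%:R) ^- q <= expR (- z) * (10 / 9).
    have h2 : expR (z - 10^-1) <= (1 + z / q%:R) ^+ q.
      apply: (@le_trans _ _ (expR (z / q%:R - 2 * (z / q%:R) ^+ 2) ^+ q)).
        rewrite -expRM_natl ler_expR.
        have -> : q%:R * (z / q%:R - 2 * (z / q%:R) ^+ 2) = z - 2 * (z ^+ 2 / q%:R).
          by field; rewrite gt_eqF.
        rewrite lerD2l lerN2.
        have : z ^+ 2 / q%:R <= 20^-1 by rewrite ler_pdivrMr//; lra.
        by lra.
      by rewrite lerXn2r ?nnegrE ?expR_ge0 ?(ltW w0)// expR_sub_le.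
    apply: (@le_trans _ _ (expR (z - 10^-1))^-1).
      by rewrite lef_pV2 ?posrE ?expR_gt0 ?exprn_gt0.
    by rewrite -expRN opprB addrC expRD ler_wpM2l ?expR_ge0 ?expR_10V.
  apply: (@le_trans _ _ (expR (- z) * (10 / 9) * (r ^+ N * n%:R * (5 / 4)))).
    rewrite ler_pM ?invr_ge0 ?exprn_ge0 ?(ltW w0)//.
      by rewrite addr_ge0 ?(ltW rN0)// divr_ge0// ltW.
    have -> : r ^+ N * n%:R * (5 / 4) = r ^+ N * n%:R + r ^+ N * n%:R / 4 by field.
    rewrite lerD2l ler_pdivrMr//.
    have h4 : 4 * (C / (r ^+ N * n%:R)) <= q%:R by lra.
    apply: le_trans (ler_wpM2l (_ : 0 <= r ^+ N * n%:R / 4) h4); last by rewrite divr_ge0// ltW.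
    move: (r ^+ N * n%:R) rN0 => D D0.
    by rewrite le_eqVlt; apply/orP; left; apply/eqP; field; rewrite gt_eqF.
  have -> : expR (N%:R * ((expR (t * n%:R) - 1) / n%:R) - t * s) = r ^+ N * expR (- z).
    by rewrite expRD expRM_natl.
  have : 0 <= r ^+ N * n%:R * expR (- z) by rewrite mulr_ge0 ?expR_ge0// ltW.
  by lra.
- move=> x u u1 hu; rewrite mulrC ler_pdivlMr ?exprn_gt0// mul1r.
  have tu : \tr (u^T *m Z q N x *m u) = 1 + t * \tr (u^T *m (\sum_i X (Y i x)) *m u) / q%:R.
    rewrite /Z mulmxDr mulmx1 mulmxDl linearD /= u1; congr (_ + _).
    rewrite -!scalemxAr -!scalemxAl !linearZ /= mulrC; congr (_ * \tr (_ *m _ *m _) / _).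
    by rewrite /S; apply: eq_bigl => l; rewrite ltn_ord.
  have tu0 : 1 + z / q%:R <= \tr (u^T *m Z q N x *m u).
    by rewrite tu lerD2l ler_wpM2r// invr_ge0 ltW.
  have tu1 : 0 <= \tr (u^T *m Z q N x *m u) by apply: le_trans tu0; exact: ltW.
  apply: (@le_trans _ _ (\tr (u^T *m Z q N x *m u) ^+ q)).
    by rewrite lerXn2r ?nnegrE ?(ltW w0).
  by have := sandwich_exp_le i (symZ q N x) u1 tu1; rewrite -qE.
Qed.

End matrix_chernoff.

(** * Spectral norm *)

Section euclidean.
Context (R : realType) (n : nat).
Implicit Types (A H : 'M[R]_n) (x y : 'cV[R]_n).

Let trZ (b : R) x : (b *: x)^T = b *: x^T.
Proof. by apply/matrixP => i j; rewrite !mxE. Qed.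

Let trD x y : (x + y)^T = x^T + y^T.
Proof. by apply/matrixP => i j; rewrite !mxE. Qed.

Lemma mxtrace_sqr x : \tr (x^T *m x) = \sum_i x i 0 ^+ 2.
Proof.
rewrite /mxtrace big_ord1 mxE; apply: eq_bigr => i _.
by rewrite mxE -expr2.
Qed.

Lemma mxtrace_sqr_ge0 x : 0 <= \tr (x^T *m x).
Proof. by rewrite mxtrace_sqr sumr_ge0// => i _; rewrite sqr_ge0. Qed.

Lemma mxtrace_sqr_eq0 x : \tr (x^T *m x) = 0 -> x = 0.
Proof.
rewrite mxtrace_sqr => /eqP; rewrite psumr_eq0; last by move=> i _; exact: sqr_ge0.
move=> /allP h; apply/matrixP => i j; rewrite ord1 mxE.
by have := h i (mem_index_enum i); rewrite /= sqrf_eq0 => /eqP.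
Qed.

Lemma euclidean_normE x : euclidean_norm x = Num.sqrt (\tr (x^T *m x)).
Proof. by rewrite /euclidean_norm mxtrace_sqr. Qed.

Lemma euclidean_norm_sqr x : euclidean_norm x ^+ 2 = \tr (x^T *m x).
Proof. by rewrite euclidean_normE sqr_sqrtr// mxtrace_sqr_ge0. Qed.

Lemma spectral_norm_le A c : 0 <= c ->
  (forall x, \tr (x^T *m x) <= 1 ->
    \tr ((A *m x)^T *m (A *m x)) <= c ^+ 2) -> spectral_norm A <= c.
Proof.
move=> c0 h; apply: ge_sup.
  exists (euclidean_norm (A *m 0)); exists 0 => //=.
  by rewrite euclidean_normE mulmx0 mxtrace0 sqrtr0.
move=> _ [x /= x1 <-]; rewrite -(@ler_pXn2r _ 2%N)// ?nnegrE ?sqrtr_ge0//.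
rewrite euclidean_norm_sqr; apply: h; rewrite -euclidean_norm_sqr.
by rewrite expr_le1// sqrtr_ge0.
Qed.

Lemma le_spectral_norm A x : euclidean_norm x <= 1 ->
  euclidean_norm (A *m x) <= spectral_norm A.
Proof.
move=> x1; apply: ub_le_sup; last by exists x.
pose c := \sum_i \sum_j `|A i j|.
have c0 : 0 <= c by apply: sumr_ge0 => i _; exact: sumr_ge0.
exists (Num.sqrt (n%:R * c ^+ 2)) => _ [y /= y1 <-].
rewrite euclidean_normE ler_wsqrtr// mxtrace_sqr.
apply: (@le_trans _ _ (\sum_(i < n) c ^+ 2)); last first.
  by rewrite sumr_const card_ord mulr_natl.
apply: ler_sum => i _; rewrite -[leLHS]real_normK ?num_real// lerXn2r ?nnegrE//.
rewrite mxE; apply: le_trans (ler_norm_sum _ _ _) _.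
apply: (@le_trans _ _ (\sum_j `|A i j|)).
  apply: ler_sum => j _; rewrite normrM ler_piMr//.
  rewrite -(@expr_le1 _ 2%N)// real_normK ?num_real//.
  have : euclidean_norm y ^+ 2 <= 1 by rewrite expr_le1// sqrtr_ge0.
  rewrite euclidean_norm_sqr mxtrace_sqr; apply: le_trans.
  by rewrite (bigD1 j)//= lerDl sumr_ge0// => l _; exact: sqr_ge0.
by rewrite /c [leRHS](bigD1 i)//= lerDl sumr_ge0// => l _; exact: sumr_ge0.
Qed.

(** With [g] the squared norm of [H *m x], adding the upper form bound at [x + 2 *: (H *m x)] to the
    lower one at [x - 2 *: (H *m x)] leaves [8 * g <= 1 + 4 * g]. *)
Lemma spectral_norm_half H : H^T = H ->
  (forall x, \tr (x^T *m x) = 1 -> `|\tr (x^T *m H *m x)| <= 2^-1) ->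
  spectral_norm H <= 2^-1.
Proof.
move=> sH h.
have h' y : `|\tr (y^T *m H *m y)| <= 2^-1 * \tr (y^T *m y).
  have [y0|yN0] := eqVneq (\tr (y^T *m y)) 0.
    by rewrite (mxtrace_sqr_eq0 y0) !mulmx0 mxtrace0 normr0 mulr0.
  have yp : 0 < \tr (y^T *m y) by rewrite lt_def yN0 mxtrace_sqr_ge0.
  pose s := (Num.sqrt (\tr (y^T *m y)))^-1.
  have s2 : s ^+ 2 = (\tr (y^T *m y))^-1 by rewrite /s exprVn sqr_sqrtr ?ltW.
  have := h (s *: y); rewrite trZ -!scalemxAl -!scalemxAr !mxtraceZ.
  rewrite mulrA -expr2 s2 mulVf// => /(_ erefl).
  rewrite mulrA -expr2 s2 normrM normfV [X in X^-1]ger0_norm ?(ltW yp)//.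
  by rewrite ler_pdivrMl// mulrC.
apply: spectral_norm_le => // x x1.
set g := \tr _.
have g0 : 0 <= g by exact: mxtrace_sqr_ge0.
have xHHx : \tr (x^T *m H *m (H *m x)) = g by rewrite /g trmx_mul sH.
have e1 (b : R) : \tr ((x + b *: (H *m x))^T *m H *m (x + b *: (H *m x))) =
    \tr (x^T *m H *m x) + 2 * b * g + b ^+ 2 * \tr ((H *m x)^T *m H *m (H *m x)).
  rewrite trD trZ !mulmxDl !mulmxDr -!scalemxAl -!scalemxAr !mxtraceD.
  rewrite !mxtraceZ xHHx.
  have -> : \tr ((H *m x)^T *m H *m x) = g by rewrite -mulmxA.
  by ring.
have e2 (b : R) : \tr ((x + b *: (H *m x))^T *m (x + b *: (H *m x))) =
    \tr (x^T *m x) + 2 * b * \tr (x^T *m (H *m x)) + b ^+ 2 * g.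
  rewrite trD trZ !mulmxDl !mulmxDr -!scalemxAl -!scalemxAr !mxtraceD.
  rewrite !mxtraceZ -/g.
  have -> : \tr ((H *m x)^T *m x) = \tr (x^T *m (H *m x)).
    by rewrite -mxtrace_tr trmx_mul trmxK.
  by ring.
have := h' (x + 2 *: (H *m x)); have := h' (x + (-2) *: (H *m x)).
rewrite !e1 !e2 !ler_norml => /andP[h1 _] /andP[_ h2].
by lra.
Qed.

(** For a unit vector [u] and [H = A - 1], expand the squared norm of [H *m u + 2^-1 *: u], where
    [H *m u] has squared norm at most 1/4. *)
Lemma sandwich_ge_half A x : spectral_norm (A - 1%:M) <= 2^-1 ->
  2^-1 * \tr (x^T *m x) <= \tr (x^T *m A *m x).
Proof.
move=> hA.
have [y0|yN0] := eqVneq (\tr (x^T *m x)) 0.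
  by rewrite (mxtrace_sqr_eq0 y0) !mulmx0 mxtrace0 mulr0.
have yp : 0 < \tr (x^T *m x) by rewrite lt_def yN0 mxtrace_sqr_ge0.
pose s := (Num.sqrt (\tr (x^T *m x)))^-1.
have s2 : s ^+ 2 = (\tr (x^T *m x))^-1 by rewrite /s exprVn sqr_sqrtr ?ltW.
have [u uE] : exists u, u = s *: x by exists (s *: x).
have u1 : \tr (u^T *m u) = 1.
  by rewrite uE trZ -!scalemxAl -!scalemxAr !mxtraceZ mulrA -expr2 s2 mulVf.
have [H HE] : exists H, H = A - 1%:M by exists (A - 1%:M).
rewrite -HE in hA.
have Hu : \tr ((H *m u)^T *m (H *m u)) <= 4^-1.
  have : euclidean_norm (H *m u) <= 2^-1.
    by apply: le_trans hA; apply: le_spectral_norm; rewrite euclidean_normE u1 sqrtr1.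
  rewrite -(@ler_pXn2r _ 2%N)// ?nnegrE ?sqrtr_ge0// euclidean_norm_sqr => h.
  by apply: le_trans h _; lra.
have : 0 <= \tr ((H *m u + 2^-1 *: u)^T *m (H *m u + 2^-1 *: u)).
  exact: mxtrace_sqr_ge0.
rewrite trD trZ !mulmxDl !mulmxDr -!scalemxAl -!scalemxAr !mxtraceD.
rewrite !mxtraceZ u1.
have -> : \tr ((H *m u)^T *m u) = \tr (u^T *m (H *m u)).
  by rewrite -mxtrace_tr trmx_mul trmxK.
have -> : \tr (u^T *m (H *m u)) = \tr (u^T *m A *m u) - 1.
  by rewrite HE mulmxBl mul1mx mulmxBr linearB /= u1 mulmxA.
have -> : \tr (u^T *m A *m u) = (\tr (x^T *m x))^-1 * \tr (x^T *m A *m x).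
  by rewrite uE trZ -!scalemxAl -!scalemxAr !mxtraceZ mulrA -expr2 s2.
move=> h; have : 2^-1 <= (\tr (x^T *m x))^-1 * \tr (x^T *m A *m x) by lra.
by rewrite ler_pdivlMl// mulrC.
Qed.

End euclidean.

(** * Gram matrix of an optimal sample *)

Section optimal_sampling.
Context d (T : measurableType d) (R : realType) (mu : probability T R).
Variables (n : nat) (B : 'I_n -> T -> R).
Hypothesis BL2 : forall i, B i \in Lfun mu 2%:E.
Hypothesis orthoB : forall i j,
  (\int[mu]_y (B i y * B j y)%:E)%E = ((i == j)%:R)%:E.

Let mB i : measurable_fun setT (B i).
Proof. by have := sub_Lfun_mfun (BL2 i); rewrite inE. Qed.

Lemma opt_density_ge0 y : 0 <= opt_density B y.
Proof.
by rewrite mulr_ge0 ?invr_ge0// sumr_ge0// => i _; rewrite exprn_ge0.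
Qed.

Lemma opt_weight_ge0 y : 0 <= opt_weight B y.
Proof. by rewrite invr_ge0 opt_density_ge0. Qed.

Lemma measurable_opt_density : measurable_fun setT (opt_density B).
Proof.
apply: measurable_funM => //; apply: measurable_sum => i.
by apply: measurable_funX; exact: measurableT_comp.
Qed.

Lemma measurable_opt_weight : measurable_fun setT (opt_weight B).
Proof.
rewrite (_ : opt_weight B = (fun x => x `^ (-1)) \o opt_density B).
  by apply: measurableT_comp; [exact: measurable_powR|exact: measurable_opt_density].
by apply/funext => y; rewrite /= powR_inv1// opt_density_ge0.
Qed.

Hypothesis n0 : (0 < n)%N.

Lemma sum_sqr_density y : \sum_i B i y ^+ 2 = n%:R * opt_density B y.
Proof.
rewrite /opt_density mulrA divff ?mul1r ?pnatr_eq0 -?lt0n//.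
by apply: eq_bigr => i _; rewrite real_normK ?num_real.
Qed.

Lemma basis_eq0 y i : opt_density B y = 0 -> B i y = 0.
Proof.
move=> r0; have := sum_sqr_density y; rewrite r0 mulr0 => /eqP.
rewrite psumr_eq0; last by move=> j _; exact: sqr_ge0.
by move=> /allP/(_ i (mem_index_enum i)); rewrite /= sqrf_eq0 => /eqP.
Qed.

(** The contribution of one sample to the Gram matrix. The optimal weight gives it trace [n]
    wherever the density is nonzero, hence [sample_matrix_sqr] and the uniform bound on its
    entries. *)
Definition sample_matrix y : 'M[R]_n :=
  \matrix_(a, b) (opt_weight B y * B a y * B b y).

(** Where the density vanishes the weight is 0 by convention, but every basis function vanishes
    there as well. *)
Lemma density_sample_matrix y a b :
  opt_density B y * sample_matrix y a b = B a y * B b y.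
Proof.
rewrite mxE /opt_weight; have [r0|r0] := eqVneq (opt_density B y) 0.
  by rewrite r0 mul0r basis_eq0// mul0r.
by rewrite !mulrA divff// mul1r.
Qed.

Lemma sample_matrix_le y a b : `|sample_matrix y a b| <= n%:R.
Proof.
have [r0|r0] := eqVneq (opt_density B y) 0.
  by rewrite mxE basis_eq0// mulr0 mul0r normr0.
have rp : 0 < opt_density B y by rewrite lt_def r0 opt_density_ge0.
rewrite -(ler_pM2l rp) -{1}(gtr0_norm rp) -normrM density_sample_matrix.
rewrite [leRHS]mulrC -sum_sqr_density normrM.
have h c : `|B c y| ^+ 2 <= \sum_i B i y ^+ 2.
  rewrite real_normK ?num_real// [leRHS](bigD1 c)//= lerDl sumr_ge0// => i _.
  exact: sqr_ge0.
have := h a; have := h b; have := sqr_ge0 (`|B a y| - `|B b y|).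
by rewrite sqrrB !mulr2n; lra.
Qed.

Lemma sample_matrix_sym y : (sample_matrix y)^T = sample_matrix y.
Proof. by apply/matrixP => a b; rewrite !mxE -!mulrA [B b y * _]mulrC. Qed.

Lemma sample_matrix_sqr y :
  sample_matrix y *m sample_matrix y = n%:R *: sample_matrix y.
Proof.
apply/matrixP => a b; rewrite !mxE.
under eq_bigr do rewrite !mxE.
transitivity (opt_weight B y * (opt_weight B y * B a y * B b y) * \sum_i B i y ^+ 2).
  by rewrite mulr_sumr; apply: eq_bigr => i _; ring.
rewrite sum_sqr_density; have [r0|r0] := eqVneq (opt_density B y) 0.
  by rewrite [B a y]basis_eq0// !(mulr0, mul0r).
by rewrite /opt_weight; field.
Qed.

Lemma bmeas_sample_matrix a b : bmeas (fun y => sample_matrix y a b).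
Proof.
split; last by exists n%:R => y; exact: sample_matrix_le.
under eq_fun do rewrite mxE.
by do 2!apply: measurable_funM => //; exact: measurable_opt_weight.
Qed.

Lemma gramE N (ys : 'I_N -> T) :
  gram B (opt_weight B) ys = N%:R^-1 *: \sum_i sample_matrix (ys i).
Proof.
apply/matrixP => a b; rewrite !mxE summxE /sample_dot; congr (_ * _).
by apply: eq_bigr => i _; rewrite mxE.
Qed.

Context d' (Omega : measurableType d') (P : probability Omega R).
Local Notation "'EE' f" := (\int[P]_x f x) (at level 10, f at level 9).

Lemma ge0_integral_sample (Y : {RV P >-> T}) (h : T -> \bar R) :
  (forall A, measurable A -> distribution P Y A = opt_distribution mu B A) ->
  measurable_fun setT h -> (forall y, 0 <= h y)%E ->
  (\int[P]_x h (Y x) = \int[mu]_y ((opt_density B y)%:E * h y))%E.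
Proof.
move=> hY mh h0; rewrite -[LHS](ge0_integral_distribution Y mh h0).
apply: (@ge0_integral_density _ _ _ _ _ mu (distribution P Y) id) => //.
- exact: measurable_opt_density.
- exact: opt_density_ge0.
Qed.

Lemma expect_sample_matrix (Y : {RV P >-> T}) a b :
  (forall A, measurable A -> distribution P Y A = opt_distribution mu B A) ->
  EE (fun x => sample_matrix (Y x) a b) = (a == b)%:R.
Proof.
move=> hY; have bX := bmeas_sample_matrix a b.
have bXY : bmeas (fun x => sample_matrix (Y x) a b) by exact: (bmeas_comp Y bX).
have bn : @bmeas _ Omega R (fun=> n%:R) by exact: bmeas_cst.
have intB i j : mu.-integrable setT (EFin \o (fun y => B i y * B j y)).
  by apply/Lfun1_integrable; exact: Lfun2_mul_Lfun1.
have mrho := measurable_opt_density.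
have X0 y : (0 <= (sample_matrix y a b + n%:R)%:E)%E.
  by rewrite lee_fin; have := sample_matrix_le y a b; rewrite ler_norml => /andP[]; lra.
(* Adding [n] makes the integrand nonnegative, as the change of measure requires; the density has
   integral one, so the added constants cancel. *)
apply: (addIr n%:R); rewrite -[X in _ + X = _](expect_cst P) -(expectD P bXY bn).
apply: EFin_inj; rewrite EFin_bmeas; last exact: bmeasD.
rewrite (@ge0_integral_sample Y (fun y => (sample_matrix y a b + n%:R)%:E))//; last first.
  by apply/measurable_EFinP/measurable_funD => //; exact: bX.1.
have int1 : (\int[mu]_y (opt_density B y)%:E = 1)%E.
  by have := hY setT measurableT; rewrite /opt_distribution probability_setT.
have intrho : mu.-integrable setT (EFin \o opt_density B).
  apply/integrableP; split; first exact/measurable_EFinP.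
  under eq_integral do rewrite /= ger0_norm ?opt_density_ge0//.
  by rewrite int1 ltry.
transitivity (\int[mu]_y ((B a y * B b y)%:E + n%:R%:E * (opt_density B y)%:E))%E.
  apply: eq_integral => y _; rewrite -EFinM mulrDr density_sample_matrix.
  by rewrite EFinD -EFinM mulrC [n%:R * _]mulrC.
rewrite integralD//; [|exact: intB|exact: integrableZl].
by rewrite orthoB integralZl// int1 mule1.
Qed.

End optimal_sampling.

(** For [n = 0] the density is identically 0 and cannot be that of a probability. *)
Lemma optimal_samples_dim_gt0 d (T : measurableType d) (R : realType)
  (mu : probability T R) (n : nat) (B : 'I_n -> T -> R)
  d' (Omega : measurableType d') (P : probability Omega R) (Y : {RV P >-> T}) :
  (forall A, measurable A -> distribution P Y A = opt_distribution mu B A) ->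
  (0 < n)%N.
Proof.
move=> hY; rewrite lt0n; apply/negP => /eqP n0.
have := hY setT measurableT; rewrite /opt_distribution probability_setT.
rewrite (eq_integral (cst 0%E)) ?integral0; last first.
  move=> y _; rewrite /opt_density big1 ?mulr0// => i.
  by move: (ltn_ord i); rewrite {2}n0.
by move=> /eqP; rewrite onee_eq0.
Qed.

(** * Concentration of the Gram matrix *)

Section concentration.
Context d (T : measurableType d) (R : realType) (mu : probability T R).
Variables (n : nat) (B : 'I_n -> T -> R).
Hypothesis BL2 : forall i, B i \in Lfun mu 2%:E.
Hypothesis orthoB : forall i j,
  (\int[mu]_y (B i y * B j y)%:E)%E = ((i == j)%:R)%:E.
Context d' (Omega : measurableType d') (P : probability Omega R).
Local Notation "'EE' f" := (\int[P]_x f x) (at level 10, f at level 9).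

Lemma gram_concentration (N : nat) (Y : 'I_N -> {RV P >-> T}) : (0 < N)%N ->
  iid_optimal_samples mu B Y -> exists F : Omega -> R,
  [/\ bmeas F, forall x, 0 <= F x,
      EE F <= 3 * n%:R * expR (- (N%:R / (16 * n%:R))) &
      forall x, ~~ (spectral_norm (gram B (opt_weight B) (fun i => Y i x) - 1%:M) <= 2^-1) ->
        1 <= F x].
Proof.
move=> N0 [indepY hY].
have n0 : (0 < n)%N by exact: optimal_samples_dim_gt0 (hY (Ordinal N0)).
have nR : 0 < n%:R :> R by rewrite ltr0n.
have NR : 0 < N%:R :> R by rewrite ltr0n.
have EX i a b := expect_sample_matrix BL2 orthoB n0 a b (hY i).
(* With [t * n = 1/4] and threshold [3/2 * N] the exponent is [N / n] times [expR (1/4) - 11/8];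
   with [t * n = - 1/4] and threshold [1/2 * N] it is [N / n] times [expR (- 1/4) - 7/8]. The bounds
   [21/16] and [13/16] below leave [- 1/16] in both cases. *)
have [F1 [bF1 F10 EF1 hF1]] := matrix_chernoff indepY n0
  (bmeas_sample_matrix BL2 n0) (sample_matrix_le B n0) (sample_matrix_sym B)
  (sample_matrix_sqr B n0) EX (4 * n%:R)^-1 (3 / 2 * N%:R).
have [F2 [bF2 F20 EF2 hF2]] := matrix_chernoff indepY n0
  (bmeas_sample_matrix BL2 n0) (sample_matrix_le B n0) (sample_matrix_sym B)
  (sample_matrix_sqr B n0) EX (- (4 * n%:R)^-1) (1 / 2 * N%:R).
have e1 : expR (4^-1 : R) <= 21 / 16.
  have h8 : expR (8^-1 : R) <= 8 / 7.
    rewrite -[X in expR X]opprK expRN -[leRHS]invrK lef_pV2 ?posrE ?invr_gt0 ?expR_gt0//.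
    by apply: le_trans (expR_ge1Dx _); lra.
  have -> : expR (4^-1 : R) = expR 8^-1 ^+ 2 by rewrite -expRM_natl; congr expR; field.
  apply: (@le_trans _ _ ((8 / 7) ^+ 2)); last by rewrite expr2; lra.
  by rewrite lerXn2r ?nnegrE ?expR_ge0.
have e2 : expR (- 4^-1 : R) <= 13 / 16.
  rewrite expRN; apply: (@le_trans _ _ (5 / 4)^-1); last by lra.
  by rewrite lef_pV2 ?posrE ?expR_gt0//; apply: le_trans (expR_ge1Dx _); lra.
exists (fun x => F1 x + F2 x); split.
- exact: bmeasD.
- by move=> x; rewrite addr_ge0.
- rewrite (expectD P bF1 bF2).
  have p32 : 0 <= 3 / 2 :> R by lra.
  have q0 : 0 <= N%:R / n%:R :> R by rewrite divr_ge0// ltW.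
  have h1 : EE F1 <= 3 / 2 * (n%:R * expR (- (N%:R / (16 * n%:R)))).
    apply: le_trans EF1 _; apply: (ler_wpM2l p32); apply: (ler_wpM2l (ltW nR)); rewrite ler_expR.
    have -> : (4 * n%:R)^-1 * n%:R = 4^-1 :> R by field; rewrite gt_eqF.
    have -> : N%:R * ((expR 4^-1 - 1) / n%:R) - (4 * n%:R)^-1 * (3 / 2 * N%:R) =
       (N%:R / n%:R) * (expR 4^-1 - 11 / 8) :> R by field; rewrite gt_eqF.
    have -> : - (N%:R / (16 * n%:R)) = N%:R / n%:R * (- 16^-1) :> R by field; rewrite gt_eqF.
    by apply: ler_wpM2l => //; lra.
  have h2 : EE F2 <= 3 / 2 * (n%:R * expR (- (N%:R / (16 * n%:R)))).
    apply: le_trans EF2 _; apply: (ler_wpM2l p32); apply: (ler_wpM2l (ltW nR)); rewrite ler_expR.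
    have -> : - (4 * n%:R)^-1 * n%:R = - 4^-1 :> R by field; rewrite gt_eqF.
    have -> : N%:R * ((expR (- 4^-1) - 1) / n%:R) - - (4 * n%:R)^-1 * (1 / 2 * N%:R) =
       (N%:R / n%:R) * (expR (- 4^-1) - 7 / 8) :> R by field; rewrite gt_eqF.
    have -> : - (N%:R / (16 * n%:R)) = N%:R / n%:R * (- 16^-1) :> R by field; rewrite gt_eqF.
    by apply: ler_wpM2l => //; lra.
  by lra.
- move=> x; rewrite gramE; set S := \sum_i _ => hS.
  apply: contrapT => /negP; rewrite -ltNge => F12; move/negP: hS; apply.
  have lt1 : F1 x < 1 by have := F20 x; lra.
  have lt2 : F2 x < 1 by have := F10 x; lra.
  apply: spectral_norm_half.
    have sS : S^T = S.
      by rewrite /S linear_sum /=; apply: eq_bigr => i _; rewrite sample_matrix_sym.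
    by apply/matrixP => a b; rewrite -[in RHS]sS !mxE eq_sym.
  move=> u u1; rewrite mulmxBr mulmxBl mulmx1 linearB /= u1 -scalemxAr -scalemxAl mxtraceZ.
  set z := \tr _.
  have t0 : 0 <= (4 * n%:R)^-1 :> R by rewrite invr_ge0 mulr_ge0// ltW.
  have z1 : z <= 3 / 2 * N%:R.
    rewrite leNgt; apply/negP => hz; have := hF1 x u u1; rewrite -/S -/z.
    by rewrite (ler_wpM2l t0 (ltW hz)) => /(_ isT); rewrite leNgt lt1.
  have z2 : 1 / 2 * N%:R <= z.
    rewrite leNgt; apply/negP => hz; have := hF2 x u u1; rewrite -/S -/z.
    by rewrite ler_wnM2l ?oppr_le0 ?(ltW hz)// => /(_ isT); rewrite leNgt lt2.
  rewrite ler_norml; apply/andP; split.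
    by rewrite lerBrDl ler_pdivlMl//; lra.
  by rewrite lerBlDr ler_pdivrMl//; lra.
Qed.

End concentration.

(** * Weighted least squares *)

Section sample_dot_algebra.
Context d (T : measurableType d) (R : realType).
Variables (w : T -> R) (N : nat) (ys : 'I_N -> T).
Hypothesis w0 : forall y, 0 <= w y.
Local Notation sd := (sample_dot w ys).

Lemma sample_dot_ge0 g : 0 <= sd g g.
Proof.
rewrite mulr_ge0 ?invr_ge0// sumr_ge0// => i _.
by rewrite -mulrA mulr_ge0// -expr2 sqr_ge0.
Qed.

Lemma eq_sample_dot g h g' h' :
  (forall j, g (ys j) = g' (ys j)) -> (forall j, h (ys j) = h' (ys j)) ->
  sd g h = sd g' h'.
Proof. by move=> gg hh; congr (_ * _); apply: eq_bigr => j _; rewrite gg hh. Qed.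

Lemma sample_dotD g h : sd (g \+ h) (g \+ h) = sd g g + 2 * sd g h + sd h h.
Proof.
rewrite /sample_dot mulrCA -!mulrDr; congr (_ * _).
rewrite mulr_sumr -!big_split /=; apply: eq_bigr => j _; ring.
Qed.

Lemma sample_dot_sqr_le g h :
  sd (g \- h) (g \- h) <= 2 * sd g g + 2 * sd h h.
Proof.
have := sample_dot_ge0 (g \+ h); rewrite sample_dotD.
have -> : g \- h = g \+ (\- h) by [].
rewrite sample_dotD.
have -> : sd (\- h) (\- h) = sd h h.
  by congr (_ * _); apply: eq_bigr => j _ /=; ring.
have -> : sd g (\- h) = - sd g h.
  rewrite /sample_dot -mulrN -sumrN; congr (_ * _); apply: eq_bigr => j _ /=; ring.
by lra.
Qed.

Variables (n : nat) (B : 'I_n -> T -> R).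
Implicit Types (c b : 'cV[R]_n).

Definition lin_comb c (y : T) := \sum_i c i 0 * B i y.

Lemma lin_combB c b y : lin_comb (c - b) y = lin_comb c y - lin_comb b y.
Proof. by rewrite /lin_comb -sumrB; apply: eq_bigr => i _; rewrite !mxE mulrBl. Qed.

Lemma sample_dot_comb g c : sd g (lin_comb c) = \sum_i c i 0 * sd g (B i).
Proof.
rewrite /sample_dot /lin_comb.
under eq_bigr do rewrite mulr_sumr.
rewrite exchange_big /= mulr_sumr; apply: eq_bigr => i _.
by rewrite mulrCA; congr (_ * _); rewrite mulr_sumr; apply: eq_bigr => j _; ring.
Qed.

Lemma sample_dotC g h : sd g h = sd h g.
Proof. by congr (_ * _); apply: eq_bigr => j _; ring. Qed.

Lemma sample_dot_gram c :
  sd (lin_comb c) (lin_comb c) = \tr (c^T *m gram B w ys *m c).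
Proof.
rewrite sample_dot_comb /mxtrace big_ord1 mxE; apply: eq_bigr => i _.
rewrite mulrC sample_dotC sample_dot_comb mxE; congr (_ * _).
by apply: eq_bigr => j _; rewrite !mxE sample_dotC.
Qed.

End sample_dot_algebra.

Section L2norm_sqr.
Context d (T : measurableType d) (R : realType) (mu : probability T R).

Lemma L2normE (f : T -> R) :
  (L2norm mu f = (\int[mu]_y (f y ^+ 2)%:E) `^ 2^-1)%E.
Proof.
rewrite /L2norm Lnorm.unlock; congr (_ `^ _)%E; apply: eq_integral => y _ /=.
by rewrite powR_mulrn// real_normK ?num_real.
Qed.

Lemma L2norm_sqr (f : T -> R) :
  (L2norm mu f ^+ 2 = \int[mu]_y (f y ^+ 2)%:E)%E.
Proof.
have i0 : (0 <= \int[mu]_y (f y ^+ 2)%:E)%E.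
  by apply: integral_ge0 => y _; rewrite lee_fin sqr_ge0.
by rewrite L2normE poweR12_sqrt// sqr_sqrte.
Qed.

Lemma integral_sqr_le_L2norm (f : T -> R) (c : R) : 0 <= c ->
  (L2norm mu f <= c%:E)%E -> (\int[mu]_y (f y ^+ 2)%:E <= (c ^+ 2)%:E)%E.
Proof. by move=> c0 fc; rewrite -L2norm_sqr EFin_expe lee_sqr ?Lnorm_ge0. Qed.

Lemma integral_sqr_eq_off_null (Z : set T) (u v : T -> R) :
  measurable Z -> mu Z = 0%E -> measurable_fun setT u -> measurable_fun setT v ->
  (forall y, ~ Z y -> u y = v y) ->
  (\int[mu]_y (u y ^+ 2)%:E = \int[mu]_y (v y ^+ 2)%:E)%E.
Proof.
move=> mZ Z0 mu' mv uv; apply: ae_eq_integral => //.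
- by apply/measurable_EFinP; exact: measurable_funX.
- by apply/measurable_EFinP; exact: measurable_funX.
exists Z; split => // y /= /not_implyP[_ h]; apply: contrapT => /uv e.
by apply: h; rewrite e.
Qed.

End L2norm_sqr.

(** * Error of the stabilized fit *)

Section least_squares_error.
Context d (T : measurableType d) (R : realType) (mu : probability T R).
Variables (V : set (T -> R)) (n : nat) (B : 'I_n -> T -> R) (Z : set T).
Hypothesis VL2 : V `<=` [set v | v \in Lfun mu 2%:E].
Hypothesis orthoB : forall i j,
  (\int[mu]_y (B i y * B j y)%:E)%E = ((i == j)%:R)%:E.
Hypothesis VB : forall c : 'cV[R]_n, V (lin_comb B c).
Hypotheses (mZ : measurable Z) (Z0 : mu Z = 0%E).
Hypothesis VZ : forall v, V v -> exists c : 'cV[R]_n, forall y, ~ Z y -> v y = lin_comb B c y.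

Lemma V_cst0 : V (cst 0).
Proof.
have -> : cst 0 = lin_comb B 0 by apply/funext => y; rewrite /lin_comb big1// => i _; rewrite mxE mul0r.
exact: VB.
Qed.

Lemma V_basis i : V (B i).
Proof.
have -> : B i = lin_comb B (delta_mx i 0); last exact: VB.
apply/funext => y; rewrite /lin_comb (bigD1 i)//= mxE !eqxx mul1r big1 ?addr0// => j /negPf ji.
by rewrite mxE ji mul0r.
Qed.

Let mB i : measurable_fun setT (B i).
Proof. by have := sub_Lfun_mfun (VL2 (V_basis i)); rewrite inE. Qed.

Lemma integral_sqr_comb c :
  (\int[mu]_y ((lin_comb B c y) ^+ 2)%:E = (\tr (c^T *m c))%:E)%E.
Proof.
have intB i j : mu.-integrable setT (fun y => (B i y * B j y)%:E).
  by apply/Lfun1_integrable; apply: Lfun2_mul_Lfun1; exact: (VL2 (V_basis _)).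
transitivity (\int[mu]_y \sum_i \sum_j ((c i 0 * c j 0)%:E * (B i y * B j y)%:E))%E.
  apply: eq_integral => y _; rewrite expr2 /lin_comb mulr_suml -sumEFin.
  apply: eq_bigr => i _; rewrite mulr_sumr -sumEFin; apply: eq_bigr => j _.
  by rewrite -EFinM; congr EFin; ring.
rewrite integral_sum//; last first.
  by move=> i; apply: integrable_sum => // j _; exact: integrableZl.
rewrite mxtrace_sqr -sumEFin; apply: eq_bigr => i _.
rewrite integral_sum//; last by move=> j; exact: integrableZl.
rewrite (bigD1 i)//= big1 ?adde0.
  by rewrite integralZl// orthoB eqxx mule1 expr2.
by move=> j ji; rewrite integralZl// orthoB eq_sym (negPf ji) mule0.
Qed.

Section fixed_sample.
Variables (w : T -> R) (N : nat) (ys : 'I_N -> T).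
Hypothesis w0 : forall y, 0 <= w y.
Hypothesis ysZ : forall j, ~ Z (ys j).
Hypothesis Ghalf : spectral_norm (gram B w ys - 1%:M) <= 2^-1.
Variable f : T -> R.
Local Notation sd := (sample_dot w ys).

Let coercive c : \tr (c^T *m c) <= 2 * sd (lin_comb B c) (lin_comb B c).
Proof. by have := sandwich_ge_half c Ghalf; rewrite -sample_dot_gram; lra. Qed.

(** Coercivity gives the Gram matrix a trivial kernel. *)
Let normal_equations : exists c : 'cV[R]_n, forall i,
  sd (f \- lin_comb B c) (B i) = 0.
Proof.
pose G := gram B w ys; pose b : 'cV[R]_n := \col_i sd f (B i).
have sG : G^T = G by apply/matrixP => i j; rewrite !mxE sample_dotC.
have uG : G \in unitmx.
  rewrite -row_free_unit; apply: inj_row_free => v vG.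
  apply: trmx_inj; rewrite trmx0; apply: mxtrace_sqr_eq0.
  apply/eqP; rewrite eq_le mxtrace_sqr_ge0 andbT.
  by have := coercive v^T; rewrite sample_dot_gram -/G trmxK vG mul0mx mxtrace0 mulr0.
have : exists c, G *m c = b by exists (invmx G *m b); rewrite mulKVmx.
move=> [c Gc]; exists c => i.
have : (G *m c) i 0 = b i 0 by rewrite Gc.
rewrite !mxE => e.
have {}e : sd (B i) (lin_comb B c) = sd f (B i).
  by rewrite -e sample_dot_comb; apply: eq_bigr => j _; rewrite mxE mulrC.
have -> : sd (f \- lin_comb B c) (B i) = sd f (B i) - sd (lin_comb B c) (B i).
  by rewrite /sample_dot -mulrBr -sumrB; congr (_ * _); apply: eq_bigr => j _ /=; ring.
by rewrite [sd (lin_comb _ _) _]sample_dotC e subrr.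
Qed.

(** [least_squares] is a choice with default 0, so a minimizer of least norm must be exhibited. By
    Pythagoras and coercivity every minimizer has the coefficients [c] of the normal equations,
    hence agrees with [lin_comb B c] off [Z] and has the same norm. *)
Lemma least_squares_is_minimizer : least_squares_minimizer V w ys f
  (least_squares mu V w ys f).
Proof.
have [c hc] := normal_equations.
have pyth c' : sd (f \- lin_comb B c') (f \- lin_comb B c') =
    sd (f \- lin_comb B c) (f \- lin_comb B c) +
    sd (lin_comb B (c - c')) (lin_comb B (c - c')).
  have -> : sd (f \- lin_comb B c') (f \- lin_comb B c') =
      sd ((f \- lin_comb B c) \+ lin_comb B (c - c')) ((f \- lin_comb B c) \+ lin_comb B (c - c')).
    by apply: eq_sample_dot => j /=; rewrite lin_combB; ring.
  rewrite sample_dotD sample_dot_comb big1 ?mulr0 ?addr0// => i _.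
  by rewrite hc mulr0.
have VE u : V u -> exists c', (forall y, ~ Z y -> u y = lin_comb B c' y) /\
    sd (f \- u) (f \- u) = sd (f \- lin_comb B c') (f \- lin_comb B c').
  move=> /VZ[c' hc']; exists c'; split => //.
  by apply: eq_sample_dot => j /=; rewrite hc'.
have min_c : least_squares_minimizer V w ys f (lin_comb B c).
  split; first exact: VB.
  move=> u /VE[c' [_ e]]; rewrite /sample_norm ler_wsqrtr// e (pyth c') lerDl.
  exact: sample_dot_ge0.
suff [] : [set v | least_squares_minimizer V w ys f v /\
    forall u, least_squares_minimizer V w ys f u -> (L2norm mu v <= L2norm mu u)%E]
    (least_squares mu V w ys f) by [].
apply: (@xgetI _ _ _ (lin_comb B c)); split => // u [Vu minu].
have [c' [hc' e]] := VE u Vu.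
have := minu _ (VB c); rewrite /sample_norm ler_sqrt; last exact: sample_dot_ge0.
rewrite e (pyth c') gerDl => le0.
have cc' : c = c'.
  apply/eqP; rewrite -subr_eq0; apply/eqP/mxtrace_sqr_eq0/eqP.
  by rewrite eq_le mxtrace_sqr_ge0 andbT (le_trans (coercive _))//; lra.
rewrite le_eqVlt; apply/orP; left; apply/eqP.
rewrite !L2normE; congr (_ `^ _)%E; apply/esym.
apply: (integral_sqr_eq_off_null mZ Z0).
- by have := sub_Lfun_mfun (VL2 Vu); rewrite inE.
- by have := sub_Lfun_mfun (VL2 (VB c)); rewrite inE.
- by move=> y Zy; rewrite hc'// cc'.
Qed.

Lemma least_squares_error (v0 : T -> R) : V v0 -> measurable_fun setT f ->
  (\int[mu]_y ((f y - least_squares mu V w ys f y) ^+ 2)%:E <=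
   2%:E * \int[mu]_y ((f y - v0 y) ^+ 2)%:E +
   (16 * sd (f \- v0) (f \- v0))%:E)%E.
Proof.
move=> Vv0 mf; have [Vv minv] := least_squares_is_minimizer.
move: (least_squares _ _ _ _ _) Vv minv => v Vv minv.
have mv : measurable_fun setT v by have := sub_Lfun_mfun (VL2 Vv); rewrite inE.
have mv0 : measurable_fun setT v0 by have := sub_Lfun_mfun (VL2 Vv0); rewrite inE.
have [c hc] := VZ Vv; have [c0 hc0] := VZ Vv0.
have mcomb b : measurable_fun setT (lin_comb B b).
  by have := sub_Lfun_mfun (VL2 (VB b)); rewrite inE.
(* Coercivity costs a factor 2, the triangle inequality for squares another 2 on each of two terms,
   and the empirical error of [v] is at most that of [v0]. *)
have le8 : \tr ((c0 - c)^T *m (c0 - c)) <= 8 * sd (f \- v0) (f \- v0).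
  have := minv _ Vv0; rewrite /sample_norm ler_sqrt; last exact: sample_dot_ge0.
  have := sample_dot_sqr_le ys w0 (f \- v) (f \- v0).
  have -> : sd ((f \- v) \- (f \- v0)) ((f \- v) \- (f \- v0)) =
      sd (lin_comb B (c0 - c)) (lin_comb B (c0 - c)).
    by apply: eq_sample_dot => j /=; rewrite lin_combB hc// hc0//; ring.
  by have := coercive (c0 - c); lra.
have mE (g : T -> R) : measurable_fun setT g -> measurable_fun setT (fun y => (g y ^+ 2)%:E).
  by move=> mg; apply/measurable_EFinP; exact: measurable_funX.
have sq0 (g : T -> R) y : [set: T] y -> (0 <= (g y ^+ 2)%:E)%E.
  by move=> _; rewrite lee_fin sqr_ge0.
apply: (@le_trans _ _ (\int[mu]_y (2%:E * ((f y - v0 y) ^+ 2)%:E +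
    2%:E * ((v0 y - v y) ^+ 2)%:E))%E).
  apply: ge0_le_integral => //.
  - exact: (sq0 (fun y => f y - v y)).
  - by apply: (mE (fun y => f y - v y)); exact: measurable_funB.
  - apply: emeasurable_funD; apply: emeasurable_funM => //.
      by apply: (mE (fun y => f y - v0 y)); exact: measurable_funB.
    by apply: (mE (fun y => v0 y - v y)); exact: measurable_funB.
  - move=> y _; rewrite -!EFinM -EFinD lee_fin.
    by have := sqr_ge0 ((f y - v0 y) - (v0 y - v y)); lra.
have m1 := mE _ (measurable_funB mf mv0); have m2 := mE _ (measurable_funB mv0 mv).
rewrite ge0_integralD//; last 4 first.
- by move=> y yT; rewrite mule_ge0//; exact: (sq0 (f \- v0)).
- exact: emeasurable_funM.
- by move=> y yT; rewrite mule_ge0//; exact: (sq0 (v0 \- v)).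
- exact: emeasurable_funM.
rewrite !ge0_integralZl//; [|exact: (sq0 (v0 \- v))|exact: (sq0 (f \- v0))].
rewrite leeD2l//.
have -> : (\int[mu]_y ((v0 y - v y) ^+ 2)%:E = \int[mu]_y (lin_comb B (c0 - c) y ^+ 2)%:E)%E.
  apply: (integral_sqr_eq_off_null mZ Z0 (measurable_funB mv0 mv) (mcomb _)) => y Zy /=.
  by rewrite lin_combB hc// hc0.
by rewrite integral_sqr_comb -EFinM lee_fin; lra.
Qed.

End fixed_sample.

Lemma stabilized_in_V (w : T -> R) N (ys : 'I_N -> T) f :
  V (stabilized_least_squares mu V B w ys f).
Proof.
rewrite /stabilized_least_squares; case: ifP => _; last exact: V_cst0.
rewrite /least_squares; case: xgetP => [v _ [[]]//|_]; exact: V_cst0.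
Qed.

Context d' (Omega : measurableType d') (P : probability Omega R).

(** In the majorant, [h1] and [h2] bound the error of the fit on the good event, [h3] is the whole
    norm of [f] on failure, and [h4] is infinite when a sample falls in [Z]. The expectations of
    [h1] and [h2] give [18 = 2 + 16], that of [h4] is 0. *)
Lemma stabilized_least_squares_error (N : nat) (Y : 'I_N -> {RV P >-> T})
  (f v0 : T -> R) : (0 < N)%N -> iid_optimal_samples mu B Y ->
  f \in Lfun mu 2%:E -> V v0 ->
  exists H : Omega -> \bar R, [/\ measurable_fun setT H, forall x, (0 <= H x)%E,
    forall x, (\int[mu]_y ((f y - stabilized_least_squares mu V B (opt_weight B)
      (fun j => Y j x) f y) ^+ 2)%:E <= H x)%E &
    (\int[P]_x H x <= 18%:E * \int[mu]_y ((f y - v0 y) ^+ 2)%:E +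
      \int[mu]_y (f y ^+ 2)%:E * (3 * n%:R * expR (- (N%:R / (16 * n%:R))))%:E)%E].
Proof.
move=> N0 iidY fL2 Vv0.
have BL2 i : B i \in Lfun mu 2%:E by exact: (VL2 (V_basis i)).
have [F [bF F0 EF hF]] := gram_concentration BL2 orthoB N0 iidY.
have n0 : (0 < n)%N by exact: optimal_samples_dim_gt0 (iidY.2 (Ordinal N0)).
have gL2 : (f \- v0) \in Lfun mu 2%:E.
  by rewrite rpredB //; [exact: (lee1n 2)|move=> ?; exact: (VL2 Vv0)].
have mf : measurable_fun setT f by have := sub_Lfun_mfun fL2; rewrite inE.
have mg : measurable_fun setT (f \- v0) by have := sub_Lfun_mfun gL2; rewrite inE.
have sq0 (g : T -> R) y : (0 <= (g y ^+ 2)%:E)%E by rewrite lee_fin sqr_ge0.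
set E2 := (\int[mu]_y ((f y - v0 y) ^+ 2)%:E)%E.
set F2 := (\int[mu]_y (f y ^+ 2)%:E)%E.
have E20 : (0 <= E2)%E by apply: integral_ge0 => y _; exact: (sq0 (f \- v0)).
have F20 : (0 <= F2)%E by apply: integral_ge0 => y _; exact: sq0.
pose w := opt_weight B.
have w0 := opt_weight_ge0 B; have mw := measurable_opt_weight BL2.
pose g2 y := w y * (f y - v0 y) ^+ 2.
have mg2 : measurable_fun setT g2.
  by apply: measurable_funM => //; exact: (measurable_funX 2%N mg).
have g20 y : 0 <= g2 y by rewrite mulr_ge0// sqr_ge0.
pose S x := N%:R^-1 * \sum_(j < N) g2 (Y j x).
have S0 x : 0 <= S x by rewrite mulr_ge0 ?invr_ge0// sumr_ge0.
have mg2Y j : measurable_fun setT (fun x => g2 (Y j x)) by exact: measurableT_comp.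
have mS : measurable_fun setT S by apply: measurable_funM => //; exact: measurable_sum.
(* Weight times density is 1, or 0 where the density vanishes. *)
have Eg2 j : (\int[P]_x (g2 (Y j x))%:E <= E2)%E.
  rewrite (@ge0_integral_sample _ _ _ _ _ _ BL2 _ _ _ _ (fun y => (g2 y)%:E) (iidY.2 j))//.
  - apply: ge0_le_integral => //.
    + by move=> y _; rewrite mule_ge0 ?lee_fin ?opt_density_ge0.
    + by apply: emeasurable_funM; apply/measurable_EFinP => //; exact: measurable_opt_density.
    + by apply/measurable_EFinP; exact: (measurable_funX 2%N mg).
    + move=> y _; rewrite -EFinM lee_fin /g2 mulrA ler_piMl ?sqr_ge0//.
      rewrite /w /opt_weight; have [->|r0] := eqVneq (opt_density B y) 0.
        by rewrite mul0r.
      by rewrite divff.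
  - exact/measurable_EFinP.
have ES : (\int[P]_x (S x)%:E <= E2)%E.
  have mS' : measurable_fun setT (fun x => (\sum_(j < N) g2 (Y j x))%:E).
    by apply/measurable_EFinP; exact: measurable_sum.
  have S'0 x : [set: Omega] x -> (0 <= (\sum_(j < N) g2 (Y j x))%:E)%E.
    by move=> _; rewrite lee_fin sumr_ge0.
  have N'0 : (0 <= (N%:R^-1)%:E :> \bar R)%E by rewrite lee_fin invr_ge0.
  rewrite /S; under eq_integral do rewrite EFinM.
  rewrite (ge0_integralZl P measurableT mS' S'0 N'0).
  under eq_integral do rewrite -sumEFin.
  rewrite ge0_integral_sum//; last 2 first.
  - by move=> j; apply/measurable_EFinP.
  - by move=> j x _; rewrite lee_fin.
  apply: (@le_trans _ _ (N%:R^-1%:E * \sum_(j < N) E2)%E).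
    by rewrite lee_pmul2l ?lte_fin ?invr_gt0 ?ltr0n//; exact: lee_sum.
  rewrite (eq_bigr (fun=> 1%:E * E2)%E); last by move=> j _; rewrite mul1e.
  rewrite -ge0_sume_distrl// sumEFin sumr_const card_ord.
  by rewrite muleA -EFinM mulVf ?mul1e// pnatr_eq0 -lt0n.
pose bad x := \sum_(j < N) \1_Z (Y j x) : R.
have mZY j : measurable_fun setT (fun x => \1_Z (Y j x) : R).
  exact: (bmeas_comp (Y j) (bmeas_indic R mZ)).1.
have bad0 x : 0 <= bad x by rewrite sumr_ge0.
have mbad : measurable_fun setT bad by exact: measurable_sum.
(* The sampling distribution has a density with respect to [mu], for which [Z] is null. *)
have Ebad : (\int[P]_x (bad x)%:E = 0)%E.
  under eq_integral do rewrite -sumEFin.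
  rewrite ge0_integral_sum//; last first.
  - by move=> j; apply/measurable_EFinP.
  rewrite big1// => j _.
  rewrite (@ge0_integral_sample _ _ _ _ _ _ BL2 _ _ _ _ (fun y => (\1_Z y)%:E) (iidY.2 j))//; last first.
  - exact/measurable_EFinP.
  rewrite (@ae_eq_integral _ _ _ _ setT (cst 0%E)) ?integral0//.
  - by apply: emeasurable_funM; apply/measurable_EFinP => //; exact: measurable_opt_density.
  exists Z; split => // y /= /not_implyP[_ h]; apply: contrapT => Zy.
  by apply: h; rewrite indicE memNset ?mule0.
have mF : measurable_fun setT (fun x => F2 * (F x)%:E)%E.
  by apply: emeasurable_funM => //; apply/measurable_EFinP; exact: bF.1.
have h40 x : (0 <= +oo * (bad x)%:E :> \bar R)%E by rewrite mule_ge0// lee_fin.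
have h30 x : (0 <= F2 * (F x)%:E)%E by rewrite mule_ge0// lee_fin.
have h20 x : (0 <= (16 * S x)%:E)%E by rewrite lee_fin mulr_ge0.
have h10 : (0 <= 2%:E * E2)%E by rewrite mule_ge0.
have m2 : measurable_fun setT (fun x => (16 * S x)%:E).
  by apply/measurable_EFinP; exact: measurable_funM.
have m4 : measurable_fun setT (fun x => +oo * (bad x)%:E : \bar R)%E.
  by apply: emeasurable_funM => //; exact/measurable_EFinP.
pose h1 (x : Omega) : \bar R := (2%:E * E2)%E.
pose h2 x := (16 * S x)%:E; pose h3 x := (F2 * (F x)%:E)%E.
(* After integration this becomes [+oo * 0], which is 0 by convention. *)
pose h4 x : \bar R := (+oo * (bad x)%:E)%E.
have m1 : measurable_fun setT h1 by exact: measurable_cst.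
have m12 : measurable_fun setT (h1 \+ h2)%E by exact: emeasurable_funD.
have m34 : measurable_fun setT (h3 \+ h4)%E by exact: emeasurable_funD.
have h12 x : (0 <= h1 x + h2 x)%E by exact: (adde_ge0 h10 (h20 x)).
have h34 x : (0 <= h3 x + h4 x)%E by exact: (adde_ge0 (h30 x) (h40 x)).
exists (fun x => h1 x + h2 x + (h3 x + h4 x))%E; split.
- exact: emeasurable_funD.
- by move=> x; exact: adde_ge0.
- move=> x; have [[j Zj]|hZ] := pselect (exists j, Z (Y j x)).
    have -> : h4 x = +oo%E.
      rewrite /h4 gt0_mulye// lte_fin /bad (bigD1 j)//= ltr_pwDl ?sumr_ge0//.
      by rewrite indicE mem_set.
    rewrite addey; last by rewrite -ltNye (lt_le_trans ltNy0 (h30 x)).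
    by rewrite addey ?leey// -ltNye (lt_le_trans ltNy0 (h12 x)).
  have {}hZ j : ~ Z (Y j x) by move=> Zj; apply: hZ; exists j.
  rewrite /stabilized_least_squares; case: ifP => [hG|/negbT /hF F1].
    apply: le_trans (least_squares_error w0 hZ hG Vv0 mf) _.
    rewrite -/E2 -[leLHS]adde0; apply: leeD; last exact: (h34 x).
    rewrite leeD2l// lee_fin le_eqVlt; apply/orP; left; apply/eqP.
    by congr (_ * (_ * _)); apply: eq_bigr => j _ /=; rewrite /g2 expr2 mulrA.
  rewrite -[leLHS]add0e; apply: leeD; first exact: (h12 x).
  rewrite -[leLHS]adde0; apply: leeD; last exact: (h40 x).
  rewrite (_ : (\int[mu]_y _)%E = F2); last by apply: eq_integral => y _; rewrite subr0.
  by rewrite -[leLHS]mule1 lee_pmul// lee_fin.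
- rewrite ge0_integralD//.
  rewrite (@ge0_integralD _ _ _ P _ measurableT h1 h2 (fun x _ => h10) m1 (fun x _ => h20 x) m2).
  rewrite (@ge0_integralD _ _ _ P _ measurableT h3 h4 (fun x _ => h30 x) mF (fun x _ => h40 x) m4).
  have -> : (\int[P]_x h4 x = 0)%E.
    rewrite ge0_integralZl//; [by rewrite Ebad mule0|exact/measurable_EFinP|].
    by move=> x _; rewrite lee_fin.
  rewrite adde0; apply: leeD.
    rewrite (_ : 18%:E = 2%:E + 16%:E)%E; last by rewrite -EFinD; congr EFin; ring.
    rewrite ge0_muleDl//; apply: leeD.
      by rewrite /h1 integral_cst// -[leRHS]mule1 lee_pmul//; exact: probability_le1.
    rewrite /h2; under eq_integral do rewrite EFinM.
    rewrite ge0_integralZl//; last 2 first.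
      exact/measurable_EFinP.
      by move=> x _; rewrite lee_fin.
    by rewrite lee_pmul2l.
  rewrite /h3 ge0_integralZl//; last 2 first.
    by apply/measurable_EFinP; exact: bF.1.
    by move=> x _; rewrite lee_fin.
  by rewrite lee_pmul// -?EFin_bmeas// lee_fin// Rintegral_ge0.
Qed.

End least_squares_error.

(** * Polynomial spaces *)

Section multiindex_code.
Variable dim : option nat.

Definition coord_rank : coord_index dim -> nat :=
  match dim return coord_index dim -> nat with Some n => fun j => val j | None => id end.

(** Makes finitely supported multi-indices countable: thanks to the default 0 of [nth], a finite
    list of exponents encodes one even when there are infinitely many coordinates. *)
Lemma finite_support_code (eta : multiindex dim) :
  finite_set [set j | eta j != 0%N] ->
  exists s : seq nat, eta = (fun j => nth 0%N s (coord_rank j)).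
Proof.
rewrite /coord_rank; case: dim eta => [n|] eta /= fin.
  exists [seq eta j | j <- enum 'I_n]; apply/funext => j.
  by rewrite (nth_map j) ?size_enum_ord// nth_ord_enum.
have [A hA] := finite_fsetP.1 fin.
exists (mkseq eta (\max_(j <- finmap.enum_fset A) j).+1); apply/funext => j.
have [jm|jm] := ltnP j (\max_(j <- finmap.enum_fset A) j).+1; first by rewrite nth_mkseq.
rewrite nth_default ?size_mkseq//; apply/eqP/negPn/negP => ej.
have : [set j | eta j != 0%N] j by [].
rewrite hA /= => jA; move: jm; rewrite leqNgt ltnS => /negP; apply.
exact: leq_bigmax_seq.
Qed.

End multiindex_code.

Section polynomial_spaces.
Context (R : realType) (dim : option nat) (Gamma : set (Rdim R dim)) (y0 : Gamma).
Variable I : set (multiindex dim).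
Local Notation span := (@monomial_span R dim Gamma y0 I).

Lemma monomial_span0 : span (fun=> 0).
Proof.
exists 0%N, (fun=> fun=> 0%N), (fun=> 0); split; first by case.
by apply/funext => y; rewrite big_ord0.
Qed.

Lemma monomial_spanD u v : span u -> span v -> span (fun y => u y + v y).
Proof.
move=> [n [eta [c [hI ->]]]] [m [eta' [c' [hI' ->]]]].
exists (n + m)%N, (fun i => match fintype.split i with inl j => eta j | inr j => eta' j end),
  (fun i => match fintype.split i with inl j => c j | inr j => c' j end); split.
  by move=> i; case: (fintype.split i).
apply/funext => y; rewrite big_split_ord /=; congr (_ + _); apply: eq_bigr => i _.
  by rewrite (unsplitK (inl i)).
by rewrite (unsplitK (inr i)).
Qed.

Lemma monomial_spanZ k u : span u -> span (fun y => k * u y).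
Proof.
move=> [n [eta [c [hI ->]]]]; exists n, eta, (fun i => k * c i); split => //.
by apply/funext => y; rewrite mulr_sumr; apply: eq_bigr => i _; rewrite mulrA.
Qed.

Lemma monomial_span_monomial eta : I eta -> span (monomial eta).
Proof.
move=> Ie; exists 1%N, (fun=> eta), (fun=> 1); split => //.
by apply/funext => y; rewrite big_ord1 mul1r.
Qed.

Lemma monomial_span_lin_comb n (B : 'I_n -> domain y0 -> R) (c : 'cV[R]_n) :
  (forall i, span (B i)) -> span (lin_comb B c).
Proof.
move=> hB; rewrite /lin_comb.
elim: (index_enum _) => [|i s IH].
  rewrite (_ : (fun _ => _) = fun=> 0); first exact: monomial_span0.
  by apply/funext => y; rewrite big_nil.
rewrite (_ : (fun y => _) = (fun y => c i 0 * B i y + \sum_(j <- s) c j 0 * B j y)).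
  by apply: monomial_spanD => //; exact: monomial_spanZ.
by apply/funext => y; rewrite big_cons.
Qed.

(* A finite-dimensional space may contain infinitely many monomials; since they
   are countably many, one null set serves all elements at once. *)
Lemma monomial_span_null_set (mu : probability (domain y0) R) n
  (B : 'I_n -> domain y0 -> R) :
  (forall eta, I eta -> finite_set [set j | eta j != 0%N]) ->
  orthonormal_basis mu span B ->
  exists Z, [/\ measurable Z, mu Z = 0%E &
    forall v, span v -> exists c : 'cV[R]_n, forall y, ~ Z y -> v y = lin_comb B c y].
Proof.
move=> finI [_ _ hB].
pose e (s : seq nat) : multiindex dim := fun j => nth 0%N s (coord_rank j).
(* One null set per code; codes that name no sequence, or a multi-index outside [I], get the empty
   set. *)
have /choice[N hN] : forall k, exists N : set (domain y0), [/\ measurable N, mu N = 0%E &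
    forall s : seq nat, unpickle k = Some s -> I (e s) ->
      exists c : 'cV[R]_n, forall y, ~ N y -> monomial (e s) y = lin_comb B c y].
  move=> k; case E : (unpickle k) => [s|]; last by exists set0; split.
  have [Is|nIs] := pselect (I (e s)); last by exists set0; split => // ? [<-].
  have [c [N [mN N0 hN]]] := hB _ (monomial_span_monomial Is).
  exists N; split => // _ [<-] _; exists (\col_i c i) => y Ny.
  apply: contrapT => h; apply: Ny; apply: hN => /= h'; apply: h; rewrite h'.
  by apply: eq_bigr => i _; rewrite mxE.
exists (\bigcup_k N k); split.
- by apply: bigcupT_measurable => k; case: (hN k).
- apply/negligibleP; first by apply: bigcupT_measurable => k; case: (hN k).
  by apply: negligible_bigcup => k; case: (hN k) => mN N0 _; exact/negligibleP.
move=> _ [m [eta [a [Ieta ->]]]].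
have /choice[c hc] : forall i, exists c : 'cV[R]_n, forall y,
    ~ (\bigcup_k N k) y -> monomial (eta i) y = lin_comb B c y.
  move=> i; have [s es] := finite_support_code (finI _ (Ieta i)).
  have [_ _ /(_ s)] := hN (pickle s); rewrite pickleK => /(_ erefl).
  rewrite -[e s]es => /(_ (Ieta i))[c hc]; exists c => y Zy; apply: hc => Ny.
  by apply: Zy; exists (pickle s).
exists (\sum_i a i *: c i) => y Zy.
rewrite /lin_comb; under [RHS]eq_bigr do rewrite summxE mulr_suml.
rewrite exchange_big /=; apply: eq_bigr => i _; rewrite hc// mulr_sumr.
by apply: eq_bigr => j _; rewrite !mxE mulrA.
Qed.

End polynomial_spaces.

(** * Sample sizes and elementary sums *)

Section elementary.
Context {R : realType}.
Implicit Types x y q : R.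

Lemma ln2_gt_half : 2^-1 <= ln 2 :> R.
Proof.
rewrite -ler_expR lnK ?posrE// -[X in expR X]opprK expRN.
rewrite -[leRHS]invrK lef_pV2 ?posrE ?expR_gt0//.
by apply: le_trans (expR_ge1Dx _); lra.
Qed.

Lemma ln2_lt1 : ln 2 < 1 :> R.
Proof.
rewrite -ltr_expR lnK ?posrE//.
have h : expR (2^-1 : R) >= 3 / 2 by apply: le_trans (expR_ge1Dx _); lra.
have -> : expR (1 : R) = expR 2^-1 ^+ 2 by rewrite -expRM_natl; congr expR; field.
apply: (@lt_le_trans _ _ ((3 / 2) ^+ 2)); first by rewrite expr2; lra.
by rewrite lerXn2r ?nnegrE ?expR_ge0//; lra.
Qed.

Lemma ln_le_tangent x y : 0 < x -> 0 < y -> ln x <= ln y + x / y - 1.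
Proof.
move=> x0 y0; have : 1 + ln (x / y) <= expR (ln (x / y)) by exact: expR_ge1Dx.
rewrite lnK ?posrE ?divr_gt0// ln_div ?posrE//; lra.
Qed.

Lemma geometric_le q n : 0 <= q -> q < 1 -> \sum_(i < n) q ^+ i <= (1 - q)^-1.
Proof.
move=> q0 q1; have p : 0 < 1 - q by rewrite subr_gt0.
rewrite -[leRHS]mul1r ler_pdivlMr// mulrC.
have -> : (1 - q) * (\sum_(i < n) q ^+ i) = 1 - q ^+ n.
  by rewrite -[X in _ = X - _](expr1n _ n) subrXX; congr (_ * _); apply: eq_bigr => i _; rewrite expr1n mul1r.
by rewrite gerBl exprn_ge0.
Qed.

(** The closed form in the proof is the derivative of a finite geometric sum. *)
Lemma arith_geometric_le q n : 0 <= q -> q < 1 ->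
  \sum_(i < n) (1 + i%:R) * q ^+ i <= (1 - q) ^- 2.
Proof.
move=> q0 q1; have p : 0 < 1 - q by rewrite subr_gt0.
have -> : \sum_(i < n) (1 + i%:R) * q ^+ i =
    (1 - (n.+1%:R - n%:R * q) * q ^+ n) / (1 - q) ^+ 2.
  elim: n => [|n IH]; first by rewrite big_ord0 expr0 mul0r subr0 mulr1 subrr mul0r.
  rewrite big_ord_recr /= IH [q ^+ n.+1]exprS -[n.+2%:R]natr1 -[n.+1%:R]natr1.
  by field; rewrite gt_eqF.
rewrite -[leRHS]mul1r ler_wpM2r ?invr_ge0 ?sqr_ge0// gerBl mulr_ge0 ?exprn_ge0//.
rewrite subr_ge0 (@le_trans _ _ n%:R)// ?ler_nat// ler_piMr// ltW//.
Qed.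

End elementary.

(** Chosen so that this constant times [(1 + L) * mu] is twice [2 * mu / kappa]; the outer factor 2
    comes from solving [N <= Q * ln N] for [N]. *)
Definition size_constant (R : realType) : R := 8 / (1 - ln 2).

Section sample_size.
Context {R : realType}.
Variables (L N : nat) (mu : R).
Hypothesis mu1 : 1 <= mu.
Hypothesis adm : mu <= kappa R L * (N%:R / ln N%:R) <= 2 * mu.

Let L1 : 0 < 1 + L%:R :> R. Proof. by rewrite ltr_pwDl. Qed.

Let k0 : 0 < kappa R L.
Proof. by rewrite divr_gt0 ?subr_gt0 ?ln2_lt1// -[X in X + _]mulr1 -mulrDr mulr_gt0. Qed.

(** For [N = 0] and [N = 1] the quotient [N / ln N] evaluates to 0 (the inverse of [ln 1 = 0] being
    0), against the lower bound. *)
Let N2 : (2 <= N)%N.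
Proof.
case: N adm => [|[|//]]; first by rewrite mul0r mulr0 leNgt (lt_le_trans _ mu1).
by rewrite ln1 invr0 !mulr0 leNgt (lt_le_trans _ mu1).
Qed.

Let lnN : 2^-1 <= ln (N%:R : R).
Proof.
apply: le_trans ln2_gt_half _; rewrite ler_ln ?posrE ?ltr0n ?(leq_trans _ N2)//.
by rewrite ler_nat.
Qed.

Lemma sample_size_gt0 : (0 < N)%N. Proof. exact: leq_trans N2. Qed.

Lemma sample_size_lower : 2 * (1 + L%:R) * mu * ln N%:R <= N%:R.
Proof.
have lnN2 := lnN; have lnN0 : 0 < ln (N%:R : R) by lra.
have h : mu * ln N%:R <= kappa R L * N%:R.
  by case/andP: adm => + _; rewrite mulrA ler_pdivlMr.
have k1 : kappa R L <= (2 * (1 + L%:R))^-1.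
  rewrite /kappa mulrDr mulr1 ler_piMl ?invr_ge0 ?addr_ge0// ?mulr_ge0//.
  by have := @ln2_gt_half R; lra.
have : mu * ln N%:R <= (2 * (1 + L%:R))^-1 * N%:R.
  by apply: le_trans h _; rewrite ler_wpM2r.
by rewrite ler_pdivlMl ?mulr_gt0// mulrA.
Qed.

Lemma sample_size_ge_level : 1 + L%:R <= N%:R :> R.
Proof.
apply: le_trans sample_size_lower.
have h : 1 <= 2 * ln (N%:R : R) by have := lnN; lra.
have -> : 2 * (1 + L%:R) * mu * ln N%:R = (1 + L%:R) * (mu * (2 * ln N%:R)) by ring.
by rewrite ler_peMr ?(ltW L1)// mulr_ege1.
Qed.

Local Notation K := (size_constant R).

(** The implicit bound [N <= Q * ln N] is solved with the tangent of [ln] at [2 * Q], whose slope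
    lets half of [N] be absorbed on the left. *)
Lemma sample_size_upper :
  N%:R <= K * (1 + L%:R) * mu * (ln K + ln (1 + L%:R) + ln mu).
Proof.
have mu0 : 0 < mu by exact: lt_le_trans mu1.
have lnN2 := lnN; have lnN0 : 0 < ln (N%:R : R) by lra.
have N0 : 0 < N%:R :> R by rewrite ltr0n sample_size_gt0.
have K0 : 0 < K by rewrite /size_constant divr_gt0// subr_gt0 ln2_lt1.
pose Q := 2 * mu / kappa R L.
have Q0 : 0 < Q by rewrite divr_gt0// mulr_gt0.
have NQ : N%:R <= Q * ln N%:R.
  case/andP: adm => _; rewrite mulrA ler_pdivrMr// /Q => h.
  by rewrite mulrAC ler_pdivlMr// mulrC.
have Q2 : 2 * Q = K * (1 + L%:R) * mu.
  rewrite /Q /size_constant /kappa; have l1 : 1 - ln 2 != 0 :> R by rewrite gt_eqF// subr_gt0 ln2_lt1.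
  have l2 : 2 + 2 * L%:R != 0 :> R by rewrite gt_eqF//; have := L1; lra.
  by field; rewrite l1 l2.
rewrite -Q2.
have -> : ln K + ln (1 + L%:R) + ln mu = ln (2 * Q).
  have KL : 0 < K * (1 + L%:R) by rewrite mulr_gt0 ?L1.
  by rewrite Q2 (lnM KL mu0) (lnM K0 L1).
have Q20 : 0 < 2 * Q by rewrite mulr_gt0.
have := ln_le_tangent N0 Q20; rewrite -(ler_pM2l Q0).
have -> : Q * (ln (2 * Q) + N%:R / (2 * Q) - 1) = Q * ln (2 * Q) + N%:R / 2 - Q.
  by field; rewrite gt_eqF.
by lra.
Qed.

(** The exponent is at least [(1 + L) * ln N / (8 * C1)] and is cut in halves. By [16 * C1 <= 1 + L]
    one half yields [1 / N], which cancels the dimension, at most [C1 * N]; the other half uses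
    [1 + L <= N]. *)
Lemma failure_probability_le (C1 : R) (n : nat) : 0 < C1 -> (0 < n)%N ->
  n%:R <= C1 * mu -> 16 * C1 <= 1 + L%:R ->
  3 * n%:R * expR (- (N%:R / (16 * n%:R))) <=
  3 * C1 * expR (- ((1 + L%:R) * ln (1 + L%:R) / (16 * C1))).
Proof.
move=> C10 n0 nC LC.
have n0' : 0 < n%:R :> R by rewrite ltr0n.
have mu0 : 0 < mu by exact: lt_le_trans mu1.
have lnN2 := lnN; have lnN0 : 0 < ln (N%:R : R) by lra.
have N0 : 0 < N%:R :> R by rewrite ltr0n sample_size_gt0.
have lnL : ln (1 + L%:R) <= ln N%:R :> R.
  by rewrite ler_ln ?posrE ?sample_size_ge_level.
have muN : mu <= N%:R.
  apply: le_trans sample_size_lower.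
  have -> : 2 * (1 + L%:R) * mu * ln N%:R = mu * ((1 + L%:R) * (2 * ln N%:R)) by ring.
  by rewrite ler_peMr ?(ltW mu0)// mulr_ege1 ?lerDl//; lra.
have e1 : (1 + L%:R) * ln N%:R / (8 * C1) <= N%:R / (16 * n%:R).
  rewrite ler_pdivlMr ?mulr_gt0//.
  apply: (@le_trans _ _ ((1 + L%:R) * ln N%:R / (8 * C1) * (16 * (C1 * mu)))).
    rewrite ler_wpM2l ?ler_wpM2l// divr_ge0 ?mulr_ge0 ?(ltW L1) ?(ltW lnN0) ?(ltW C10)//.
  apply: le_trans sample_size_lower; rewrite le_eqVlt; apply/orP; left; apply/eqP.
  by field; rewrite gt_eqF.
have e2 : (1 + L%:R) * ln N%:R / (8 * C1) >=
    ln N%:R + (1 + L%:R) * ln (1 + L%:R) / (16 * C1).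
  have -> : (1 + L%:R) * ln N%:R / (8 * C1) = (1 + L%:R) / (16 * C1) * ln N%:R +
      (1 + L%:R) * ln N%:R / (16 * C1) by field; rewrite gt_eqF.
  apply: lerD.
    by rewrite ler_peMl ?(ltW lnN0)// ler_pdivlMr ?mulr_gt0// mul1r.
  by rewrite ler_wpM2r ?invr_ge0 ?mulr_ge0 ?(ltW C10)// ler_wpM2l ?(ltW L1).
apply: (@le_trans _ _ (3 * (C1 * N%:R) *
   expR (- (ln N%:R + (1 + L%:R) * ln (1 + L%:R) / (16 * C1))))).
  rewrite ler_pM ?mulr_ge0 ?expR_ge0 ?(ltW n0')//.
    by rewrite ler_wpM2l// (le_trans nC)// ler_wpM2l// ltW.
  by rewrite ler_expR lerN2 (le_trans e2).
rewrite opprD expRD [expR (- ln _)]expRN lnK ?posrE//.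
by rewrite le_eqVlt; apply/orP; left; apply/eqP; field; rewrite gt_eqF.
Qed.

End sample_size.

Lemma superexponential_decay (R : realType) (b c C rho : R) : 0 <= b -> 0 < c -> 0 < C ->
  exists L0 : nat, forall L : nat, (L0 <= L)%N -> C <= 1 + L%:R /\
    b * expR (- ((1 + L%:R) * ln (1 + L%:R) / C)) <= c * expR (- (rho * L%:R)).
Proof.
move=> b0 c0 C0.
(* Once [ln (1 + L) / C] exceeds [K], one copy of it pays for the constants and the other [L] copies
   for [rho]. Taking [1 + b] keeps the argument of the logarithm positive when [b = 0]. *)
pose K := `|ln ((1 + b) / c)| + `|rho|.
have K0 : 0 <= K by rewrite addr_ge0.
exists (Num.trunc (C + expR (C * K))).+1 => L hL.
have hL' : C + expR (C * K) <= L%:R.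
  by apply: le_trans (ltW (truncnS_gt _)) _; rewrite ler_nat.
have e0 := expR_gt0 (C * K).
split; first by lra.
have L1 : 0 < 1 + L%:R :> R by rewrite ltr_pwDl.
have lnL : K <= ln (1 + L%:R) / C.
  rewrite ler_pdivlMr// mulrC -ler_expR lnK ?posrE//; lra.
have h : K + `|rho| * L%:R <= (1 + L%:R) * ln (1 + L%:R) / C.
  rewrite -mulrA; apply: le_trans (ler_wpM2l (ltW L1) lnL).
  rewrite mulrDl mul1r lerD2l mulrC ler_wpM2l// /K lerDr//.
apply: (@le_trans _ _ ((1 + b) * expR (- (`|ln ((1 + b) / c)| + rho * L%:R)))).
  rewrite ler_pM ?expR_ge0// ?lerDr// ler_expR lerN2 (le_trans _ h)// /K -addrA lerD2l.
  have : rho * L%:R <= `|rho| * L%:R by rewrite ler_wpM2r// ler_norm.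
  by have := normr_ge0 rho; lra.
have b1 : 0 < (1 + b) / c by rewrite divr_gt0// ltr_pwDl.
rewrite opprD expRD mulrA ler_wpM2r ?expR_ge0//.
rewrite expRN ler_pdivrMr ?expR_gt0// mulrC -ler_pdivrMr//.
by rewrite -{1}[(1 + b) / c]lnK ?posrE// ler_expR ler_norm.
Qed.

(** * Choice of the level *)

Section level_sums.
Context {R : realType}.
Variables (alpha beta_s beta_w gamma sigma : R).
Hypotheses (s0 : 0 < beta_s) (sw : beta_s <= beta_w) (sigma0 : 0 < sigma).
Hypotheses (alpha0 : 0 < alpha) (gamma0 : 0 < gamma).
Local Notation delta := (delta alpha beta_s beta_w gamma).
Local Notation lambda := (lambda alpha beta_s beta_w gamma sigma).
Local Notation r1 := (alpha / (sigma + alpha)).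
Local Notation r2 := (beta_s / (gamma + beta_s)).

Definition log_scaleM (L : nat) : R :=
  if sigma / alpha < gamma / beta_s then L%:R * delta else 0.

(** Decay rate of the error in [L]. In the second case it equals [alpha * delta + r2]: the scale [M]
    is tuned so that the projections attain the weak rate of the finest [f_n]. *)
Definition convergence_rate : R :=
  if gamma / beta_s <= sigma / alpha then r1 else beta_w / (gamma + beta_s).

(** In the balanced case all levels contribute equally, whence their number. *)
Definition error_factor (L : nat) : R :=
  if gamma / beta_s == sigma / alpha then 1 + L%:R else 1.

(** One factor [1 + L] comes from [kappa], one from the logarithm of the sample size, and in the
    balanced case one from the number of levels. In the last case the dominant level has [k = 0],
    and the logarithm is essentially [ln M = L * delta]. *)
Definition work_factor (L : nat) : R :=
  if gamma / beta_s < sigma / alpha then (1 + L%:R) ^+ 2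
  else if gamma / beta_s == sigma / alpha then (1 + L%:R) ^+ 3
  else (1 + L%:R) * (1 + ln (1 + L%:R) + L%:R * delta).

Let w0 : 0 < beta_w. Proof. exact: lt_le_trans sw. Qed.
Let sa0 : 0 < sigma + alpha. Proof. exact: addr_gt0. Qed.
Let gs0 : 0 < gamma + beta_s. Proof. exact: addr_gt0. Qed.

Let delta_ge0 : 0 <= delta.
by rewrite divr_ge0 ?subr_ge0 ?mulr_ge0 ?(ltW alpha0) ?(ltW gs0). Qed.

Lemma log_scaleM_ge0 L : 0 <= log_scaleM L.
Proof. by rewrite /log_scaleM; case: ifP => // _; rewrite mulr_ge0. Qed.

Lemma level_mE L k : level_m alpha beta_s beta_w gamma sigma L k =
  expR (log_scaleM L + k%:R / (sigma + alpha)).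
Proof.
rewrite /level_m /scaleM /log_scaleM; case: ifP => _; first by rewrite expRD.
by rewrite mul1r add0r.
Qed.

Lemma convergence_rate_gt0 : 0 < convergence_rate.
Proof. by rewrite /convergence_rate; case: ifP => _; rewrite divr_gt0. Qed.

(** The rates are [r1 = 1 / (1 + sigma / alpha)] and [r2 = 1 / (1 + gamma / beta_s)]. *)
Let rate_lt : (gamma / beta_s < sigma / alpha) = (r1 < r2).
Proof.
rewrite ltr_pdivrMr// mulrAC ltr_pdivlMr// ltr_pdivrMr// mulrAC ltr_pdivlMr//.
by apply/idP/idP; nra.
Qed.

Let rate_gt : (sigma / alpha < gamma / beta_s) = (r2 < r1).
Proof.
rewrite ltr_pdivrMr// mulrAC ltr_pdivlMr// ltr_pdivrMr// mulrAC ltr_pdivlMr//.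
by apply/idP/idP; nra.
Qed.

Lemma convergence_rate_le : convergence_rate <= beta_w / (gamma + beta_s).
Proof.
rewrite /convergence_rate; case: ifPn => // h.
apply: (@le_trans _ _ r2); last by rewrite ler_wpM2r// invr_ge0 ltW.
by rewrite leNgt -rate_gt -leNgt.
Qed.

(** [lambda] is the growth exponent of the work in [L] divided by the decay exponent of the error;
    this and the next identity express that in the two regimes. *)
Let lambda_rate_le : gamma / beta_s <= sigma / alpha ->
  lambda * convergence_rate = 1 - r1.
Proof.
by rewrite /lambda /convergence_rate => ->; field; rewrite !gt_eqF.
Qed.

Let lambda_rate_gt : sigma / alpha < gamma / beta_s ->
  lambda * convergence_rate = sigma * delta + (1 - r2).
Proof.
rewrite ltNge /lambda /convergence_rate => /negPf ->.
by rewrite /theta /delta; field; rewrite !gt_eqF// mulr_gt0.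
Qed.

Let rev_sum L (F : nat -> R) : \sum_(l < L.+1) F (L - l)%N = \sum_(l < L.+1) F l.
Proof. by rewrite (reindex_inj rev_ord_inj) /=; apply: eq_bigr => l _; rewrite subSS subKn// -ltnS. Qed.

(** The exponent is affine in [l]: according to the order of [r1] and [r2], the terms form a
    geometric series dominated by [l = 0] or by [l = L], or are all equal. *)
Lemma sum_level_errors : exists2 K : R, 0 < K & forall L,
  \sum_(l < L.+1) expR (- (alpha * (log_scaleM L + (L - l)%N%:R / (sigma + alpha)))
     - l%:R * r2) <= K * error_factor L * expR (- (L%:R * convergence_rate)).
Proof.
have LlE L (l : 'I_L.+1) : (L - l)%N%:R = L%:R - l%:R :> R by rewrite natrB// -ltnS.
rewrite /error_factor /log_scaleM /convergence_rate.
case: (ltgtP (gamma / beta_s) (sigma / alpha)) => [uv|uv|uv].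
- have q1 : expR (- (r2 - r1)) < 1 by rewrite expR_lt1 oppr_lt0 subr_gt0 -rate_lt.
  exists (1 - expR (- (r2 - r1)))^-1; first by rewrite invr_gt0 subr_gt0.
  move=> L; rewrite mulr1.
  under eq_bigr => l _.
    rewrite (_ : _ - _ = l%:R * - (r2 - r1) + - (L%:R * r1)); last first.
      by rewrite LlE; field; rewrite !gt_eqF.
    rewrite expRD expRM_natl; over.
  by rewrite -mulr_suml ler_wpM2r ?expR_ge0// geometric_le ?expR_ge0.
- have q1 : expR (- (r1 - r2)) < 1 by rewrite expR_lt1 oppr_lt0 subr_gt0 -rate_gt.
  exists (1 - expR (- (r1 - r2)))^-1; first by rewrite invr_gt0 subr_gt0.
  move=> L; rewrite mulr1.
  under eq_bigr => l _.
    rewrite (_ : _ - _ = (L - l)%N%:R * - (r1 - r2) + - (L%:R * (beta_w / (gamma + beta_s)))); last first.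
      by rewrite LlE /delta; field; rewrite !gt_eqF.
    rewrite expRD expRM_natl; over.
  rewrite -mulr_suml ler_wpM2r ?expR_ge0// (rev_sum L (fun j => expR (- (r1 - r2)) ^+ j)).
  by rewrite geometric_le ?expR_ge0.
- exists 1 => // L; rewrite mul1r.
  have r12 : r1 = r2.
    apply/eqP; rewrite eq_le !leNgt -rate_lt -rate_gt uv.
    by rewrite ltxx.
  under eq_bigr => l _.
    rewrite (_ : _ - _ = - (L%:R * r1)); last first.
      by rewrite -r12 LlE; field; rewrite gt_eqF.
    over.
  by rewrite sumr_const card_ord -[leLHS]mulr_natl -natr1 addrC.
Qed.

Lemma sum_level_works : exists2 K : R, 0 < K & forall L,
  \sum_(l < L.+1) (1 + L%:R) * (1 + ln (1 + L%:R) + log_scaleM L + (L - l)%N%:R) *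
     expR (sigma * (log_scaleM L + (L - l)%N%:R / (sigma + alpha)) +
       gamma * (l%:R / (gamma + beta_s)))
  <= K * work_factor L * expR (L%:R * (lambda * convergence_rate)).
Proof.
have LlE L (l : 'I_L.+1) : (L - l)%N%:R = L%:R - l%:R :> R by rewrite natrB// -ltnS.
have L1 L : 0 < 1 + L%:R :> R by rewrite ltr_pwDl.
have lnL L : ln (1 + L%:R) <= L%:R :> R by rewrite -ler_expR lnK ?posrE// expR_ge1Dx.
have lnL0 L : 0 <= ln (1 + L%:R) :> R by rewrite ln_ge0// lerDl.
have brack L (l : 'I_L.+1) : 1 + ln (1 + L%:R) + 0 + (L - l)%N%:R <= 2 * (1 + L%:R) :> R.
  by have := lnL L; have : 0 <= l%:R :> R by []; rewrite LlE; lra.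
have brack0 L (l : 'I_L.+1) : 0 <= 1 + ln (1 + L%:R) + 0 + (L - l)%N%:R :> R.
  by rewrite !addr_ge0.
rewrite /work_factor /log_scaleM.
case: (ltgtP (gamma / beta_s) (sigma / alpha)) => [uv|uv|uv].
- have q1 : expR (- (r2 - r1)) < 1 by rewrite expR_lt1 oppr_lt0 subr_gt0 -rate_lt.
  exists (2 * (1 - expR (- (r2 - r1)))^-1); first by rewrite mulr_gt0// invr_gt0 subr_gt0.
  move=> L; rewrite (lambda_rate_le (ltW uv)).
  apply: (@le_trans _ _ (\sum_(l < L.+1) (2 * (1 + L%:R) ^+ 2 * expR (L%:R * (1 - r1))) *
     expR (- (r2 - r1)) ^+ l)).
    apply: ler_sum => l _.
    rewrite (_ : sigma * _ + _ = L%:R * (1 - r1) + l%:R * - (r2 - r1)); last first.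
      by rewrite LlE; field; rewrite !gt_eqF.
    rewrite expRD [expR (l%:R * _)]expRM_natl mulrA ler_wpM2r ?exprn_ge0 ?expR_ge0// ler_wpM2r ?expR_ge0//.
    have -> : 2 * (1 + L%:R) ^+ 2 = (1 + L%:R) * (2 * (1 + L%:R)) :> R by ring.
    by rewrite ler_wpM2l ?(ltW (L1 L)).
  rewrite -mulr_sumr.
  apply: le_trans (ler_wpM2l _ (geometric_le _ (expR_ge0 _) q1)) _.
    by rewrite !mulr_ge0 ?expR_ge0 ?sqr_ge0.
  by rewrite le_eqVlt; apply/orP; left; apply/eqP; ring.
- have q1 : expR (- (r1 - r2)) < 1 by rewrite expR_lt1 oppr_lt0 subr_gt0 -rate_gt.
  exists ((1 - expR (- (r1 - r2))) ^- 2); first by rewrite invr_gt0 exprn_gt0// subr_gt0.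
  move=> L; rewrite lambda_rate_gt//.
  set A := 1 + ln (1 + L%:R) + L%:R * delta.
  have A1 : 1 <= A by rewrite /A -addrA lerDl addr_ge0// mulr_ge0.
  (* The work concentrates near [l = L], where [j = L - l] is small; keeping [1 + j] inside an
     arithmetic-geometric series avoids another power of [1 + L]. *)
  pose F j := (1 + L%:R) * A * expR (L%:R * (sigma * delta + (1 - r2))) *
     ((1 + j%:R) * expR (- (r1 - r2)) ^+ j).
  apply: (@le_trans _ _ (\sum_(l < L.+1) F (L - l)%N)).
    apply: ler_sum => l _; rewrite /F.
    rewrite (_ : sigma * _ + _ = L%:R * (sigma * delta + (1 - r2)) + (L - l)%N%:R * - (r1 - r2)); last first.
      by rewrite LlE /delta; field; rewrite !gt_eqF.
    rewrite expRD [expR ((L - l)%N%:R * _)]expRM_natl.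
    move: (expR _) (expR_ge0 (L%:R * (sigma * delta + (1 - r2)))) => E E0.
    have q0 := exprn_ge0 (L - l) (expR_ge0 (- (r1 - r2))).
    move: (_ ^+ (L - l)) q0 => Q Q0.
    have -> : (1 + L%:R) * A * E * ((1 + (L - l)%N%:R) * Q) =
       (1 + L%:R) * (A * (1 + (L - l)%N%:R)) * (E * Q) by ring.
    rewrite ler_wpM2r ?mulr_ge0// ler_wpM2l ?(ltW (L1 L))// mulrDr mulr1 lerD2l.
    by rewrite ler_peMl.
  rewrite rev_sum /F -mulr_sumr.
  apply: le_trans (ler_wpM2l _ (arith_geometric_le _ (expR_ge0 _) q1)) _.
    by rewrite !mulr_ge0 ?expR_ge0 ?(ltW (L1 L))// (le_trans _ A1).
  by rewrite le_eqVlt; apply/orP; left; apply/eqP; ring.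
- exists 2 => // L; rewrite lambda_rate_le ?uv//.
  have r12 : r1 = r2.
    apply/eqP; rewrite eq_le !leNgt -rate_lt -rate_gt uv.
    by rewrite ltxx.
  apply: (@le_trans _ _ (\sum_(l < L.+1) (2 * (1 + L%:R) ^+ 2 * expR (L%:R * (1 - r1))))).
    apply: ler_sum => l _.
    have e : gamma * (l%:R / (gamma + beta_s)) = l%:R * (1 - r1).
      by rewrite r12; field; rewrite gt_eqF.
    rewrite e (_ : sigma * _ + _ = L%:R * (1 - r1)); last first.
      by rewrite LlE; field; rewrite !gt_eqF.
    rewrite ler_wpM2r ?expR_ge0//.
    have -> : 2 * (1 + L%:R) ^+ 2 = (1 + L%:R) * (2 * (1 + L%:R)) :> R by ring.
    by rewrite ler_wpM2l ?(ltW (L1 L)).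
  rewrite sumr_const card_ord -[leLHS]mulr_natl -natr1.
  by rewrite le_eqVlt; apply/orP; left; apply/eqP; ring.
Qed.

(** Serves to choose the offset [D] in the level: the bound on the number of levels is affine in
    [D], the gain in accuracy exponential. *)
Lemma exists_expR_ge_affine (a b : R) : 0 <= a -> 0 <= b ->
  exists2 D : R, 0 <= D & a + b * D <= expR D.
Proof.
move=> a0 b0; pose D := 4 * (a + b + 1).
have D0 : 1 <= D by rewrite /D; lra.
exists D; first by lra.
have -> : expR D = expR (D / 2) ^+ 2 by rewrite -expRM_natl; congr expR; field.
apply: (@le_trans _ _ ((D / 2) ^+ 2)); last first.
  rewrite lerXn2r ?nnegrE ?expR_ge0//; first by lra.
  by apply: le_trans (expR_ge1Dx _); lra.
have -> : (D / 2) ^+ 2 = (a + b + 1) * D by rewrite /D; field.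
have h : a <= a * D by rewrite ler_peMr.
by rewrite !mulrDl mul1r; lra.
Qed.

(* With x = |log eps|, the level L = (x + ln x + D) / rate (without ln x unless
   gamma / beta_s = sigma / alpha) balances the error e^(- rate L) against eps. *)
Lemma exists_level (K : R) (L0 : nat) : 0 < K ->
  exists x0 C : R, 0 < C /\ forall x, x0 <= x -> exists L : nat,
    [/\ (L0 <= L)%N,
      K * error_factor L * expR (- (L%:R * convergence_rate)) <= expR (- x) &
      work_factor L * expR (L%:R * (lambda * convergence_rate)) <=
      C * expR (lambda * x) * x `^ (log_exponent alpha beta_s beta_w gamma sigma) * ln x].
Proof.
move=> K0; have r0 := convergence_rate_gt0; move rE : convergence_rate r0 => r r0.
(* In the balanced case an extra [ln x] in the level pays for the factor [1 + L] of the error. In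
   the work it costs [x] to the power [lambda], the summand [sigma / alpha] of the log exponent. *)
pose tau : R := if gamma / beta_s == sigma / alpha then 1 else 0.
have tau01 : 0 <= tau <= 1 by rewrite /tau; case: ifP => _; rewrite ?lexx ?ler01.
have [D D0 hD] := @exists_expR_ge_affine (K * (2 / r + 2)) (K / r)
  (mulr_ge0 (ltW K0) (addr_ge0 (divr_ge0 (ler0n _ 2) (ltW r0)) (ler0n _ 2)))
  (divr_ge0 (ltW K0) (ltW r0)).
(* Chosen for [1 + L <= K4 * x]; then [hD] amounts to [K * K4 <= expR D]. *)
pose K4 := 2 / r + 2 + D / r.
have Dr0 : 0 <= D / r by rewrite divr_ge0// ltW.
have r20 : 0 <= 2 / r by rewrite divr_ge0// ltW.
have K41 : 1 <= K4 by rewrite /K4; lra.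
have hD' : K * K4 <= expR D.
  by apply: le_trans hD; rewrite /K4 le_eqVlt; apply/orP; left; apply/eqP; ring.
have lam0 : 0 <= lambda.
  rewrite /lambda; case: ifP => _; first by rewrite divr_ge0// ltW.
  have th : theta beta_s beta_w <= 1 by rewrite /theta ler_pdivrMr// mul1r.
  by rewrite addr_ge0// mulr_ge0 ?subr_ge0// divr_ge0// ltW.
have lnK40 : 0 <= ln K4 by rewrite ln_ge0.
(* [expR 1 <= x] gives [1 <= ln x], and [r * L0 <= x] forces the level above [L0]. *)
exists (expR 1 + r * L0%:R).
exists ((1 + delta) * (2 + ln K4) * K4 ^+ 3 * expR (lambda * (D + r))).
split.
  by rewrite !mulr_gt0 ?expR_gt0 ?exprn_gt0 ?(lt_le_trans _ K41)// ltr_pwDl.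
move=> x hx; have rL0 : 0 <= r * L0%:R by rewrite mulr_ge0// ltW.
have xe : expR 1 <= x by lra.
have x1 : 1 <= x by apply: le_trans xe; have := @expR_ge1Dx R 1; lra.
have x0 : 0 < x by lra.
have lnx1 : 1 <= ln x by rewrite -[leLHS]expRK ler_ln ?posrE ?expR_gt0.
have lnxx : ln x <= x by have := ln_le_tangent x0 ltr01; rewrite ln1; lra.
pose z := (x + tau * ln x + D) / r.
have tl0 : 0 <= tau * ln x by rewrite mulr_ge0//; case/andP: tau01 => //; lra.
have tl1 : tau * ln x <= ln x by rewrite ler_piMl//; [lra|case/andP: tau01].
have z0 : 0 <= z by rewrite divr_ge0// ?(ltW r0)//; lra.
pose L := (Num.trunc z).+1.
have zL : z <= L%:R by exact: ltW (truncnS_gt z).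
have Lz : L%:R <= z + 1 by rewrite /L -natr1 lerD2r truncn_le.
have zr : z * r = x + tau * ln x + D by rewrite /z divfK// gt_eqF.
have L1 : 1 + L%:R <= K4 * x.
  have h1 : x / r * 2 + D / r <= K4 * x - 2 * x.
    have -> : K4 * x - 2 * x = x / r * 2 + D / r * x by rewrite /K4; field; rewrite gt_eqF.
    by rewrite lerD2l ler_peMr.
  have h2 : z <= x / r * 2 + D / r.
    have -> : x / r * 2 + D / r = (x + x + D) / r by field; rewrite gt_eqF.
    by rewrite ler_wpM2r ?invr_ge0 ?(ltW r0)//; lra.
  by lra.
have L10 : 0 < 1 + L%:R :> R by rewrite ltr_pwDl.
exists L; split.
- rewrite -(ler_nat R); apply: le_trans zL; rewrite ler_pdivlMr//.
  by rewrite mulrC; have := expR_gt0 (1 : R); lra.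
- apply: (@le_trans _ _ (K * error_factor L * expR (- (x + tau * ln x + D)))).
    rewrite ler_wpM2l//.
      by rewrite mulr_ge0 ?(ltW K0)// /error_factor; case: ifP => // _; exact: ltW.
    by rewrite ler_expR lerN2 -zr ler_wpM2r// ltW.
  have -> : - (x + tau * ln x + D) = - x + (- (tau * ln x) + - D) by ring.
  rewrite expRD mulrCA ler_piMr ?expR_ge0// expRD mulrA [expR (- D)]expRN ler_pdivrMr ?expR_gt0// mul1r.
  apply: le_trans hD'; rewrite -mulrA ler_wpM2l ?(ltW K0)//.
  rewrite /error_factor /tau; case: ifP => _.
    by rewrite mul1r expRN lnK ?posrE// ler_pdivrMr.
  by rewrite mul0r oppr0 expR0 mulr1.
- have hexp : expR (L%:R * (lambda * r)) <=
      expR (lambda * (D + r)) * expR (lambda * x) * x `^ (tau * lambda).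
    have -> : x `^ (tau * lambda) = expR (lambda * (tau * ln x)).
      by rewrite /powR gt_eqF//; congr expR; ring.
    rewrite -!expRD ler_expR mulrCA -!mulrDr ler_wpM2l//.
    have : L%:R * r <= (z + 1) * r by rewrite ler_wpM2r// ltW.
    by rewrite mulrDl zr mul1r; lra.
  suff hw : work_factor L * x `^ (tau * lambda) <= (1 + delta) * (2 + ln K4) * K4 ^+ 3 *
      (x `^ log_exponent alpha beta_s beta_w gamma sigma * ln x).
    have wf0 : 0 <= work_factor L.
      rewrite /work_factor; case: ifP => _; first by rewrite exprn_ge0// ltW.
      case: ifP => _; first by rewrite exprn_ge0// ltW.
      by rewrite mulr_ge0 ?(ltW L10)// !addr_ge0 ?ln_ge0 ?lerDl// mulr_ge0.
    apply: le_trans (ler_wpM2l wf0 hexp) _.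
    move: hw; move: (expR (lambda * (D + r))) (expR_ge0 (lambda * (D + r))) => E1 E10.
    move: (expR (lambda * x)) (expR_ge0 (lambda * x)) => E2 E20 hw.
    rewrite [leLHS](_ : _ = E1 * E2 * (work_factor L * x `^ (tau * lambda))); last by ring.
    apply: le_trans (ler_wpM2l (mulr_ge0 E10 E20) hw) _.
    by rewrite le_eqVlt; apply/orP; left; apply/eqP; ring.
  have K43 : K4 ^+ 2 <= K4 ^+ 3 by rewrite ler_weXn2l.
  have K40 : 0 <= K4 by lra.
  have K430 : 0 <= K4 ^+ 3 by rewrite exprn_ge0.
  have c1 : 1 <= (1 + delta) * (2 + ln K4).
    by rewrite mulr_ege1 ?lerDl//; lra.
  have hsq : (1 + L%:R) ^+ 2 <= K4 ^+ 3 * x ^+ 2.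
    apply: (@le_trans _ _ ((K4 * x) ^+ 2)).
      by rewrite lerXn2r ?nnegrE ?(ltW L10)// mulr_ge0// ltW.
    by rewrite exprMn ler_wpM2r// sqr_ge0.
  have xlnx (p q : R) : 0 <= p -> 0 <= q -> p <= K4 ^+ 3 * q ->
      p <= (1 + delta) * (2 + ln K4) * K4 ^+ 3 * (q * ln x).
    move=> p0 q0 pq; apply: (le_trans pq).
    have -> : (1 + delta) * (2 + ln K4) * K4 ^+ 3 * (q * ln x) =
      K4 ^+ 3 * q * ((1 + delta) * (2 + ln K4) * ln x) by ring.
    by rewrite ler_peMr ?mulr_ge0// mulr_ege1.
  rewrite /work_factor /log_exponent /tau.
  case: (ltgtP (gamma / beta_s) (sigma / alpha)) => [uv|uv|uv].
  + rewrite mul0r powRr0 mulr1 powR_mulrn ?(ltW x0)//.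
    by apply: xlnx; rewrite ?exprn_ge0 ?(ltW L10) ?(ltW x0).
  + rewrite mul0r powRr0 mulr1.
    have lnL : ln (1 + L%:R) <= ln K4 + ln x.
      by rewrite -lnM ?posrE ?(lt_le_trans _ K41)// ler_ln ?posrE// mulr_gt0// (lt_le_trans _ K41).
    have [bb|bb] := eqVneq beta_w beta_s.
      have -> : delta = 0 by rewrite /delta bb subrr mul0r.
      rewrite mulr0 !addr0 powRr1 ?(ltW x0)// mul1r.
      have h1 : 1 + ln (1 + L%:R) <= (2 + ln K4) * ln x.
        rewrite mulrDl; have : ln K4 <= ln K4 * ln x by rewrite ler_peMr.
        by lra.
      apply: (@le_trans _ _ ((K4 * x) * ((2 + ln K4) * ln x))).
        by rewrite ler_pM ?(ltW L10)// addr_ge0// ln_ge0// lerDl.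
      have -> : (2 + ln K4) * K4 ^+ 3 * (x * ln x) = K4 ^+ 3 * (x * ((2 + ln K4) * ln x)) by ring.
      rewrite -mulrA ler_wpM2r//.
        by rewrite !mulr_ge0 ?(ltW x0)//; lra.
      by rewrite ler_eXnr.
    rewrite powR_mulrn ?(ltW x0)//.
    have lnL' : ln (1 + L%:R) <= L%:R :> R by rewrite -ler_expR lnK ?posrE// expR_ge1Dx.
    have dL : L%:R * delta <= (1 + L%:R) * delta by rewrite ler_wpM2r// lerDr.
    apply: (@le_trans _ _ ((1 + delta) * (1 + L%:R) ^+ 2)).
      have -> : (1 + delta) * (1 + L%:R) ^+ 2 = (1 + L%:R) * ((1 + L%:R) + (1 + L%:R) * delta) by ring.
      by rewrite ler_wpM2l ?(ltW L10)// lerD// lerD2l.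
    apply: (@le_trans _ _ ((1 + delta) * (K4 ^+ 3 * x ^+ 2))).
      by rewrite ler_wpM2l// addr_ge0.
    have -> : (1 + delta) * (2 + ln K4) * K4 ^+ 3 * (x ^+ 2 * ln x) =
       (1 + delta) * (K4 ^+ 3 * x ^+ 2) * ((2 + ln K4) * ln x) by ring.
    apply: ler_peMr; last by rewrite mulr_ege1//; lra.
    apply: mulr_ge0; first by rewrite addr_ge0.
    by rewrite mulr_ge0 ?sqr_ge0.
  + rewrite mul1r.
    have lamE : lambda = sigma / alpha by rewrite /lambda uv lexx.
    rewrite lamE powRD; last by rewrite (gt_eqF x0) implybT.
    rewrite powR_mulrn ?(ltW x0)//.
    move: (x `^ (sigma / alpha)) (powR_ge0 x (sigma / alpha)) => p p0.
    rewrite [leRHS](_ : _ = (1 + delta) * (2 + ln K4) * K4 ^+ 3 * (x ^+ 3 * ln x) * p); last by ring.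
    rewrite ler_wpM2r//.
    apply: xlnx; rewrite ?exprn_ge0 ?(ltW L10) ?(ltW x0)//.
    by rewrite -exprMn lerXn2r ?nnegrE ?(ltW L10)// mulr_ge0// ltW.
Qed.

End level_sums.

(** * Integral inequalities and best approximation *)

Section integral_bounds.
Context d (T : measurableType d) (R : realType).
Variable mu : {measure set T -> \bar R}.

(* Needed because the least squares fit is chosen without regard to measurability
   in the sample. *)
Lemma le_integral_measurable_free (f1 f2 : T -> \bar R) :
  (forall x, 0 <= f1 x)%E -> (forall x, f1 x <= f2 x)%E ->
  (\int[mu]_x f1 x <= \int[mu]_x f2 x)%E.
Proof.
move=> f10 f12; rewrite !ge0_integralTE//; last by move=> x; exact: le_trans (f12 x).
by apply: ereal_sup_le => _ [h hf <-]; exists h => //= x; exact: le_trans (f12 x).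
Qed.

Lemma integral_sqrD_le (u v : T -> R) :
  measurable_fun setT u -> measurable_fun setT v ->
  (\int[mu]_x ((u x + v x) ^+ 2)%:E <=
   2%:E * \int[mu]_x (u x ^+ 2)%:E + 2%:E * \int[mu]_x (v x ^+ 2)%:E)%E.
Proof.
move=> mu' mv.
have mE (g : T -> R) : measurable_fun setT g -> measurable_fun setT (fun y => (g y ^+ 2)%:E).
  by move=> mg; apply/measurable_EFinP; exact: measurable_funX.
have sq0 (g : T -> R) y : [set: T] y -> (0 <= (g y ^+ 2)%:E)%E.
  by move=> _; rewrite lee_fin sqr_ge0.
have [m1 m2] := (mE _ mu', mE _ mv).
have two0 : (0 <= 2%:E :> \bar R)%E by [].
have z2 (g : T -> R) y : [set: T] y -> (0 <= 2%:E * (g y ^+ 2)%:E)%E.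
  by move=> yT; apply: mule_ge0 => //; exact: (sq0 g).
have m1' : measurable_fun setT (fun y => 2%:E * (u y ^+ 2)%:E)%E by exact: emeasurable_funM.
have m2' : measurable_fun setT (fun y => 2%:E * (v y ^+ 2)%:E)%E by exact: emeasurable_funM.
rewrite -(ge0_integralZl mu measurableT m1 (sq0 u) two0).
rewrite -(ge0_integralZl mu measurableT m2 (sq0 v) two0).
rewrite -(ge0_integralD mu measurableT (z2 u) m1' (z2 v) m2').
apply: le_integral_measurable_free => y; first by rewrite lee_fin sqr_ge0.
rewrite -!EFinM -EFinD lee_fin.
by have := sqr_ge0 (u y - v y); lra.
Qed.

Lemma integral_sqrB_le (u v : T -> R) :
  measurable_fun setT u -> measurable_fun setT v ->
  (\int[mu]_x ((u x - v x) ^+ 2)%:E <=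
   2%:E * \int[mu]_x (u x ^+ 2)%:E + 2%:E * \int[mu]_x (v x ^+ 2)%:E)%E.
Proof.
move=> mu' mv; apply: le_trans (integral_sqrD_le mu' (measurable_funN mv)) _.
by under [X in (_ + _ * X)%E]eq_integral do rewrite /= sqrrN.
Qed.

(** Expand the sum of [p i * P * (a i / p i - S / P) ^+ 2], a weighted variance. *)
Lemma weighted_sqr_sum_le n (a p : 'I_n -> R) : (forall i, 0 < p i) ->
  (\sum_i a i) ^+ 2 <= \sum_i (\sum_j p j) / p i * a i ^+ 2.
Proof.
case: n a p => [|n] a p p0; first by rewrite !big_ord0 expr0n.
have [P PE] : exists P, P = \sum_j p j by exists (\sum_j p j).
have [S SE] : exists S, S = \sum_i a i by exists (\sum_i a i).
have P0 : 0 < P by rewrite PE big_ord_recl ltr_pwDl// sumr_ge0// => i _; exact: ltW.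
have : 0 <= \sum_i p i * P * (a i / p i - S / P) ^+ 2.
  by apply: sumr_ge0 => i _; rewrite mulr_ge0 ?sqr_ge0// mulr_ge0// ltW.
have -> : \sum_i p i * P * (a i / p i - S / P) ^+ 2 =
    \sum_i P / p i * a i ^+ 2 - 2 * S * (\sum_i a i) + S ^+ 2 / P * (\sum_i p i).
  rewrite !mulr_sumr -sumrN -!big_split /=; apply: eq_bigr => i _.
  by field; rewrite !gt_eqF.
rewrite -SE -PE divfK ?gt_eqF//.
by rewrite expr2; lra.
Qed.

Lemma integral_sqr_sum_le n (h : 'I_n -> T -> R) (p : 'I_n -> R) :
  (forall i, measurable_fun setT (h i)) -> (forall i, 0 < p i) ->
  (\int[mu]_x ((\sum_i h i x) ^+ 2)%:E <=
   \sum_i ((\sum_j p j) / p i)%:E * \int[mu]_x (h i x ^+ 2)%:E)%E.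
Proof.
move=> mh p0; pose P := \sum_j p j.
have P0 : 0 <= P by apply: sumr_ge0 => i _; exact: ltW.
have c0 i : (0 <= (P / p i)%:E)%E by rewrite lee_fin divr_ge0// ltW.
have m i : measurable_fun setT (fun x => (h i x ^+ 2)%:E).
  by apply/measurable_EFinP; exact: measurable_funX.
have s0 i x : [set: T] x -> (0 <= (h i x ^+ 2)%:E)%E by rewrite lee_fin sqr_ge0.
rewrite (eq_bigr (fun i => \int[mu]_x ((P / p i)%:E * (h i x ^+ 2)%:E)))%E; last first.
  by move=> i _; rewrite (ge0_integralZl mu measurableT (m i) (s0 i) (c0 i)).
rewrite -ge0_integral_sum//; last 2 first.
- by move=> i; exact: emeasurable_funM.
- by move=> i x xT; apply: mule_ge0 => //; exact: s0.
apply: le_integral_measurable_free => x; first by rewrite lee_fin sqr_ge0.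
rewrite [leRHS](eq_bigr (fun i => (P / p i * h i x ^+ 2)%:E)); last first.
  by move=> i _; rewrite EFinM.
by rewrite sumEFin lee_fin weighted_sqr_sum_le.
Qed.

End integral_bounds.

Section best_approximation.
Context d (T : measurableType d) (R : realType) (mu : probability T R).
Context (F : normedModType R) (ev : {linear F -> (T -> R^o)}).

(** An element within twice the bound [e] replaces a minimizer, so the infimum need not be attained;
    squaring gives the factor 4. The supremum leaves out [g = 0], where [v = 0] serves. *)
Lemma best_approximation (V : set (T -> R)) (c e : R) (g : F) :
  V (cst 0) -> 0 < e ->
  (ereal_sup [set best_error mu V (ev g) * (`|g|^-1)%:E
               | g in [set g : F | g != 0%R]] <= c%:E)%E ->
  c * `|g| <= e ->
  exists2 v, V v & (\int[mu]_y ((ev g y - v y) ^+ 2)%:E <= (4 * e ^+ 2)%:E)%E.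
Proof.
move=> V0 e0 /ereal_supP hsup cge.
have [->|g0] := eqVneq g 0.
  exists (cst 0) => //; rewrite linear0.
  rewrite (eq_integral (cst 0%E)); last by move=> y _ /=; rewrite subr0 expr0n.
  by rewrite integral0 lee_fin; have := sqr_ge0 e; lra.
have ng0 : 0 < `|g| by rewrite normr_gt0.
have h1 : (best_error mu V (ev g) < (2 * e)%:E)%E.
  have := hsup (best_error mu V (ev g) * (`|g|^-1)%:E)%E; rewrite lee_pdivrMr// => h.
  apply: (@le_lt_trans _ _ (c%:E * `|g|%:E)%E); first by apply: h; exists g.
  by rewrite -EFinM lte_fin; lra.
have [_ [v Vv <-] hv] := ereal_inf_lt h1.
exists v => //; rewrite -(L2norm_sqr mu (fun y => ev g y - v y)).
have -> : (4 * e ^+ 2)%:E = ((2 * e)%:E ^+ 2)%E by rewrite -EFin_expe; congr EFin; ring.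
by rewrite lee_sqr ?Lnorm_ge0 ?lee_fin ?mulr_ge0 ?ltW.
Qed.

End best_approximation.

(** * The multilevel error *)

Lemma sum_level_difference (R : realType) d (X : measurableType d)
  (beta_s gamma : R) (f : R -> X -> R) L (y : X) :
  \sum_(l < L.+1) level_difference beta_s gamma f l y = f (level_n beta_s gamma L) y.
Proof.
elim: L => [|L IH]; first by rewrite big_ord1.
by rewrite big_ord_recr /= IH /=; ring.
Qed.

Section multilevel_error.
Context d (T : measurableType d) (R : realType) (mu : probability T R).
Variables (alpha beta_s beta_w gamma sigma : R).
Variables (V : R -> set (T -> R)) (dimV : R -> nat).
Variable B : forall m : R, 'I_(dimV m) -> T -> R.
Variables (f : R -> T -> R) (f_inf : T -> R) (L : nat) (N : nat -> nat).
Context d' (Omega : measurableType d') (P : probability Omega R).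
Variable Y : forall k : nat, 'I_(N k) -> {RV P >-> T}.
Local Notation m_ := (level_m alpha beta_s beta_w gamma sigma L).
Local Notation n_ := (level_n beta_s gamma).
Local Notation D := (level_difference beta_s gamma f).
Let A x (l : nat) := stabilized_least_squares mu (V (m_ (L - l)%N)) (@B (m_ (L - l)%N))
   (opt_weight (@B (m_ (L - l)%N))) (fun j => @Y (L - l)%N j x) (D l).
Variables (c : R) (e : 'I_L.+1 -> R) (H : 'I_L.+1 -> Omega -> \bar R).
Hypotheses (mf : forall l, (l <= L)%N -> measurable_fun setT (f (n_ l))).
Hypotheses (mf_inf : measurable_fun setT f_inf).
Hypotheses (mA : forall x (l : 'I_L.+1), measurable_fun setT (A x l)).
Hypotheses (e0 : forall l, 0 < e l).
Hypothesis tail : (\int[mu]_y ((f_inf y - f (n_ L) y) ^+ 2)%:E <= (c ^+ 2)%:E)%E.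
Hypotheses (mH : forall l, measurable_fun setT (H l)) (H0 : forall l x, (0 <= H l x)%E).
Hypothesis AH : forall x (l : 'I_L.+1), (\int[mu]_y ((D l y - A x l y) ^+ 2)%:E <= H l x)%E.
Hypothesis EH : forall l, (\int[P]_x H l x <= (73 * e l ^+ 2)%:E)%E.

(** With weights proportional to the [e l], the sum of [E / e l * e l ^+ 2] is [E ^+ 2], so no
    factor for the number of levels appears. *)
Lemma multilevel_mean_square_error :
  (mean_square_error mu alpha beta_s beta_w gamma sigma V B f L f_inf (@Y) <=
    (2 * c ^+ 2 + 146 * (\sum_l e l) ^+ 2)%:E)%E.
Proof.
have mD (l : 'I_L.+1) : measurable_fun setT (D l).
  case: l => -[|l] lL /=; first exact: mf.
  by apply: measurable_funB; apply: mf => //; exact: ltnW.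
pose E := \sum_l e l.
have E0 : 0 <= E by apply: sumr_ge0 => l _; exact: ltW.
have c0 l : (0 <= (E / e l)%:E)%E by rewrite lee_fin divr_ge0// ltW.
have mG l : measurable_fun setT (fun x => (E / e l)%:E * H l x)%E by exact: emeasurable_funM.
have G0 l x : (0 <= (E / e l)%:E * H l x)%E by exact: mule_ge0.
pose S x := (\sum_l (E / e l)%:E * H l x)%E.
have mS : measurable_fun setT S by exact: emeasurable_sum.
have S0 x : (0 <= S x)%E by apply: sume_ge0 => l _.
have le1 x : (L2norm mu (f_inf \- multilevel_approx mu alpha beta_s beta_w gamma sigma V B f L
     (fun k j => @Y k j x))%R ^+ 2 <= (2 * c ^+ 2)%:E + 2%:E * S x)%E.
  rewrite L2norm_sqr.
  rewrite (eq_integral (fun y => (((f_inf y - f (n_ L) y) + \sum_(l < L.+1) (D l y - A x l y)) ^+ 2)%:E)); last first.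
    move=> y _; congr (_ ^+ 2)%:E; rewrite sumrB sum_level_difference//= /multilevel_approx.
    by rewrite addrA subrK.
  apply: le_trans (integral_sqrD_le _ _ _) _.
  - by apply: measurable_funB => //; exact: mf.
  - by apply: measurable_sum => l; exact: measurable_funB.
  apply: leeD; first by rewrite EFinM lee_pmul2l.
  rewrite lee_pmul2l//.
  apply: le_trans (integral_sqr_sum_le _ _ e0) _; first by move=> l; exact: measurable_funB.
  by apply: lee_sum => l _; apply: lee_pmul => //; apply: integral_ge0 => y _; rewrite lee_fin sqr_ge0.
apply: le_trans (le_integral_measurable_free P _ le1) _.
  by move=> x; rewrite sqre_ge0.
have c20 : (0 <= (2 * c ^+ 2)%:E)%E by rewrite lee_fin mulr_ge0// sqr_ge0.
have mS2 : measurable_fun setT (fun x => 2%:E * S x)%E by exact: emeasurable_funM.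
have S20 x : [set: Omega] x -> (0 <= 2%:E * S x)%E by move=> _; exact: mule_ge0.
rewrite (ge0_integralD P measurableT (fun x _ => c20) _ S20 mS2)//.
have S0' x : [set: Omega] x -> (0 <= S x)%E by [].
rewrite (ge0_integralZl P measurableT mS S0')// /S.
rewrite ge0_integral_sum//.
rewrite [leRHS]EFinD; apply: leeD.
  by rewrite integral_cst// -[leRHS]mule1 lee_pmul//; exact: probability_le1.
apply: (@le_trans _ _ (2%:E * \sum_l (E / e l * (73 * e l ^+ 2))%:E)%E).
  rewrite lee_pmul2l//; apply: lee_sum => l _.
  have H0' x : [set: Omega] x -> (0 <= H l x)%E by [].
  rewrite (ge0_integralZl P measurableT (mH l) H0' (c0 l)) [leRHS]EFinM.
  by apply: lee_pmul => //; exact: integral_ge0.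
rewrite sumEFin -EFinM lee_fin -/E le_eqVlt; apply/orP; left; apply/eqP.
rewrite (eq_bigr (fun l => 73 * E * e l)) -?mulr_sumr -/E; last first.
  by move=> l _; field; rewrite gt_eqF.
by ring.
Qed.

End multilevel_error.

(** * Assembly for polynomial spaces *)

Lemma polynomial_stabilized_error (R : realType) (dim : option nat)
    (Gamma : set (Rdim R dim)) (y0 : Gamma) (mu : probability (domain y0) R)
    (V : set (domain y0 -> R)) (n : nat) (B : 'I_n -> domain y0 -> R) :
  downward_closed_polynomial_space V -> V `<=` [set v | v \in Lfun mu 2%:E] ->
  orthonormal_basis mu V B ->
  [/\ V (cst 0),
    forall w N (ys : 'I_N -> domain y0) g,
      measurable_fun setT (stabilized_least_squares mu V B w ys g) &
    forall d (Omega : measurableType d) (P : probability Omega R) N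
        (Y : 'I_N -> {RV P >-> domain y0}) (g v0 : domain y0 -> R), (0 < N)%N ->
      iid_optimal_samples mu B Y -> g \in Lfun mu 2%:E -> V v0 ->
      exists H : Omega -> \bar R, [/\ measurable_fun setT H, forall x, (0 <= H x)%E,
        forall x, (\int[mu]_y ((g y - stabilized_least_squares mu V B (opt_weight B)
          (fun j => Y j x) g y) ^+ 2)%:E <= H x)%E &
        (\int[P]_x H x <= 18%:E * \int[mu]_y ((g y - v0 y) ^+ 2)%:E +
          \int[mu]_y (g y ^+ 2)%:E * (3 * n%:R * expR (- (N%:R / (16 * n%:R))))%:E)%E]].
Proof.
move=> [I [finI _ ->]] VL2 orth; have [BV orthoB _] := orth.
have [Z [mZ Z0 VZ]] := monomial_span_null_set finI orth.
have VB c := monomial_span_lin_comb c BV.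
split.
- exact: (V_cst0 VB).
- move=> w N ys g.
  by have := sub_Lfun_mfun (VL2 _ (stabilized_in_V mu VB w ys g)); rewrite inE.
- move=> d Omega P N Y g v0 N0 iidY gL2 Vv0.
  exact: (stabilized_least_squares_error VL2 orthoB VB mZ Z0 VZ N0 iidY gL2 Vv0).
Qed.

Theorem theorem4p2 (R : realType)
    (C0 C1 C2 beta_s beta_w sigma alpha gamma K : R) :
  0 < C0 -> 0 < C1 -> 0 < C2 ->
  0 < beta_s -> beta_s <= beta_w -> 0 < sigma -> 0 < alpha -> 0 < gamma ->
  exists c C : R, [/\ 0 < c, 0 < C &
  forall (dim : option nat) (Gamma : set (Rdim R dim)) (y0 : Gamma)
    (mu : probability (domain y0) R)
    (F : normedModType R) (ev : {linear F -> (domain y0 -> R^o)})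
    (f_inf : F) (f : R -> F) (work : R -> R)
    (V : R -> set (domain y0 -> R)) (dimV : R -> nat)
    (B : forall m : R, 'I_(dimV m) -> domain y0 -> R),
  (forall g : F, continuous (ev g : domain y0 -> R)) ->
  continuously_embedded mu ev ->
  `|f_inf| <= K -> (L2norm mu (ev f_inf) <= K%:E)%E ->
  (forall m : R, 1 <= m ->
    [/\ downward_closed_polynomial_space (V m),
        V m `<=` [set v | v \in Lfun mu 2%:E]
      & orthonormal_basis mu (V m) (@B m)]) ->
  assumption_A1 mu ev C0 beta_s beta_w f_inf f ->
  assumption_A2 mu ev C1 sigma alpha V dimV ->
  assumption_A3 C2 gamma work ->
  forall eps : R, 0 < eps -> eps <= c ->
  exists L : nat, forall N : nat -> nat,
    admissible_sample_sizes alpha beta_s beta_w gamma sigma L N ->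
    (forall (d : measure_display) (Omega : measurableType d)
        (P : probability Omega R)
        (Y : forall k : nat, 'I_(N k) -> {RV P >-> domain y0}),
      (forall k : nat, (k <= L)%N ->
        iid_optimal_samples mu
          (@B (level_m alpha beta_s beta_w gamma sigma L k)) (Y k)) ->
      (mean_square_error mu alpha beta_s beta_w gamma sigma V B
         (fun n => ev (f n)) L (ev f_inf) Y <= (eps ^+ 2)%:E)%E)
    /\
    multilevel_work beta_s gamma work L N <=
      C * eps `^ (- lambda alpha beta_s beta_w gamma sigma)
        * `|ln eps| `^ (log_exponent alpha beta_s beta_w gamma sigma)
        * ln `|ln eps|].
Proof.
move=> C00 C10 C20 s0 sw sigma0 alpha0 gamma0.
have sa0 : 0 < sigma + alpha by exact: addr_gt0.
have gs0 : 0 < gamma + beta_s by exact: addr_gt0.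
have w0 : 0 < beta_w by exact: lt_le_trans sw.
pose r2 := beta_s / (gamma + beta_s).
(* [A] bounds the [F]-norms of the level differences relative to [expR (- (l * r2))]: [|K| + C0]
   serves for [l = 0], where the difference is a whole [f_n], and [2 * C0 * expR r2] for two
   consecutive errors. *)
pose A := 2 * C0 * expR r2 + `|K| + C0.
have A0 : 0 < A.
  by rewrite /A; have := normr_ge0 K; have := mulr_gt0 C00 (expR_gt0 r2); lra.
have CA0 : 0 < C1 * A by exact: mulr_gt0.
have [K2 K20 hK2] := sum_level_errors beta_w s0 sigma0 alpha0 gamma0.
have [K3 K30 hK3] := sum_level_works s0 sw sigma0 alpha0 gamma0.
(* Bounds the squared L2 norms of all level differences, for use on the failure event. *)
pose b2 := 4 * (C0 ^+ 2 + K ^+ 2).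
have b20 : 0 <= b2 by rewrite /b2; have := sqr_ge0 C0; have := sqr_ge0 K; lra.
pose dl := delta alpha beta_s beta_w gamma.
have dl0 : 0 <= dl.
  by rewrite divr_ge0 ?subr_ge0 ?mulr_ge0 ?(ltW alpha0) ?(ltW gs0).
(* Twice the largest decay exponent, per unit of [L], of the level errors, since failure must be
   negligible against their squares. *)
pose rho := 2 * (alpha * dl + alpha / (sigma + alpha) + r2).
have C31 : 0 <= 3 * C1 by rewrite mulr_ge0// ltW.
have C161 : 0 < 16 * C1 by rewrite mulr_gt0.
have [L0 hL0] := superexponential_decay rho (mulr_ge0 b20 C31) (exprn_gt0 2 CA0) C161.
(* The squares of 2 and 13 exceed the factors 2 and 146 of the mean square error. *)
pose Ke := 2 * C0 + 13 * (C1 * A * K2).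
have Ke0 : 0 < Ke by rewrite /Ke; have := mulr_gt0 CA0 K20; lra.
have [x0 [Cw [Cw0 hx]]] := exists_level s0 sw sigma0 alpha0 gamma0 L0 Ke0.
have [Kk KkE] : exists Kk, Kk = size_constant R by exists (size_constant R).
have Kk0 : 0 < Kk by rewrite KkE divr_gt0// subr_gt0 ln2_lt1.
pose Bk := `|ln Kk| + 1 + sigma + sigma / (sigma + alpha).
have ss0 : 0 < sigma / (sigma + alpha) by exact: divr_gt0.
have Bk0 : 0 < Bk by rewrite /Bk; have := normr_ge0 (ln Kk); lra.
(* For [eps] below this, [x = - ln eps] is positive, hence equal to [|ln eps|], and at least
   [x0]. *)
exists (expR (- (`|x0| + 1))), (2 * C2 * Kk * Bk * K3 * Cw); split.
- exact: expR_gt0.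
- by rewrite !mulr_gt0.
move=> dim Gamma y0 mu F ev f_inf f work V dimV B _ [evL2 _ _] fK fK2 hV A1 A2 A3.
move=> eps eps0 epsc.
pose x := - ln eps.
have xx0 : `|x0| + 1 <= x by rewrite /x lerNr -ler_expR lnK ?posrE.
have x0x : x0 <= x by apply: le_trans xx0; rewrite (le_trans (ler_norm x0))// lerDl.
have [L [LL0 herr hwork]] := hx x x0x.
exists L => N adm; have [L16 hdecay] := hL0 L LL0.
pose m_ := level_m alpha beta_s beta_w gamma sigma L.
pose n_ := level_n beta_s gamma.
pose lm k := log_scaleM alpha beta_s beta_w gamma sigma L + k%:R / (sigma + alpha).
have lM0 : 0 <= log_scaleM alpha beta_s beta_w gamma sigma L by exact: log_scaleM_ge0.
have lm0 k : 0 <= lm k by rewrite addr_ge0// divr_ge0// ltW.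
have mE k : m_ k = expR (lm k) by exact: level_mE.
have m1 k : 1 <= m_ k by rewrite mE -[leLHS]expR0 ler_expR.
have mpow k p : m_ k `^ p = expR (p * lm k) by rewrite mE -expRM mulrC.
have n1 l : 1 <= n_ l by rewrite -[leLHS]expR0 ler_expR divr_ge0// ltW.
have npow l p : n_ l `^ p = expR (p * (l%:R / (gamma + beta_s))) by rewrite -expRM mulrC.
have mu1 k : 1 <= m_ k `^ sigma.
  by rewrite mpow -[leLHS]expR0 ler_expR mulr_ge0// ltW.
have L1 : 0 < 1 + L%:R :> R by rewrite ltr_pwDl.
have lnL0 : 0 <= ln (1 + L%:R) :> R by rewrite ln_ge0// lerDl.
split; last first.
  have Nle k : (k <= L)%N -> (N k)%:R <= Kk * Bk * ((1 + L%:R) *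
      (1 + ln (1 + L%:R) + log_scaleM alpha beta_s beta_w gamma sigma L + k%:R) *
      expR (sigma * lm k)).
    move=> kL; apply: le_trans (sample_size_upper (mu1 k) (adm k kL)) _.
    rewrite mpow expRK -KkE.
    have -> : Kk * Bk * ((1 + L%:R) *
      (1 + ln (1 + L%:R) + log_scaleM alpha beta_s beta_w gamma sigma L + k%:R) *
      expR (sigma * lm k)) = Kk * (1 + L%:R) * expR (sigma * lm k) *
      (Bk * (1 + ln (1 + L%:R) + log_scaleM alpha beta_s beta_w gamma sigma L + k%:R)) by ring.
    rewrite ler_wpM2l ?mulr_ge0 ?expR_ge0 ?(ltW Kk0) ?(ltW L1)//.
    have -> : sigma * lm k = sigma * log_scaleM alpha beta_s beta_w gamma sigma L +
        sigma / (sigma + alpha) * k%:R by rewrite /lm; field; rewrite gt_eqF.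
    move: (log_scaleM _ _ _ _ _ _) lM0 => lM lM0.
    move: (ln (1 + L%:R)) lnL0 => lnL lnL0.
    have k0 : 0 <= k%:R :> R by [].
    have := ler_norm (ln Kk); have := normr_ge0 (ln Kk).
    rewrite /Bk; move: (`|ln Kk|) (ln Kk) => a b a0 ba.
    move: (sigma / (sigma + alpha)) ss0 => q q0.
    by clear - a0 ba q0 lM0 lnL0 k0 sigma0; nra.
  have wle l : (l <= L)%N -> work (n_ l) <= C2 * expR (gamma * (l%:R / (gamma + beta_s))).
    by move=> lL; rewrite -npow; exact: A3.
  (* The bound on the work of the finer function also covers the coarser one, hence the factor 2. *)
  pose G l := (N (L - l)%N)%:R * (2 * C2 * expR (gamma * (l%:R / (gamma + beta_s)))) : R.
  have Wle : multilevel_work beta_s gamma work L N <= \sum_(l < L.+1) G l.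
    rewrite /multilevel_work big_add1 /= big_mkord [leRHS]big_ord_recl /=.
    have E0 l := expR_gt0 (gamma * (l%:R / (gamma + beta_s))).
    apply: lerD.
      rewrite /G subn0 ler_wpM2l// (le_trans (wle 0%N (leq0n _)))//.
      by rewrite -mulrA ler_peMl// ?ler1n// ltW// mulr_gt0.
    apply: ler_sum => l _; rewrite /G ler_wpM2l//.
    have lL : (l < L)%N by [].
    have h1 := wle l.+1 lL; have h2 := wle l (ltnW lL).
    have h3 : C2 * expR (gamma * (l%:R / (gamma + beta_s))) <=
        C2 * expR (gamma * (l.+1%:R / (gamma + beta_s))).
      rewrite ler_wpM2l ?(ltW C20)// ler_expR ler_wpM2l ?(ltW gamma0)//.
      by rewrite ler_wpM2r ?invr_ge0 ?(ltW gs0)// ler_nat.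
    by rewrite /bump /= add1n; clear - h1 h2 h3; lra.
  apply: (le_trans Wle).
  apply: (@le_trans _ _ (2 * C2 * Kk * Bk * (K3 * (Cw *
      expR (lambda alpha beta_s beta_w gamma sigma * x) *
      x `^ log_exponent alpha beta_s beta_w gamma sigma * ln x)))); last first.
    have lnx : `|ln eps| = x by rewrite -normrN ger0_norm// -/x (le_trans _ xx0)// addr_ge0.
    rewrite lnx /powR (gt_eqF eps0).
    have -> : - lambda alpha beta_s beta_w gamma sigma * ln eps =
       lambda alpha beta_s beta_w gamma sigma * x by rewrite /x; ring.
    by rewrite le_eqVlt; apply/orP; left; apply/eqP; ring.
  have cst0 : 0 <= 2 * C2 * Kk * Bk by rewrite !mulr_ge0 ?ltW.
  apply: le_trans (ler_wpM2l cst0 (ler_wpM2l (ltW K30) hwork)).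
  rewrite [K3 * _]mulrA; apply: le_trans (ler_wpM2l cst0 (hK3 L)).
  rewrite mulr_sumr; apply: ler_sum => l _; rewrite /G expRD.
  have lL : (L - l <= L)%N by exact: leq_subr.
  have E0 := expR_ge0 (gamma * (l%:R / (gamma + beta_s))).
  apply: le_trans (ler_wpM2r _ (Nle _ lL)) _; first by rewrite !mulr_ge0 ?(ltW C20).
  by rewrite /lm le_eqVlt; apply/orP; left; apply/eqP; ring.
move=> d Omega P Y iidY.
have mev g : measurable_fun setT (ev g : domain y0 -> R).
  by have := sub_Lfun_mfun (evL2 g); rewrite inE.
pose g l := if l is l'.+1 then f (n_ l) - f (n_ l') else f (n_ 0%N).
have gE l : level_difference beta_s gamma (fun n => ev (f n)) l = ev (g l).
  by case: l => [//|l] /=; rewrite linearB.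
have sq1 n : 1 <= n -> (\int[mu]_y ((ev f_inf y - ev (f n) y) ^+ 2)%:E <= (C0 ^+ 2)%:E)%E.
  move=> n1'; have [_ h] := A1 n n1'.
  have := integral_sqr_le_L2norm (ltW C00) (le_trans h _).
  rewrite linearB; apply; rewrite lee_fin ler_piMr ?(ltW C00)//.
  have n0 : 0 < n by exact: lt_le_trans n1'.
  rewrite /powR (gt_eqF n0) -[leRHS]expR0 ler_expR mulNr oppr_le0.
  by rewrite mulr_ge0 ?(ltW w0)// ln_ge0.
have normg l : `|g l| <= A * expR (- (l%:R * r2)).
  have fn j : `|f_inf - f (n_ j)| <= C0 * expR (- (j%:R * r2)).
    have [h _] := A1 _ (n1 j); apply: le_trans h _.
    rewrite npow ler_wpM2l ?(ltW C00)// ler_expR le_eqVlt; apply/orP; left; apply/eqP.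
    by rewrite /r2; field; rewrite gt_eqF.
  case: l => [|l] /=.
    rewrite mul0r oppr0 expR0 mulr1.
    have -> : f (n_ 0%N) = f_inf - (f_inf - f (n_ 0%N)) by rewrite subKr.
    apply: le_trans (ler_normB _ _) _; have := fn 0%N; rewrite mul0r oppr0 expR0 mulr1.
    have := ler_norm K; have := mulr_gt0 C00 (expR_gt0 r2).
    by rewrite /A; clear - fK; lra.
  have -> : f (n_ l.+1) - f (n_ l) = (f_inf - f (n_ l)) - (f_inf - f (n_ l.+1)).
    by rewrite opprB [RHS]addrC subrKA.
  apply: le_trans (ler_normB _ _) _.
  have e1 : expR (- (l%:R * r2)) = expR r2 * expR (- (l.+1%:R * r2)).
    by rewrite -expRD; congr expR; rewrite -natr1; ring.
  have r20 : 0 < r2 by exact: divr_gt0.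
  have e2 : 1 <= expR r2 by rewrite -[leLHS]expR0 ler_expR ltW.
  have := fn l; have := fn l.+1; rewrite e1.
  move: (expR (- (l.+1%:R * r2))) (expR_ge0 (- (l.+1%:R * r2))) => E E0 h1 h2.
  apply: le_trans (lerD h2 h1) _.
  have h3 : C0 * E <= C0 * (expR r2 * E).
    by rewrite ler_wpM2l ?(ltW C00)// ler_peMl.
  have h4 : 0 <= (`|K| + C0) * E by rewrite mulr_ge0// addr_ge0// ltW.
  by rewrite /A; clear - h3 h4; lra.
have sqg l : (\int[mu]_y ((ev (g l) y) ^+ 2)%:E <= b2%:E)%E.
  have two0 : (0 <= 2%:E :> \bar R)%E by [].
  have le2 (a b : R) (I J : \bar R) : (I <= a%:E)%E -> (J <= b%:E)%E -> 2 * a + 2 * b <= b2 ->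
      (2%:E * I + 2%:E * J <= b2%:E)%E.
    move=> Ia Jb ab; apply: (@le_trans _ _ (2 * a + 2 * b)%:E); last by rewrite lee_fin.
    by rewrite [leRHS]EFinD; apply: leeD; rewrite EFinM lee_pmul2l.
  have K0 : 0 <= K by exact: le_trans fK.
  have sqK := integral_sqr_le_L2norm K0 fK2.
  case: l => [|l] /=.
    rewrite (eq_integral (fun y => ((ev f_inf y - (ev f_inf y - ev (f (n_ 0%N)) y)) ^+ 2)%:E)); last first.
      by move=> y _; rewrite subKr.
    apply: le_trans (integral_sqrB_le mu (mev _) (measurable_funB (mev _) (mev _))) _.
    apply: (le2 _ _ _ _ sqK (sq1 _ (n1 0%N))).
    by rewrite /b2; have := sqr_ge0 C0; have := sqr_ge0 K; clear; lra.
  rewrite (eq_integral (fun y => (((ev f_inf y - ev (f (n_ l)) y) -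
      (ev f_inf y - ev (f (n_ l.+1)) y)) ^+ 2)%:E)); last first.
    by move=> y _; rewrite linearB /=; congr (_ ^+ 2)%:E; rewrite /= opprB [RHS]addrC subrKA.
  apply: le_trans (integral_sqrB_le mu (measurable_funB (mev _) (mev _)) (measurable_funB (mev _) (mev _))) _.
  apply: (le2 _ _ _ _ (sq1 _ (n1 l)) (sq1 _ (n1 l.+1))).
  by rewrite /b2; have := sqr_ge0 K; clear; lra.
(* The a priori projection error of a level, which is also its weight in the Cauchy-Schwarz
   inequality: the rate in [m] times the [F]-norm bound of the difference. *)
pose e l := C1 * A * expR (- (alpha * lm (L - l)%N) - l%:R * r2).
have e0 l : 0 < e l by rewrite mulr_gt0// expR_gt0.
have stab k := (let: And3 h1 h2 h3 := hV (m_ k) (m1 k) in polynomial_stabilized_error h1 h2 h3).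
have /choice[H hH] : forall l : 'I_L.+1, exists H : Omega -> \bar R,
   [/\ measurable_fun setT H, forall w, (0 <= H w)%E,
     forall w, (\int[mu]_y ((level_difference beta_s gamma (fun n => ev (f n)) l y -
       stabilized_least_squares mu (V (m_ (L - l)%N)) (@B (m_ (L - l)%N))
         (opt_weight (@B (m_ (L - l)%N))) (fun j => Y (L - l)%N j w)
         (level_difference beta_s gamma (fun n => ev (f n)) l) y) ^+ 2)%:E <= H w)%E &
     (\int[P]_w H w <= (73 * e l ^+ 2)%:E)%E].
  move=> l; rewrite gE; set k := (L - l)%N.
  have kL : (k <= L)%N by exact: leq_subr.
  have [V0 _ herrH] := stab k.
  have N0 := sample_size_gt0 (mu1 k) (adm k kL).
  have [dimle supe] := A2 (m_ k) (m1 k).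
  have ge : C1 * m_ k `^ (- alpha) * `|g l| <= e l.
    rewrite mpow mulNr /e expRD.
    have -> : C1 * A * (expR (- (alpha * lm k)) * expR (- (l%:R * r2))) =
      C1 * expR (- (alpha * lm k)) * (A * expR (- (l%:R * r2))) by ring.
    by rewrite ler_wpM2l ?normg// mulr_ge0 ?expR_ge0// ltW.
  have [v0 Vv0 v0e] := best_approximation V0 (e0 l) supe ge.
  have [H [mH H0 leH EH]] := herrH _ _ P _ (Y k) (ev (g l)) v0 N0 (iidY k kL) (evL2 _) Vv0.
  exists H; split => //.
  apply: (le_trans EH).
  have n0 : (0 < dimV (m_ k))%N by exact: optimal_samples_dim_gt0 ((iidY k kL).2 (Ordinal N0)).
  have pf := failure_probability_le (mu1 k) (adm k kL) C10 n0 dimle L16.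
  set p := 3 * _ * _ in pf *.
  have p0 : 0 <= p by rewrite !mulr_ge0 ?expR_ge0.
  (* The decay in [L] beats the lower bound for [e l ^+ 2] that is uniform in [l]. *)
  have bp : b2 * p <= e l ^+ 2.
    apply: le_trans (ler_wpM2l b20 pf) _; rewrite mulrA.
    rewrite [b2 * _]mulrA in hdecay *; apply: (le_trans hdecay).
    rewrite /e [leRHS]exprMn ler_wpM2l ?sqr_ge0// -expRM_natl ler_expR.
    have lML : log_scaleM alpha beta_s beta_w gamma sigma L <= L%:R * dl.
      by rewrite /log_scaleM; case: ifP => // _; rewrite mulr_ge0.
    have h1 : alpha * lm k <= alpha * (L%:R * dl + L%:R / (sigma + alpha)).
      rewrite ler_wpM2l ?(ltW alpha0)// lerD// ler_wpM2r ?invr_ge0 ?(ltW sa0)//.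
      by rewrite ler_nat.
    have h2 : l%:R * r2 <= L%:R * r2.
      by rewrite ler_wpM2r ?divr_ge0 ?(ltW s0) ?(ltW gs0)// ler_nat -ltnS.
    have -> : rho * L%:R = 2 * (alpha * (L%:R * dl + L%:R / (sigma + alpha)) + L%:R * r2).
      by rewrite /rho; ring.
    by clear - h1 h2; lra.
  (* The factor 18 of the fit meets a near-best [v0] of squared error [4 * e l ^+ 2]; the failure
     term adds one more [e l ^+ 2]. *)
  have -> : (73 * e l ^+ 2)%:E = (18 * (4 * e l ^+ 2) + e l ^+ 2)%:E by congr EFin; ring.
  rewrite [leRHS]EFinD; apply: leeD; first by rewrite EFinM lee_pmul2l.
  apply: (@le_trans _ _ (b2%:E * p%:E)%E); last by rewrite -EFinM lee_fin.
  by apply: lee_wpmul2r; [rewrite lee_fin|exact: sqg].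
pose r := convergence_rate alpha beta_s beta_w gamma sigma.
pose psi := error_factor alpha beta_s gamma sigma L.
have tail : (\int[mu]_y ((ev f_inf y - ev (f (n_ L)) y) ^+ 2)%:E <=
    ((C0 * expR (- (L%:R * (beta_w / (gamma + beta_s))))) ^+ 2)%:E)%E.
  have [_ h] := A1 _ (n1 L).
  have -> : C0 * expR (- (L%:R * (beta_w / (gamma + beta_s)))) = C0 * n_ L `^ (- beta_w).
    by rewrite npow; congr (_ * expR _); ring.
  have := integral_sqr_le_L2norm _ h; rewrite linearB; apply.
  by rewrite mulr_ge0 ?powR_ge0// ltW.
have main := @multilevel_mean_square_error _ _ _ mu alpha beta_s beta_w gamma sigma V dimV B
  (fun n => ev (f n)) (ev f_inf) L N _ Omega P Y _ (fun l => e l) H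
  (fun l _ => mev (f (n_ l))) (mev f_inf) _ (fun l => e0 l) tail.
apply: le_trans (main _ _ _ _ _) _.
- by move=> w l; have [_ h _] := stab (L - l)%N; exact: h.
- by move=> l; case: (hH l).
- by move=> l w; case: (hH l).
- by move=> w l; case: (hH l).
- by move=> l; case: (hH l).
rewrite lee_fin.
have epsE : eps = expR (- x) by rewrite /x opprK lnK ?posrE.
have sume : \sum_(l < L.+1) e l <= C1 * A * (K2 * psi * expR (- (L%:R * r))).
  rewrite /e -mulr_sumr ler_wpM2l ?(ltW CA0)//; exact: (hK2 L).
have psi1 : 1 <= psi.
  by rewrite /psi /error_factor; case: ifP => // _; rewrite lerDl.
pose w := psi * expR (- (L%:R * r)).
have w'0 : 0 <= w by rewrite mulr_ge0 ?expR_ge0// (le_trans _ psi1).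
(* The tail decays at least as fast as the sum of the level errors. *)
have cle : C0 * expR (- (L%:R * (beta_w / (gamma + beta_s)))) <= C0 * w.
  rewrite ler_wpM2l ?(ltW C00)// /w -[leLHS]mul1r ler_pM ?expR_ge0// ler_expR lerN2.
  by rewrite ler_wpM2l//; exact: convergence_rate_le.
have sume' : \sum_(l < L.+1) e l <= C1 * A * K2 * w by rewrite /w !mulrA in sume *.
have Kew : Ke * w <= eps by rewrite epsE /w mulrA; exact: herr.
apply: (@le_trans _ _ ((Ke * w) ^+ 2)); last first.
  have Kw0 : 0 <= Ke * w by rewrite mulr_ge0// ltW.
  by rewrite lerXn2r ?nnegrE ?(ltW eps0).
have Cw'0 : 0 <= C0 * w by exact: mulr_ge0 (ltW C00) w'0.
have Kw'0 : 0 <= C1 * A * K2 * w by exact: mulr_ge0 (ltW (mulr_gt0 CA0 K20)) w'0.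
have sq1' : (C0 * expR (- (L%:R * (beta_w / (gamma + beta_s))))) ^+ 2 <= (C0 * w) ^+ 2.
  by rewrite lerXn2r ?nnegrE//; exact: mulr_ge0 (ltW C00) (expR_ge0 _).
have sq2' : (\sum_(l < L.+1) e l) ^+ 2 <= (C1 * A * K2 * w) ^+ 2.
  by rewrite lerXn2r ?nnegrE//; apply: sumr_ge0 => l _; exact: ltW.
have ab0 : 0 <= (C0 * w) * (C1 * A * K2 * w) by exact: mulr_ge0.
have -> : (Ke * w) ^+ 2 = 4 * (C0 * w) ^+ 2 + 52 * ((C0 * w) * (C1 * A * K2 * w)) +
   169 * (C1 * A * K2 * w) ^+ 2 by rewrite /Ke; ring.
have := sqr_ge0 (C0 * w); have := sqr_ge0 (C1 * A * K2 * w).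
by clear - sq1' sq2' ab0; lra.
Qed.
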